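(* For a finite group $G$, there is an isomorphism of abelian groups $$\mathrm{Pic}(A(G))\cong\mathrm{Pic}(\mathrm{Mack}_G).$$
   Context: $A(G)$ is the Burnside ring of $G$ (Grothendieck completion of the semiring of isomorphism classes of finite $G$-sets under disjoint union and cartesian product), and $\mathrm{Pic}(A(G))$ is the group of isomorphism classes of invertible $A(G)$-modules under $\otimes_{A(G)}$. $\mathrm{Mack}_G$ is the category of $G$-Mackey functors, i.e. additive functors $\mathcal{B}_G^{op}\to\mathrm{Ab}$ where $\mathcal{B}_G$ is the Burnside category (finite $G$-sets, with morphisms the group completions of the monoids of equivalence classes of spans). It is symmetric monoidal under the box product $\boxtimes$ (Day convolution of the cartesian product of $G$-sets with the tensor product of abelian groups), with unit the Burnside Mackey functor $\underline{A}$, $\underline{A}(G/H)=A(H)$; $\mathrm{Pic}(\mathrm{Mack}_G)$ is the group of isomorphism classes of $\boxtimes$-invertible Mackey functors under $\boxtimes$. *)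

(* Defs.v *)
From HB Require Import structures.
From mathcomp Require Import all_boot all_order all_algebra all_fingroup.
From mathcomp Require Import generic_quotient boolp.

Set Implicit Arguments.
Unset Strict Implicit.
Unset Printing Implicit Defensive.

Import GRing.Theory.
Local Open Scope quotient_scope.
Local Open Scope ring_scope.

Record eqvRel (T : Type) := EqvRel {
  eqv :> T -> T -> Prop;
  eqv_refl : forall x, eqv x x;
  eqv_sym : forall x y, eqv x y -> eqv y x;
  eqv_trans : forall x y z, eqv x y -> eqv y z -> eqv x z }.

Section Quot.
Variables (T : choiceType) (E : eqvRel T).

Definition eqv_rel : rel T := fun x y => `[< E x y >].

Lemma eqv_rel_refl : reflexive eqv_rel.
Proof. by move=> x; apply/asboolP/eqv_refl. Qed.
Lemma eqv_rel_sym : symmetric eqv_rel.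
Proof. by move=> x y; apply/asboolP/asboolP; apply: eqv_sym. Qed.
Lemma eqv_rel_trans : transitive eqv_rel.
Proof.
by move=> y x z /asboolP xy /asboolP yz; apply/asboolP/(eqv_trans xy yz).
Qed.

Canonical eqv_equiv := EquivRel eqv_rel eqv_rel_refl eqv_rel_sym eqv_rel_trans.

Definition quot := {eq_quot eqv_equiv}.
HB.instance Definition _ := Choice.on quot.

Definition cls (x : T) : quot := \pi_quot x.
Definition rep (c : quot) : T := repr c.

Lemma repK c : cls (rep c) = c. Proof. exact: reprK. Qed.
Lemma clsP x y : cls x = cls y <-> E x y.
Proof.
split; first by move=> /eqmodP /asboolP.
by move=> xy; apply/eqmodP/asboolP.
Qed.
Lemma cls_eq x y : E x y -> cls x = cls y. Proof. by move/clsP. Qed.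
Lemma rep_cls x : E (rep (cls x)) x. Proof. by apply/clsP; rewrite repK. Qed.
Lemma quotW (P : quot -> Prop) : (forall x, P (cls x)) -> forall c, P c.
Proof. by move=> h c; rewrite -[c]repK. Qed.

End Quot.
Arguments quot {T} E.
Arguments cls {T E} x.
Arguments rep {T E} c.

(** [presented rel] is the abelian group generated by [T] subject to [rel]:
    formal expressions modulo the least congruence that contains [rel] and the
    axioms of abelian groups. *)
Inductive zterm (T : Type) :=
  | ZGen of T | ZZero | ZAdd of zterm T & zterm T | ZOpp of zterm T.
Arguments ZZero {T}.

Section Presented.
Variables (T : Type) (rel : zterm T -> zterm T -> Prop).

Inductive zeq : zterm T -> zterm T -> Prop :=
  | zeq_rel a b : rel a b -> zeq a b
  | zeq_refl a : zeq a a
  | zeq_sym a b : zeq a b -> zeq b a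
  | zeq_trans a b c : zeq a b -> zeq b c -> zeq a c
  | zeq_add a a' b b' : zeq a a' -> zeq b b' -> zeq (ZAdd a b) (ZAdd a' b')
  | zeq_opp a a' : zeq a a' -> zeq (ZOpp a) (ZOpp a')
  | zeq_addA a b c : zeq (ZAdd a (ZAdd b c)) (ZAdd (ZAdd a b) c)
  | zeq_addC a b : zeq (ZAdd a b) (ZAdd b a)
  | zeq_add0 a : zeq (ZAdd ZZero a) a
  | zeq_addN a : zeq (ZAdd (ZOpp a) a) ZZero.

HB.instance Definition _ := gen_eqMixin (zterm T).
HB.instance Definition _ := gen_choiceMixin (zterm T).

Definition zeqv := EqvRel zeq_refl zeq_sym zeq_trans.

Definition presented := quot zeqv.
HB.instance Definition _ := Choice.on presented.

Definition pres_add (x y : presented) : presented := cls (ZAdd (rep x) (rep y)).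
Definition pres_opp (x : presented) : presented := cls (ZOpp (rep x)).

Lemma pres_addE a b : pres_add (cls a) (cls b) = cls (ZAdd a b).
Proof. by apply: cls_eq; apply: zeq_add; apply: (rep_cls zeqv). Qed.
Lemma pres_oppE a : pres_opp (cls a) = cls (ZOpp a).
Proof. by apply: cls_eq; apply: zeq_opp; apply: (rep_cls zeqv). Qed.

Lemma pres_addA : associative pres_add.
Proof.
elim/quotW=> a; elim/quotW=> b; elim/quotW=> c.
by rewrite !pres_addE; apply/cls_eq/zeq_addA.
Qed.
Lemma pres_addC : commutative pres_add.
Proof.
by elim/quotW=> a; elim/quotW=> b; rewrite !pres_addE; apply/cls_eq/zeq_addC.
Qed.
Lemma pres_add0 : left_id (cls ZZero) pres_add.
Proof. by elim/quotW=> a; rewrite !pres_addE; apply/cls_eq/zeq_add0. Qed.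
Lemma pres_addN : left_inverse (cls ZZero) pres_opp pres_add.
Proof.
by elim/quotW=> a; rewrite pres_oppE !pres_addE; apply/cls_eq/zeq_addN.
Qed.

HB.instance Definition _ := GRing.isZmodule.Build presented
  pres_addA pres_addC pres_add0 pres_addN.

Definition pcls (a : zterm T) : presented := cls a.
Definition pgen (t : T) : presented := pcls (ZGen t).

Lemma pclsD a b : pcls (ZAdd a b) = pcls a + pcls b.
Proof. by symmetry; apply: pres_addE. Qed.
Lemma pclsN a : pcls (ZOpp a) = - pcls a.
Proof. by symmetry; apply: pres_oppE. Qed.
Lemma pcls0 : pcls ZZero = 0. Proof. by []. Qed.

Lemma pres_ind (P : presented -> Prop) :
  (forall t, P (pgen t)) -> P 0 -> (forall x y, P x -> P y -> P (x + y)) ->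
  (forall x, P x -> P (- x)) -> forall x, P x.
Proof.
move=> Pg P0 PD PN; elim/quotW=> a; rewrite -/(pcls a); elim: a => [t||a Pa b Pb|a Pa].
- exact: Pg.
- exact: P0.
- by rewrite pclsD; apply: PD.
- by rewrite pclsN; apply: PN.
Qed.

Section Lift.
Variables (V : zmodType) (phi : T -> V).

Fixpoint zeval (a : zterm T) : V :=
  match a with
  | ZGen t => phi t
  | ZZero => 0
  | ZAdd a b => zeval a + zeval b
  | ZOpp a => - zeval a
  end.

Hypothesis phi_rel : forall a b, rel a b -> zeval a = zeval b.

Lemma zeval_eq a b : zeq a b -> zeval a = zeval b.
Proof.
elim=> //=.
- by move=> ? ? ? _ -> _ ->.
- by move=> ? ? ? ? _ -> _ ->.
- by move=> ? ? _ ->.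
- by move=> *; rewrite addrA.
- by move=> *; rewrite addrC.
- by move=> *; rewrite add0r.
- by move=> *; rewrite addNr.
Qed.

Definition pres_lift_fun (x : presented) : V := zeval (rep x).

Lemma pres_lift_cls a : pres_lift_fun (pcls a) = zeval a.
Proof. by apply: zeval_eq; apply: (rep_cls zeqv). Qed.

Lemma pres_lift_additive : zmod_morphism pres_lift_fun.
Proof.
elim/quotW=> a; elim/quotW=> b; rewrite -!/(pcls _).
by rewrite -pclsN -pclsD !pres_lift_cls.
Qed.

Definition pres_lift : {additive presented -> V} :=
  HB.pack pres_lift_fun (GRing.isZmodMorphism.Build _ _ _ pres_lift_additive).

Lemma pres_liftE t : pres_lift (pgen t) = phi t.
Proof. exact: (pres_lift_cls (ZGen t)). Qed.

End Lift.

Lemma pres_ext (V : zmodType) (f g : {additive presented -> V}) :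
  (forall t, f (pgen t) = g (pgen t)) -> f =1 g.
Proof.
move=> fg; apply: pres_ind => //; first by rewrite !raddf0.
  by move=> x y; rewrite !raddfD => -> ->.
by move=> x; rewrite !raddfN => ->.
Qed.

End Presented.
Arguments pgen {T rel} t.

(** [groth M] is the group completion of the commutative monoid [M]; it is made
    a ring below when [M] is a commutative semiring. *)
Section Groth.
Variable M : nmodType.

Definition groth_eq (x y : M * M) :=
  exists k, x.1 + y.2 + k = y.1 + x.2 + k.

Lemma groth_refl x : groth_eq x x. Proof. by exists 0. Qed.
Lemma groth_sym x y : groth_eq x y -> groth_eq y x.
Proof. by case=> k e; exists k. Qed.
Lemma groth_trans x y z : groth_eq x y -> groth_eq y z -> groth_eq x z.
Proof.
case: x y z => [a b] [c d] [e f] [k /= E1] [l /= E2]; exists (c + d + k + l).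
transitivity ((a + d + k) + (c + f + l)).
  by rewrite [RHS](AC (3*3) (1*5*(4*2*3*6))).
by rewrite E1 E2 [LHS](AC (3*3) (4*2*(1*5*3*6))).
Qed.

Definition groth_eqv := EqvRel groth_refl groth_sym groth_trans.
Definition groth := quot groth_eqv.
HB.instance Definition _ := Choice.on groth.

Definition gpair (a b : M) : groth := cls (a, b).
Definition gadd (x y : groth) : groth :=
  gpair ((rep x).1 + (rep y).1) ((rep x).2 + (rep y).2).
Definition gopp (x : groth) : groth := gpair (rep x).2 (rep x).1.

Lemma gpairP a b c d : gpair a b = gpair c d <-> exists k, a + d + k = c + b + k.
Proof. exact: clsP. Qed.

Lemma gaddE a b c d : gadd (gpair a b) (gpair c d) = gpair (a + c) (b + d).
Proof.
apply/gpairP => /=.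
have [k] := rep_cls (groth_eqv) (a, b).
have [l] := rep_cls (groth_eqv) (c, d).
rewrite -/(gpair a b) -/(gpair c d) /=.
case: (rep (gpair a b)) (rep (gpair c d)) => [a' b'] [c' d'] /= E1 E2.
exists (k + l).
transitivity ((a' + b + k) + (c' + d + l)).
  by rewrite [RHS](AC (3*3) (1*4*(2*5)*(3*6))).
by rewrite E1 E2 [LHS](AC (3*3) (1*4*(2*5)*(3*6))).
Qed.

Lemma goppE a b : gopp (gpair a b) = gpair b a.
Proof.
apply/gpairP => /=; have [k] := rep_cls (groth_eqv) (a, b).
rewrite -/(gpair a b) /=; case: (rep (gpair a b)) => [a' b'] /= e.
by exists k; rewrite [b' + a]addrC [b + a']addrC e.
Qed.

Lemma gpairW (P : groth -> Prop) : (forall a b, P (gpair a b)) -> forall x, P x.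
Proof. by move=> h; elim/quotW=> -[a b]; apply: h. Qed.

Lemma gaddA : associative gadd.
Proof.
elim/gpairW=> a b; elim/gpairW=> c d; elim/gpairW=> e f.
by rewrite !gaddE !addrA.
Qed.
Lemma gaddC : commutative gadd.
Proof.
elim/gpairW=> a b; elim/gpairW=> c d.
by rewrite !gaddE [a + c]addrC [b + d]addrC.
Qed.
Lemma gadd0 : left_id (gpair 0 0) gadd.
Proof. by elim/gpairW=> a b; rewrite gaddE !add0r. Qed.
Lemma gaddN : left_inverse (gpair 0 0) gopp gadd.
Proof.
elim/gpairW=> a b; rewrite goppE gaddE; apply/gpairP.
by exists 0; rewrite !addr0 add0r addrC.
Qed.

HB.instance Definition _ := GRing.isZmodule.Build groth gaddA gaddC gadd0 gaddN.

Lemma gpairD a b c d : gpair a b + gpair c d = gpair (a + c) (b + d).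
Proof. exact: gaddE. Qed.
Lemma gpairN a b : - gpair a b = gpair b a.
Proof. exact: goppE. Qed.

Definition gin (a : M) : groth := gpair a 0.

Lemma ginD a b : gin (a + b) = gin a + gin b.
Proof. by rewrite gpairD addr0. Qed.
Lemma gin0 : gin 0 = 0. Proof. by []. Qed.
Lemma gpairE a b : gpair a b = gin a - gin b.
Proof. by rewrite gpairN gpairD addr0 add0r. Qed.
Lemma gin_eqP a b : gin a = gin b <-> exists k, a + k = b + k.
Proof.
by rewrite gpairP; split=> -[k e]; exists k; move: e; rewrite !addr0.
Qed.

Lemma grothW (P : groth -> Prop) :
  (forall a, P (gin a)) -> (forall x y, P x -> P y -> P (x - y)) ->
  forall x, P x.
Proof. by move=> Pg PB; elim/gpairW=> a b; rewrite gpairE; apply: PB. Qed.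

End Groth.

(** The bi-additive extension of [f], see [glift2_gin]; the lock only prevents
    unification from unfolding it to a sum. *)
Section GrothLift2.
Variables (M N : nmodType) (V : zmodType) (f : M -> N -> V).

Definition glift2 (x : groth M) (y : groth N) : V :=
  locked (f (rep x).1 (rep y).1 + f (rep x).2 (rep y).2
          - (f (rep x).1 (rep y).2 + f (rep x).2 (rep y).1)).

Hypotheses (fDl : forall a b c, f (a + b) c = f a c + f b c)
           (fDr : forall a b c, f a (b + c) = f a b + f a c).

Lemma glift2_pair a b c d :
  glift2 (gpair a b) (gpair c d) = f a c + f b d - (f a d + f b c).
Proof.
rewrite /glift2 -lock.
have [k] := rep_cls (groth_eqv M) (a, b).
have [l] := rep_cls (groth_eqv N) (c, d).
rewrite -/(gpair a b) -/(gpair c d) /=.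
case: (rep (gpair a b)) (rep (gpair c d)) => [a' b'] [c' d'] /= E1 E2.
have FA z : f a' z - f b' z = f a z - f b z.
  apply/eqP; rewrite subr_eq addrAC eq_sym subr_eq eq_sym; apply/eqP.
  by apply: (addIr (f k z)); rewrite -!fDl E2.
have FC z : f z c' - f z d' = f z c - f z d.
  apply/eqP; rewrite subr_eq addrAC eq_sym subr_eq eq_sym; apply/eqP.
  by apply: (addIr (f z l)); rewrite -!fDr E1.
transitivity ((f a' c' - f b' c') - (f a' d' - f b' d')).
  by rewrite !opprD !opprK [LHS](AC (2*2) (1*4*(3*2))).
rewrite !FA; transitivity ((f a c' - f a d') - (f b c' - f b d')).
  by rewrite !opprD !opprK [LHS](AC (2*2) (1*3*(2*4))).
by rewrite !FC !opprD !opprK [LHS](AC (2*2) (1*4*(2*3))).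
Qed.

Lemma glift2Dl x y z : glift2 (x + y) z = glift2 x z + glift2 y z.
Proof.
elim/gpairW: x => a b; elim/gpairW: y => c d; elim/gpairW: z => e g.
rewrite gpairD !glift2_pair !fDl !opprD.
by rewrite [RHS](AC ((2*2)*(2*2)) ((1*5)*(2*6)*((3*7)*(4*8)))).
Qed.

Lemma glift2Dr x y z : glift2 x (y + z) = glift2 x y + glift2 x z.
Proof.
elim/gpairW: x => a b; elim/gpairW: y => c d; elim/gpairW: z => e g.
rewrite gpairD !glift2_pair !fDr !opprD.
by rewrite [RHS](AC ((2*2)*(2*2)) ((1*5)*(2*6)*((3*7)*(4*8)))).
Qed.

Lemma glift2Nl x y : glift2 (- x) y = - glift2 x y.
Proof.
apply: (addIr (glift2 x y)); rewrite -glift2Dl !addNr.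
by apply: (addIr (glift2 0 y)); rewrite -glift2Dl !add0r.
Qed.
Lemma glift2Nr x y : glift2 x (- y) = - glift2 x y.
Proof.
apply: (addIr (glift2 x y)); rewrite -glift2Dr !addNr.
by apply: (addIr (glift2 x 0)); rewrite -glift2Dr !add0r.
Qed.
Lemma glift2Bl x y z : glift2 (x - y) z = glift2 x z - glift2 y z.
Proof. by rewrite glift2Dl glift2Nl. Qed.
Lemma glift2Br x y z : glift2 x (y - z) = glift2 x y - glift2 x z.
Proof. by rewrite glift2Dr glift2Nr. Qed.

Lemma glift2_gin a b : glift2 (gin a) (gin b) = f a b.
Proof.
have f0l c : f 0 c = 0 by apply: (addIr (f 0 c)); rewrite -fDl !add0r.
have f0r c : f c 0 = 0 by apply: (addIr (f c 0)); rewrite -fDr !add0r.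
by rewrite glift2_pair !(f0l, f0r) !addr0 subr0.
Qed.

End GrothLift2.

Section GrothRing.
Variable M : comPzSemiRingType.

Definition gmul : groth M -> groth M -> groth M :=
  glift2 (fun a b => gin (a * b)).
Definition gone : groth M := gin 1.

Lemma ginMl (a b c : M) : gin ((a + b) * c) = gin (a * c) + gin (b * c).
Proof. by rewrite mulrDl ginD. Qed.
Lemma ginMr (a b c : M) : gin (a * (b + c)) = gin (a * b) + gin (a * c).
Proof. by rewrite mulrDr ginD. Qed.

Lemma gmulDl : left_distributive gmul +%R.
Proof. exact: (glift2Dl ginMl ginMr). Qed.
Lemma gmulBl x y z : gmul (x - y) z = gmul x z - gmul y z.
Proof. exact: (glift2Bl ginMl ginMr). Qed.
Lemma gmulBr x y z : gmul z (x - y) = gmul z x - gmul z y.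
Proof. exact: (glift2Br ginMl ginMr). Qed.
Lemma gmul_gin a b : gmul (gin a) (gin b) = gin (a * b).
Proof. exact: (glift2_gin ginMl ginMr). Qed.

Lemma gmulA : associative gmul.
Proof.
elim/grothW=> [a|x x' Hx Hx'] y z; last by rewrite !gmulBl Hx Hx'.
elim/grothW: y => [b|y y' Hy Hy']; last by rewrite !(gmulBl, gmulBr) Hy Hy'.
elim/grothW: z => [c|z z' Hz Hz']; last by rewrite !gmulBr Hz Hz'.
by rewrite !gmul_gin mulrA.
Qed.
Lemma gmulC : commutative gmul.
Proof.
elim/grothW=> [a|x x' Hx Hx'] y; last by rewrite gmulBl gmulBr Hx Hx'.
elim/grothW: y => [b|y y' Hy Hy']; last by rewrite gmulBl gmulBr Hy Hy'.
by rewrite !gmul_gin mulrC.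
Qed.
Lemma gmul1 : left_id gone gmul.
Proof.
elim/grothW=> [a|x x' Hx Hx']; last by rewrite gmulBr Hx Hx'.
by rewrite gmul_gin mul1r.
Qed.

HB.instance Definition _ := GRing.Zmodule_isComPzRing.Build (groth M)
  gmulA gmulC gmul1 gmulDl.

End GrothRing.

Section GSets.
Variable gT : finGroupType.

(** The carriers live in [Set] so that the finite G-sets form a small type;
    groups act on the right, as everywhere in the library, which amounts to a
    left action through inverses. *)
Record gset := GSet {
  gcar : Set;
  gfin : inhabited (Finite gcar);
  gact : {action gT &-> gcar} }.

Definition gset_fin (X : gset) : finType := Finite.Pack (inhabited_witness (gfin X)).
HB.instance Definition _ (X : gset) := Finite.copy (gcar X) (gset_fin X).

HB.instance Definition _ := gen_eqMixin gset.
HB.instance Definition _ := gen_choiceMixin gset.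

Local Notation "x ** a" := (gact _ x a) (at level 40, left associativity).

Record gmap (X Y : gset) := GMap {
  gfun :> gcar X -> gcar Y;
  gmapJ : forall x a, gfun (x ** a) = gfun x ** a }.

Definition gid X : gmap X X := @GMap X X id (fun _ _ => erefl).
Lemma gcomp_subproof X Y Z (g : gmap Y Z) (f : gmap X Y) x a :
  g (f (x ** a)) = g (f x) ** a.
Proof. by rewrite !gmapJ. Qed.
Definition gcomp X Y Z (g : gmap Y Z) (f : gmap X Y) : gmap X Z :=
  GMap (gcomp_subproof g f).

Lemma ginv_subproof X Y (f : gmap X Y) g : cancel f g -> cancel g f ->
  forall y a, g (y ** a) = g y ** a.
Proof. by move=> fK gK y a; rewrite -{1}[y]gK -gmapJ fK. Qed.
Definition ginv X Y (f : gmap X Y) g (fK : cancel f g) (gK : cancel g f) :=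
  GMap (ginv_subproof fK gK).

Definition gpt : gset.
Proof.
refine (@GSet unit (inhabits (Finite.class unit)) (@TotalAction gT unit (fun x _ => x) _ _)).
  by [].
by [].
Defined.

Definition gempty : gset.
Proof.
refine (@GSet void (inhabits (Finite.class void)) (@TotalAction gT void (fun x _ => x) _ _)).
  by [].
by [].
Defined.

Section Prod.
Variables X Y : gset.
Definition gprod_act (p : gcar X * gcar Y) a := (p.1 ** a, p.2 ** a).
Lemma gprod_act1 : gprod_act^~ 1%g =1 id.
Proof. by case=> x y; rewrite /gprod_act /= !act1. Qed.
Lemma gprod_actM x : act_morph gprod_act x.
Proof. by case: x => x y a b; rewrite /gprod_act /= !actM. Qed.
Definition gprod : gset :=
  @GSet (gcar X * gcar Y)%type (inhabits (Finite.class (gcar X * gcar Y)%type))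
   (TotalAction gprod_act1 gprod_actM).
Definition gsum_act (p : gcar X + gcar Y) a :=
  match p with inl x => inl (x ** a) | inr y => inr (y ** a) end.
Lemma gsum_act1 : gsum_act^~ 1%g =1 id.
Proof. by case=> x; rewrite /gsum_act /= !act1. Qed.
Lemma gsum_actM x : act_morph gsum_act x.
Proof. by case: x => x a b; rewrite /gsum_act /= !actM. Qed.
Definition gsum : gset :=
  @GSet (gcar X + gcar Y)%type (inhabits (Finite.class (gcar X + gcar Y)%type))
   (TotalAction gsum_act1 gsum_actM).
End Prod.

Section Pullback.
Variables (X Y Z : gset) (f : gmap X Z) (g : gmap Y Z).
Definition gpb_car : Set := {p : gcar X * gcar Y | f p.1 == g p.2}.
Lemma gpb_act_subproof (p : gpb_car) a :
  f ((val p).1 ** a) == g ((val p).2 ** a).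
Proof. by rewrite !gmapJ (eqP (valP p)). Qed.
Definition gpb_act (p : gpb_car) a : gpb_car :=
  exist _ ((val p).1 ** a, (val p).2 ** a) (gpb_act_subproof p a).
Lemma gpb_act1 : gpb_act^~ 1%g =1 id.
Proof. by move=> p; apply: val_inj; case: p => -[x y] e /=; rewrite !act1. Qed.
Lemma gpb_actM x : act_morph gpb_act x.
Proof. by move=> a b; apply: val_inj; rewrite /= !actM. Qed.
Definition gpb : gset :=
  @GSet gpb_car (inhabits (Finite.class {p : gcar X * gcar Y | f p.1 == g p.2}))
   (TotalAction gpb_act1 gpb_actM).
Definition gpb1 : gmap gpb X := @GMap gpb X (fun p => (val p).1) (fun _ _ => erefl).
Definition gpb2 : gmap gpb Y := @GMap gpb Y (fun p => (val p).2) (fun _ _ => erefl).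
End Pullback.

Definition giso (X Y : gset) := exists f : gmap X Y, bijective f.

Lemma gisoI (X Y : gset) (f : gcar X -> gcar Y) g :
  (forall x a, f (x ** a) = f x ** a) -> cancel f g -> cancel g f -> giso X Y.
Proof. by move=> fJ fK gK; exists (GMap fJ); exists g. Qed.

Lemma giso_refl X : giso X X.
Proof. by exists (gid X); exists id. Qed.
Lemma giso_sym X Y : giso X Y -> giso Y X.
Proof. by case=> f [g fK gK]; exists (ginv fK gK); exists f. Qed.
Lemma giso_trans X Y Z : giso X Y -> giso Y Z -> giso X Z.
Proof. by case=> f fb [g gb]; exists (gcomp g f); apply: bij_comp. Qed.

Definition giso_eqv := EqvRel giso_refl giso_sym giso_trans.
Definition gclass := quot giso_eqv.
HB.instance Definition _ := Choice.on gclass.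

Definition gclass_add (x y : gclass) : gclass := cls (gsum (rep x) (rep y)).
Definition gclass_mul (x y : gclass) : gclass := cls (gprod (rep x) (rep y)).

Lemma gsum_iso X X' Y Y' : giso X X' -> giso Y Y' -> giso (gsum X Y) (gsum X' Y').
Proof.
case=> f [f' fK f'K] [g [g' gK g'K]].
pose h (p : gcar (gsum X Y)) : gcar (gsum X' Y') :=
  match p with inl x => inl (f x) | inr y => inr (g y) end.
pose h' (p : gcar (gsum X' Y')) : gcar (gsum X Y) :=
  match p with inl x => inl (f' x) | inr y => inr (g' y) end.
apply: (@gisoI _ _ h h'); first by case=> x a /=; rewrite gmapJ.
  by case=> x /=; rewrite ?fK ?gK.
by case=> x /=; rewrite ?f'K ?g'K.
Qed.

Lemma gprod_iso X X' Y Y' :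
  giso X X' -> giso Y Y' -> giso (gprod X Y) (gprod X' Y').
Proof.
case=> f [f' fK f'K] [g [g' gK g'K]].
pose h (p : gcar (gprod X Y)) : gcar (gprod X' Y') := (f p.1, g p.2).
pose h' (p : gcar (gprod X' Y')) : gcar (gprod X Y) := (f' p.1, g' p.2).
apply: (@gisoI _ _ h h'); first by move=> p a; rewrite /h /= !gmapJ.
  by case=> x y; rewrite /h /h' /= fK gK.
by case=> x y; rewrite /h /h' /= f'K g'K.
Qed.

Lemma gclass_addE X Y : gclass_add (cls X) (cls Y) = cls (gsum X Y).
Proof. by apply/clsP/gsum_iso; apply: (rep_cls giso_eqv). Qed.
Lemma gclass_mulE X Y : gclass_mul (cls X) (cls Y) = cls (gprod X Y).
Proof. by apply/clsP/gprod_iso; apply: (rep_cls giso_eqv). Qed.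

Section SumMaps.
Variables A B C D : Type.
Definition sum_assoc (p : A + (B + C)) : A + B + C :=
  match p with
  | inl a => inl (inl a) | inr (inl b) => inl (inr b) | inr (inr c) => inr c
  end.
Definition sum_unassoc (p : A + B + C) : A + (B + C) :=
  match p with
  | inl (inl a) => inl a | inl (inr b) => inr (inl b) | inr c => inr (inr c)
  end.
Definition sum_swap (p : A + B) : B + A :=
  match p with inl a => inr a | inr b => inl b end.
Definition sum_dist (p : (A + B) * C) : A * C + B * C :=
  match p.1 with inl a => inl (a, p.2) | inr b => inr (b, p.2) end.
Definition sum_undist (p : A * C + B * C) : (A + B) * C :=
  match p with inl q => (inl q.1, q.2) | inr q => (inr q.1, q.2) end.
Definition void_sum (p : void + A) : A :=
  match p with inl v => of_void A v | inr a => a end.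
End SumMaps.

Lemma gclass_addA : associative gclass_add.
Proof.
elim/quotW=> X; elim/quotW=> Y; elim/quotW=> Z; rewrite !gclass_addE.
apply/clsP; apply: (@gisoI (gsum X (gsum Y Z)) (gsum (gsum X Y) Z)
  (@sum_assoc _ _ _) (@sum_unassoc _ _ _)).
- by case=> [x|[y|z]].
- by case=> [x|[y|z]].
- by case=> [[x|y]|z].
Qed.
Lemma gclass_addC : commutative gclass_add.
Proof.
elim/quotW=> X; elim/quotW=> Y; rewrite !gclass_addE.
apply/clsP; apply: (@gisoI (gsum X Y) (gsum Y X) (@sum_swap _ _) (@sum_swap _ _)).
- by case.
- by case.
- by case.
Qed.
Lemma gclass_add0 : left_id (cls gempty) gclass_add.
Proof.
elim/quotW=> X; rewrite !gclass_addE; apply/clsP.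
apply: (@gisoI (gsum gempty X) X (@void_sum _) inr).
- by case=> // -[].
- by case=> // -[].
- by [].
Qed.

HB.instance Definition _ :=
  GRing.isNmodule.Build gclass gclass_addA gclass_addC gclass_add0.

Lemma gclass_mulA : associative gclass_mul.
Proof.
elim/quotW=> X; elim/quotW=> Y; elim/quotW=> Z; rewrite !gclass_mulE.
apply/clsP; apply: (@gisoI (gprod X (gprod Y Z)) (gprod (gprod X Y) Z)
  (fun p => (p.1, p.2.1, p.2.2)) (fun p => (p.1.1, (p.1.2, p.2)))).
- by [].
- by case=> [x [y z]].
- by case=> [[x y] z].
Qed.
Lemma gclass_mulC : commutative gclass_mul.
Proof.
elim/quotW=> X; elim/quotW=> Y; rewrite !gclass_mulE.
apply/clsP; apply: (@gisoI (gprod X Y) (gprod Y X)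
  (fun p => (p.2, p.1)) (fun p => (p.2, p.1))) => //; by case.
Qed.
Lemma gclass_mul1 : left_id (cls gpt) gclass_mul.
Proof.
elim/quotW=> X; rewrite !gclass_mulE.
apply/clsP; apply: (@gisoI (gprod gpt X) X (fun p => p.2) (fun x => (tt, x))) => //.
by case=> [[] x].
Qed.
Lemma gclass_mulDl : left_distributive gclass_mul gclass_add.
Proof.
elim/quotW=> X; elim/quotW=> Y; elim/quotW=> Z.
rewrite !(gclass_addE, gclass_mulE); apply/clsP.
apply: (@gisoI (gprod (gsum X Y) Z) (gsum (gprod X Z) (gprod Y Z))
   (@sum_dist _ _ _) (@sum_undist _ _ _)).
- by case=> -[].
- by case=> -[].
- by case=> -[].
Qed.
Lemma gclass_mul0 : left_zero (cls gempty) gclass_mul.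
Proof.
elim/quotW=> X; rewrite !gclass_mulE; apply/clsP.
by apply: (@gisoI (gprod gempty X) gempty (fun p => p.1) (of_void _));
  [case=> -[]|case=> -[]|case].
Qed.

HB.instance Definition _ := GRing.Nmodule_isComPzSemiRing.Build gclass
  gclass_mulA gclass_mulC gclass_mul1 gclass_mulDl gclass_mul0.

Definition burnside_ring : comPzRingType := groth gclass.

End GSets.
Local Notation "x ** a" := (gact _ x a) (at level 40, left associativity).

Section Spans.
Variable gT : finGroupType.
Implicit Types X Y Z W : gset gT.

Record span X Y := Span {
  apex : gset gT;
  legl : gmap apex X;
  legr : gmap apex Y }.

HB.instance Definition _ X Y := gen_eqMixin (span X Y).
HB.instance Definition _ X Y := gen_choiceMixin (span X Y).

Definition span_iso X Y (s t : span X Y) :=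
  exists f : gmap (apex s) (apex t),
    [/\ bijective f, forall u, legl t (f u) = legl s u
      & forall u, legr t (f u) = legr s u].

Lemma span_isoI X Y (s t : span X Y) (f : gcar (apex s) -> gcar (apex t)) g :
  (forall x a, f (x ** a) = f x ** a) -> cancel f g -> cancel g f ->
  (forall u, legl t (f u) = legl s u) -> (forall u, legr t (f u) = legr s u) ->
  span_iso s t.
Proof. by move=> fJ fK gK fl fr; exists (GMap fJ); split=> //; exists g. Qed.

Lemma span_iso_refl X Y (s : span X Y) : span_iso s s.
Proof. by exists (gid _); split=> //; exists id. Qed.
Lemma span_iso_sym X Y (s t : span X Y) : span_iso s t -> span_iso t s.
Proof.
case=> f [[g fK gK] fl fr]; exists (ginv fK gK); split; first by exists f.
  by move=> u; rewrite -fl /= gK.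
by move=> u; rewrite -fr /= gK.
Qed.
Lemma span_iso_trans X Y (s t r : span X Y) :
  span_iso s t -> span_iso t r -> span_iso s r.
Proof.
case=> f [fb fl fr] [g [gb gl gr]]; exists (gcomp g f); split.
- exact: bij_comp.
- by move=> u /=; rewrite gl fl.
- by move=> u /=; rewrite gr fr.
Qed.

Definition span_eqv X Y :=
  EqvRel (@span_iso_refl X Y) (@span_iso_sym X Y) (@span_iso_trans X Y).
Definition spanc X Y := quot (span_eqv X Y).
HB.instance Definition _ X Y := Choice.on (spanc X Y).

Definition copair X Y Z (f : gmap X Z) (g : gmap Y Z) : gmap (gsum X Y) Z.
Proof.
refine (@GMap _ (gsum X Y) Z
  (fun p => match p with inl x => f x | inr y => g y end) _).
by case=> x a; apply: gmapJ.
Defined.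
Definition gempty_map Z : gmap (gempty gT) Z.
Proof. by refine (@GMap _ (gempty gT) Z (of_void _) _); case. Defined.

Definition span_add X Y (s t : span X Y) : span X Y :=
  Span (copair (legl s) (legl t)) (copair (legr s) (legr t)).
Definition span_zero X Y : span X Y := Span (gempty_map X) (gempty_map Y).

Lemma span_add_iso X Y (s s' t t' : span X Y) :
  span_iso s s' -> span_iso t t' -> span_iso (span_add s t) (span_add s' t').
Proof.
case=> f [[f' fK f'K] fl fr] [g [[g' gK g'K] gl gr]].
pose h (p : gcar (gsum (apex s) (apex t))) : gcar (gsum (apex s') (apex t')) :=
  match p with inl x => inl (f x) | inr y => inr (g y) end.
pose h' (p : gcar (gsum (apex s') (apex t'))) : gcar (gsum (apex s) (apex t)) :=
  match p with inl x => inl (f' x) | inr y => inr (g' y) end.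
apply: (@span_isoI _ _ (span_add s t) (span_add s' t') h h').
- by case=> x a /=; rewrite gmapJ.
- by case=> x /=; rewrite ?fK ?gK.
- by case=> x /=; rewrite ?f'K ?g'K.
- by case=> x /=; rewrite ?fl ?gl.
- by case=> x /=; rewrite ?fr ?gr.
Qed.

Definition spanc_add X Y (x y : spanc X Y) : spanc X Y :=
  cls (span_add (rep x) (rep y)).
Lemma spanc_addE X Y (s t : span X Y) :
  spanc_add (cls s) (cls t) = cls (span_add s t).
Proof. by apply/clsP/span_add_iso; apply: (rep_cls (span_eqv X Y)). Qed.

Lemma spanc_addA X Y : associative (@spanc_add X Y).
Proof.
elim/quotW=> r; elim/quotW=> s; elim/quotW=> t; rewrite !spanc_addE.
apply/clsP; apply: (@span_isoI _ _
  (span_add r (span_add s t)) (span_add (span_add r s) t)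
  (@sum_assoc _ _ _) (@sum_unassoc _ _ _)).
- by case=> [x|[y|z]].
- by case=> [x|[y|z]].
- by case=> [[x|y]|z].
- by case=> [x|[y|z]].
- by case=> [x|[y|z]].
Qed.
Lemma spanc_addC X Y : commutative (@spanc_add X Y).
Proof.
elim/quotW=> s; elim/quotW=> t; rewrite !spanc_addE; apply/clsP.
by apply: (@span_isoI _ _ (span_add s t) (span_add t s)
  (@sum_swap _ _) (@sum_swap _ _)); case.
Qed.
Lemma spanc_add0 X Y : left_id (cls (span_zero X Y)) (@spanc_add X Y).
Proof.
elim/quotW=> s; rewrite !spanc_addE; apply/clsP.
by apply: (@span_isoI _ _ (span_add (span_zero X Y) s) s
  (@void_sum _) inr) => //; case=> // -[].
Qed.

HB.instance Definition _ X Y := GRing.isNmodule.Build (spanc X Y)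
  (@spanc_addA X Y) (@spanc_addC X Y) (@spanc_add0 X Y).

Definition scls X Y (s : span X Y) : spanc X Y := cls s.
Lemma sclsD X Y (s t : span X Y) : scls s + scls t = scls (span_add s t).
Proof. exact: spanc_addE. Qed.
Lemma scls_eq X Y (s t : span X Y) : span_iso s t -> scls s = scls t.
Proof. exact: (@cls_eq _ (span_eqv X Y)). Qed.
Lemma sclsW X Y (P : spanc X Y -> Prop) :
  (forall s, P (scls s)) -> forall c, P c.
Proof. exact: quotW. Qed.

Definition span_comp X Y Z (t : span Y Z) (s : span X Y) : span X Z :=
  Span (gcomp (legl s) (gpb1 (legr s) (legl t)))
       (gcomp (legr t) (gpb2 (legr s) (legl t))).

Lemma span_comp_iso X Y Z (t t' : span Y Z) (s s' : span X Y) :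
  span_iso t t' -> span_iso s s' -> span_iso (span_comp t s) (span_comp t' s').
Proof.
case=> g [[g' gK g'K] gl gr] [f [[f' fK f'K] fl fr]].
have hP (p : gpb_car (legr s) (legl t)) :
  legr s' (f (val p).1) == legl t' (g (val p).2).
  by rewrite fr gl (eqP (valP p)).
have h'P (p : gpb_car (legr s') (legl t')) :
  legr s (f' (val p).1) == legl t (g' (val p).2).
  by rewrite -fr -gl f'K g'K (eqP (valP p)).
pose h (p : gpb_car (legr s) (legl t)) : gpb_car (legr s') (legl t') :=
  exist _ (f (val p).1, g (val p).2) (hP p).
pose h' (p : gpb_car (legr s') (legl t')) : gpb_car (legr s) (legl t) :=
  exist _ (f' (val p).1, g' (val p).2) (h'P p).
apply: (@span_isoI _ _ (span_comp t s) (span_comp t' s') h h').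
- by move=> p a; apply: val_inj; rewrite /= !gmapJ.
- by move=> p; apply: val_inj; case: p => -[x y] e; rewrite /= fK gK.
- by move=> p; apply: val_inj; case: p => -[x y] e; rewrite /= f'K g'K.
- by move=> p; rewrite /= fl.
- by move=> p; rewrite /= gr.
Qed.

Definition spanc_comp X Y Z (t : spanc Y Z) (s : spanc X Y) : spanc X Z :=
  scls (span_comp (rep t) (rep s)).
Lemma spanc_compE X Y Z (t : span Y Z) (s : span X Y) :
  spanc_comp (scls t) (scls s) = scls (span_comp t s).
Proof.
apply: scls_eq; apply: span_comp_iso; last exact: (rep_cls (span_eqv X Y)).
exact: (rep_cls (span_eqv Y Z)).
Qed.

(** The span [X <- X -> Y] whose left leg is the identity. *)
Definition span_of X Y (f : gmap X Y) : span X Y := Span (gid X) f.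

Lemma span_comp_of X Y Z (f : gmap Y Z) (s : span X Y) :
  span_iso (span_comp (span_of f) s) (Span (legl s) (gcomp f (legr s))).
Proof.
have hP (u : gcar (apex s)) : legr s u == gid Y (legr s u) by [].
apply: (@span_isoI _ _ (span_comp (span_of f) s) (Span (legl s) (gcomp f (legr s)))
  (fun p => (val p).1) (fun u => exist _ (u, legr s u) (hP u))) => //.
- by move=> p; apply: val_inj; case: p => -[x y] /= /eqP e; rewrite e.
- by move=> p /=; rewrite (eqP (valP p)).
Qed.

Lemma span_of_comp X Y Z (f : gmap X Y) f' (fK : cancel f f') (f'K : cancel f' f)
    (t : span Y Z) :
  span_iso (span_comp t (span_of f)) (Span (gcomp (ginv fK f'K) (legl t)) (legr t)).
Proof.
have hP (u : gcar (apex t)) : f (f' (legl t u)) == legl t u by rewrite f'K.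
apply: (@span_isoI _ _ (span_comp t (span_of f))
  (Span (gcomp (ginv fK f'K) (legl t)) (legr t))
  (fun p => (val p).2) (fun u => exist _ (f' (legl t u), u) (hP u))) => //.
- by move=> p; apply: val_inj; case: p => -[x y] /= /eqP e; rewrite -e fK.
- by move=> p /=; rewrite -(eqP (valP p)) /= fK.
Qed.

Lemma spanc_comp1 X Y (s : spanc X Y) :
  spanc_comp (scls (span_of (gid Y))) s = s.
Proof.
elim/sclsW: s => s; rewrite spanc_compE; apply: scls_eq.
apply: span_iso_trans (span_comp_of _ _) _.
by exists (gid _); split=> //; exists id.
Qed.
Lemma spanc_1comp X Y (s : spanc X Y) :
  spanc_comp s (scls (span_of (gid X))) = s.
Proof.
elim/sclsW: s => s; rewrite spanc_compE; apply: scls_eq.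
have idK : cancel (gid X) id by [].
apply: span_iso_trans (span_of_comp idK idK _) _.
by exists (gid _); split=> //; exists id.
Qed.

Lemma spanc_compA X Y Z W (r : spanc Z W) (t : spanc Y Z) (s : spanc X Y) :
  spanc_comp r (spanc_comp t s) = spanc_comp (spanc_comp r t) s.
Proof.
elim/sclsW: r => r; elim/sclsW: t => t; elim/sclsW: s => s.
rewrite !spanc_compE; apply: scls_eq.
pose A := span_comp r (span_comp t s); pose B := span_comp (span_comp r t) s.
have h1 (p : gcar (apex A)) : legr t (val (val p).1).2 == legl r (val p).2.
  by rewrite -(eqP (valP p)).
pose h2 (p : gcar (apex A)) : gpb_car (legr t) (legl r) :=
  exist _ ((val (val p).1).2, (val p).2) (h1 p).
have h3 (p : gcar (apex A)) :
  legr s (val (val p).1).1 == gcomp (legl t) (gpb1 _ _) (h2 p).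
  by rewrite /= (eqP (valP (val p).1)).
have k1 (p : gcar (apex B)) : legr s (val p).1 == legl t (val (val p).2).1.
  by rewrite (eqP (valP p)).
pose k2 (p : gcar (apex B)) : gpb_car (legr s) (legl t) :=
  exist _ ((val p).1, (val (val p).2).1) (k1 p).
have k3 (p : gcar (apex B)) :
  gcomp (legr t) (gpb2 _ _) (k2 p) == legl r (val (val p).2).2.
  by rewrite /= (eqP (valP (val p).2)).
apply: (@span_isoI _ _ A B
  (fun p => exist _ ((val (val p).1).1, h2 p) (h3 p))
  (fun p => exist _ (k2 p, (val (val p).2).2) (k3 p))) => //.
- by move=> p a; apply: val_inj; congr pair; apply: val_inj.
- by move=> p; apply: val_inj; case: p => -[[[x y] e] z] e'; congr pair; apply: val_inj.
- by move=> p; apply: val_inj; case: p => -[x [[y z] e]] e'; congr pair; apply: val_inj.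
Qed.

Lemma spanc_compDl X Y Z (t t' : spanc Y Z) (s : spanc X Y) :
  spanc_comp (t + t') s = spanc_comp t s + spanc_comp t' s.
Proof.
elim/sclsW: t => t; elim/sclsW: t' => t'; elim/sclsW: s => s.
rewrite sclsD !spanc_compE sclsD; apply: scls_eq.
pose A := span_comp (span_add t t') s.
pose B := span_add (span_comp t s) (span_comp t' s).
pose h (p : gcar (apex A)) : gcar (apex B) :=
  match p with
  | exist (u, inl v) e => inl (exist _ (u, v) e)
  | exist (u, inr v) e => inr (exist _ (u, v) e)
  end.
pose h' (p : gcar (apex B)) : gcar (apex A) :=
  match p with
  | inl q => exist _ ((val q).1, inl (val q).2) (valP q)
  | inr q => exist _ ((val q).1, inr (val q).2) (valP q)
  end.
apply: (@span_isoI _ _ A B h h').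
- case=> -[u [v|v]] e a; [apply: (congr1 inl)|apply: (congr1 inr)];
  exact: val_inj.
- by case=> -[u [v|v]] e; apply: val_inj.
- case=> -[[u v] e]; [apply: (congr1 inl)|apply: (congr1 inr)];
  exact: val_inj.
- by case=> -[u [v|v]] e.
- by case=> -[u [v|v]] e.
Qed.

Lemma spanc_compDr X Y Z (t : spanc Y Z) (s s' : spanc X Y) :
  spanc_comp t (s + s') = spanc_comp t s + spanc_comp t s'.
Proof.
elim/sclsW: t => t; elim/sclsW: s => s; elim/sclsW: s' => s'.
rewrite sclsD !spanc_compE sclsD; apply: scls_eq.
pose A := span_comp t (span_add s s').
pose B := span_add (span_comp t s) (span_comp t s').
pose h (p : gcar (apex A)) : gcar (apex B) :=
  match p with
  | exist (inl u, v) e => inl (exist _ (u, v) e)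
  | exist (inr u, v) e => inr (exist _ (u, v) e)
  end.
pose h' (p : gcar (apex B)) : gcar (apex A) :=
  match p with
  | inl q => exist _ (inl (val q).1, (val q).2) (valP q)
  | inr q => exist _ (inr (val q).1, (val q).2) (valP q)
  end.
apply: (@span_isoI _ _ A B h h').
- case=> -[[u|u] v] e a; [apply: (congr1 inl)|apply: (congr1 inr)];
  exact: val_inj.
- by case=> -[[u|u] v] e; apply: val_inj.
- case=> -[[u v] e]; [apply: (congr1 inl)|apply: (congr1 inr)];
  exact: val_inj.
- by case=> -[[u|u] v] e.
- by case=> -[[u|u] v] e.
Qed.

Definition gprod_map X X' Y Y' (f : gmap X X') (g : gmap Y Y') :
  gmap (gprod X Y) (gprod X' Y').
Proof.
refine (@GMap _ (gprod X Y) (gprod X' Y') (fun p => (f p.1, g p.2)) _).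
by move=> p a; rewrite /= !gmapJ.
Defined.

Definition span_prod X X' Y Y' (s : span X X') (t : span Y Y') :
  span (gprod X Y) (gprod X' Y') :=
  Span (gprod_map (legl s) (legl t)) (gprod_map (legr s) (legr t)).

Lemma span_prod_iso X X' Y Y' (s s' : span X X') (t t' : span Y Y') :
  span_iso s s' -> span_iso t t' -> span_iso (span_prod s t) (span_prod s' t').
Proof.
case=> f [[f' fK f'K] fl fr] [g [[g' gK g'K] gl gr]].
apply: (@span_isoI _ _ (span_prod s t) (span_prod s' t')
  (fun p => (f p.1, g p.2)) (fun p => (f' p.1, g' p.2))).
- by move=> p a; rewrite /= !gmapJ.
- by case=> x y; rewrite /= fK gK.
- by case=> x y; rewrite /= f'K g'K.
- by move=> p; rewrite /= fl gl.
- by move=> p; rewrite /= fr gr.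
Qed.

Definition spanc_prod X X' Y Y' (s : spanc X X') (t : spanc Y Y') :
  spanc (gprod X Y) (gprod X' Y') := scls (span_prod (rep s) (rep t)).
Lemma spanc_prodE X X' Y Y' (s : span X X') (t : span Y Y') :
  spanc_prod (scls s) (scls t) = scls (span_prod s t).
Proof.
apply: scls_eq; apply: span_prod_iso; first exact: (rep_cls (span_eqv X X')).
exact: (rep_cls (span_eqv Y Y')).
Qed.

Lemma spanc_prodDl X X' Y Y' (s s' : spanc X X') (t : spanc Y Y') :
  spanc_prod (s + s') t = spanc_prod s t + spanc_prod s' t.
Proof.
elim/sclsW: s => s; elim/sclsW: s' => s'; elim/sclsW: t => t.
rewrite sclsD !spanc_prodE sclsD; apply: scls_eq.
apply: (@span_isoI _ _ (span_prod (span_add s s') t)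
  (span_add (span_prod s t) (span_prod s' t))
  (@sum_dist _ _ _) (@sum_undist _ _ _)).
- by case=> -[].
- by case=> -[].
- by case=> -[].
- by case=> -[].
- by case=> -[].
Qed.

Definition prod_swap (A B : Type) (p : A * B) : B * A := (p.2, p.1).
Definition prod_assoc (A B C : Type) (p : A * (B * C)) : A * B * C :=
  (p.1, p.2.1, p.2.2).
Definition prod_unassoc (A B C : Type) (p : A * B * C) : A * (B * C) :=
  (p.1.1, (p.1.2, p.2)).

Definition gswap X Y : gmap (gprod X Y) (gprod Y X) :=
  @GMap _ (gprod X Y) (gprod Y X) (@prod_swap _ _) (fun _ _ => erefl).
Definition gassoc X Y Z : gmap (gprod X (gprod Y Z)) (gprod (gprod X Y) Z) :=
  @GMap _ (gprod X (gprod Y Z)) (gprod (gprod X Y) Z)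
    (@prod_assoc _ _ _) (fun _ _ => erefl).
Definition gunassoc X Y Z : gmap (gprod (gprod X Y) Z) (gprod X (gprod Y Z)) :=
  @GMap _ (gprod (gprod X Y) Z) (gprod X (gprod Y Z))
    (@prod_unassoc _ _ _) (fun _ _ => erefl).
Definition glunit X : gmap (gprod (gpt gT) X) X :=
  @GMap _ (gprod (gpt gT) X) X (fun p => p.2) (fun _ _ => erefl).
Definition glununit X : gmap X (gprod (gpt gT) X) :=
  @GMap _ X (gprod (gpt gT) X) (fun x => (tt, x)) (fun _ _ => erefl).

Lemma gswapK X Y : cancel (gswap X Y) (gswap Y X). Proof. by case. Qed.
Lemma gassocK X Y Z : cancel (gassoc X Y Z) (gunassoc X Y Z).
Proof. by case=> x []. Qed.
Lemma gunassocK X Y Z : cancel (gunassoc X Y Z) (gassoc X Y Z).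
Proof. by case=> -[]. Qed.
Lemma glunitK X : cancel (glunit X) (glununit X). Proof. by case=> -[]. Qed.
Lemma glununitK X : cancel (glununit X) (glunit X). Proof. by []. Qed.

Lemma span_swap_nat X X' Y Y' (s : spanc X X') (t : spanc Y Y') :
  spanc_comp (scls (span_of (gswap X' Y'))) (spanc_prod s t) =
  spanc_comp (spanc_prod t s) (scls (span_of (gswap X Y))).
Proof.
elim/sclsW: s => s; elim/sclsW: t => t; rewrite !(spanc_prodE, spanc_compE).
apply: scls_eq; apply: span_iso_trans (span_comp_of _ _) _.
apply: span_iso_trans (span_iso_sym (span_of_comp (@gswapK X Y) (@gswapK Y X) _)).
by exists (gswap _ _); split=> //; exists (gswap _ _); apply: gswapK.
Qed.

Lemma span_assoc_nat X X' Y Y' Z Z' (s : spanc X X') (t : spanc Y Y')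
    (r : spanc Z Z') :
  spanc_comp (scls (span_of (gassoc X' Y' Z'))) (spanc_prod s (spanc_prod t r)) =
  spanc_comp (spanc_prod (spanc_prod s t) r) (scls (span_of (gassoc X Y Z))).
Proof.
elim/sclsW: s => s; elim/sclsW: t => t; elim/sclsW: r => r.
rewrite !(spanc_prodE, spanc_compE).
apply: scls_eq; apply: span_iso_trans (span_comp_of _ _) _.
apply: span_iso_trans (span_iso_sym (span_of_comp (@gassocK X Y Z)
  (@gunassocK X Y Z) _)).
exists (gassoc _ _ _); split=> //; exists (gunassoc _ _ _);
  [exact: gassocK | exact: gunassocK].
Qed.

Lemma span_lunit_nat X X' (s : spanc X X') :
  spanc_comp (scls (span_of (glunit X')))
    (spanc_prod (scls (span_of (gid (gpt gT)))) s) =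
  spanc_comp s (scls (span_of (glunit X))).
Proof.
elim/sclsW: s => s; rewrite !(spanc_prodE, spanc_compE).
apply: scls_eq; apply: span_iso_trans (span_comp_of _ _) _.
apply: span_iso_trans (span_iso_sym (span_of_comp (@glunitK X) (@glununitK X) _)).
exists (glunit _); split=> //; first by exists (glununit _); [exact: glunitK|].
by case=> -[].
Qed.

Lemma spanc_of_comp X Y Z (g : gmap Y Z) (f : gmap X Y) :
  spanc_comp (scls (span_of g)) (scls (span_of f)) = scls (span_of (gcomp g f)).
Proof.
rewrite spanc_compE; apply: scls_eq; apply: span_iso_trans (span_comp_of _ _) _.
by exists (gid _); split=> //; exists id.
Qed.

Lemma scls_of_ext X Y (f g : gmap X Y) :
  f =1 g -> scls (span_of f) = scls (span_of g).
Proof.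
by move=> fg; apply: scls_eq; exists (gid X); split=> //; exists id.
Qed.

Lemma spanc_prod1 X Y :
  spanc_prod (scls (span_of (gid X))) (scls (span_of (gid Y))) =
  scls (span_of (gid (gprod X Y))).
Proof.
rewrite spanc_prodE; apply: scls_eq; exists (gid _).
by split; [exists id | case | case].
Qed.

Lemma spanc_prod_comp X X' X'' Y Y' Y'' (s : spanc X X') (s' : spanc X' X'')
    (t : spanc Y Y') (t' : spanc Y' Y'') :
  spanc_comp (spanc_prod s' t') (spanc_prod s t) =
  spanc_prod (spanc_comp s' s) (spanc_comp t' t).
Proof.
elim/sclsW: s => s; elim/sclsW: s' => s'; elim/sclsW: t => t; elim/sclsW: t' => t'.
rewrite !(spanc_prodE, spanc_compE); apply: scls_eq.
pose A := span_comp (span_prod s' t') (span_prod s t).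
pose B := span_prod (span_comp s' s) (span_comp t' t).
have h1 (p : gcar (apex A)) : legr s (val p).1.1 == legl s' (val p).2.1.
  by have /eqP[-> _] := valP p.
have h2 (p : gcar (apex A)) : legr t (val p).1.2 == legl t' (val p).2.2.
  by have /eqP[_ ->] := valP p.
have k1 (p : gcar (apex B)) :
  legr (span_prod s t) ((val p.1).1, (val p.2).1) ==
  legl (span_prod s' t') ((val p.1).2, (val p.2).2).
  by apply/eqP; congr pair; apply/eqP; [exact: (valP p.1)|exact: (valP p.2)].
apply: (@span_isoI _ _ A B
  (fun p => (exist _ ((val p).1.1, (val p).2.1) (h1 p),
             exist _ ((val p).1.2, (val p).2.2) (h2 p)))
  (fun p => exist _ (((val p.1).1, (val p.2).1), ((val p.1).2, (val p.2).2))
    (k1 p))) => //.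
- by move=> p a; congr pair; apply: val_inj.
- by move=> p; apply: val_inj; case: p => -[[a b] [c d]] e.
- by case=> -[[a b] e] [[c d] e']; congr pair; apply: val_inj.
Qed.

Lemma spanc_prodC X X' Y Y' (s : spanc X X') (t : spanc Y Y') :
  spanc_prod s t =
  spanc_comp (scls (span_of (gswap Y' X')))
    (spanc_comp (spanc_prod t s) (scls (span_of (gswap X Y)))).
Proof.
rewrite -span_swap_nat spanc_compA spanc_of_comp.
by rewrite (@scls_of_ext _ _ _ (gid _)) ?spanc_comp1 //; case.
Qed.

Lemma spanc_prodDr X X' Y Y' (s : spanc X X') (t t' : spanc Y Y') :
  spanc_prod s (t + t') = spanc_prod s t + spanc_prod s t'.
Proof. by rewrite !(spanc_prodC s) spanc_prodDl spanc_compDl spanc_compDr. Qed.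

End Spans.

Section BurnsideCategory.
Variable gT : finGroupType.
Implicit Types X Y Z W : gset gT.

Definition bhom X Y : zmodType := groth (spanc X Y).

Definition bof X Y (f : gmap X Y) : bhom X Y := gin (scls (span_of f)).
Definition bid X : bhom X X := bof (gid X).

Definition bcomp X Y Z (g : bhom Y Z) (f : bhom X Y) : bhom X Z :=
  glift2 (fun t s => gin (spanc_comp t s)) g f.
Definition bprod X X' Y Y' (f : bhom X X') (g : bhom Y Y') :
  bhom (gprod X Y) (gprod X' Y') :=
  glift2 (fun s t => gin (spanc_prod s t)) f g.

Local Notation "g \bo f" := (bcomp g f) (at level 40, left associativity).

Lemma gin_compDl X Y Z (t t' : spanc Y Z) (s : spanc X Y) :
  gin (spanc_comp (t + t') s) = gin (spanc_comp t s) + gin (spanc_comp t' s).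
Proof. by rewrite spanc_compDl ginD. Qed.
Lemma gin_compDr X Y Z (t : spanc Y Z) (s s' : spanc X Y) :
  gin (spanc_comp t (s + s')) = gin (spanc_comp t s) + gin (spanc_comp t s').
Proof. by rewrite spanc_compDr ginD. Qed.
Lemma gin_prodDl X X' Y Y' (s s' : spanc X X') (t : spanc Y Y') :
  gin (spanc_prod (s + s') t) = gin (spanc_prod s t) + gin (spanc_prod s' t).
Proof. by rewrite spanc_prodDl ginD. Qed.
Lemma gin_prodDr X X' Y Y' (s : spanc X X') (t t' : spanc Y Y') :
  gin (spanc_prod s (t + t')) = gin (spanc_prod s t) + gin (spanc_prod s t').
Proof. by rewrite spanc_prodDr ginD. Qed.

Section Comp.
Context {X Y Z : gset gT}.
Implicit Types (g : bhom Y Z) (f : bhom X Y).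
Lemma bcompDl g g' f : (g + g') \bo f = g \bo f + g' \bo f.
Proof. exact: (glift2Dl (@gin_compDl _ _ _) (@gin_compDr _ _ _)). Qed.
Lemma bcompDr g f f' : g \bo (f + f') = g \bo f + g \bo f'.
Proof. exact: (glift2Dr (@gin_compDl _ _ _) (@gin_compDr _ _ _)). Qed.
Lemma bcompBl g g' f : (g - g') \bo f = g \bo f - g' \bo f.
Proof. exact: (glift2Bl (@gin_compDl _ _ _) (@gin_compDr _ _ _)). Qed.
Lemma bcompBr g f f' : g \bo (f - f') = g \bo f - g \bo f'.
Proof. exact: (glift2Br (@gin_compDl _ _ _) (@gin_compDr _ _ _)). Qed.
Lemma bcomp_gin (t : spanc Y Z) (s : spanc X Y) :
  gin t \bo gin s = gin (spanc_comp t s).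
Proof. exact: (glift2_gin (@gin_compDl _ _ _) (@gin_compDr _ _ _)). Qed.
End Comp.

Section Prod.
Context {X X' Y Y' : gset gT}.
Implicit Types (f : bhom X X') (g : bhom Y Y').
Lemma bprodDl f f' g : bprod (f + f') g = bprod f g + bprod f' g.
Proof. exact: (glift2Dl (@gin_prodDl _ _ _ _) (@gin_prodDr _ _ _ _)). Qed.
Lemma bprodDr f g g' : bprod f (g + g') = bprod f g + bprod f g'.
Proof. exact: (glift2Dr (@gin_prodDl _ _ _ _) (@gin_prodDr _ _ _ _)). Qed.
Lemma bprodBl f f' g : bprod (f - f') g = bprod f g - bprod f' g.
Proof. exact: (glift2Bl (@gin_prodDl _ _ _ _) (@gin_prodDr _ _ _ _)). Qed.
Lemma bprodBr f g g' : bprod f (g - g') = bprod f g - bprod f g'.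
Proof. exact: (glift2Br (@gin_prodDl _ _ _ _) (@gin_prodDr _ _ _ _)). Qed.
Lemma bprod_gin (s : spanc X X') (t : spanc Y Y') :
  bprod (gin s) (gin t) = gin (spanc_prod s t).
Proof. exact: (glift2_gin (@gin_prodDl _ _ _ _) (@gin_prodDr _ _ _ _)). Qed.
End Prod.

Lemma bcompA X Y Z W (h : bhom Z W) (g : bhom Y Z) (f : bhom X Y) :
  h \bo (g \bo f) = h \bo g \bo f.
Proof.
elim/grothW: h => [c|x x' H H']; last by rewrite !bcompBl H H'.
elim/grothW: g => [b|x x' H H']; last by rewrite !(bcompBl, bcompBr) H H'.
elim/grothW: f => [a|x x' H H']; last by rewrite !bcompBr H H'.
by rewrite !bcomp_gin spanc_compA.
Qed.

Lemma bcomp1 X Y (f : bhom X Y) : f \bo bid X = f.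
Proof.
elim/grothW: f => [a|x x' H H']; last by rewrite !bcompBl H H'.
by rewrite bcomp_gin spanc_1comp.
Qed.
Lemma b1comp X Y (f : bhom X Y) : bid Y \bo f = f.
Proof.
elim/grothW: f => [a|x x' H H']; last by rewrite !bcompBr H H'.
by rewrite bcomp_gin spanc_comp1.
Qed.

Lemma bof_comp X Y Z (g : gmap Y Z) (f : gmap X Y) :
  bof g \bo bof f = bof (gcomp g f).
Proof. by rewrite bcomp_gin spanc_of_comp. Qed.
Lemma bof_id X (f : gmap X X) : f =1 id -> bof f = bid X.
Proof. by move=> fE; congr gin; apply: scls_of_ext. Qed.

Lemma bprod1 X Y : bprod (bid X) (bid Y) = bid (gprod X Y).
Proof. by rewrite bprod_gin spanc_prod1. Qed.

Lemma bprod_comp X X' X'' Y Y' Y'' (f : bhom X X') (f' : bhom X' X'')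
    (g : bhom Y Y') (g' : bhom Y' Y'') :
  bprod f' g' \bo bprod f g = bprod (f' \bo f) (g' \bo g).
Proof.
elim/grothW: f => [a|x x' H H']; last by rewrite !(bprodBl, bcompBr) H H'.
elim/grothW: f' => [a'|x x' H H']; last by rewrite !(bprodBl, bcompBl) H H'.
elim/grothW: g => [b|x x' H H']; last by rewrite !(bprodBr, bcompBr) H H'.
elim/grothW: g' => [b'|x x' H H'].
  by rewrite !(bprod_gin, bcomp_gin) spanc_prod_comp.
by rewrite bprodBr !bcompBl bprodBr H H'.
Qed.

Definition bswap X Y := bof (gswap X Y).
Definition bassoc X Y Z := bof (gassoc X Y Z).
Definition bunassoc X Y Z := bof (gunassoc X Y Z).
Definition blunit X := bof (glunit X).
Definition blununit X := bof (glununit X).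

Lemma bswapK X Y : bswap Y X \bo bswap X Y = bid _.
Proof. by rewrite bof_comp bof_id //; apply: gswapK. Qed.
Lemma bassocK X Y Z : bunassoc X Y Z \bo bassoc X Y Z = bid _.
Proof. by rewrite bof_comp bof_id //; apply: gassocK. Qed.
Lemma bunassocK X Y Z : bassoc X Y Z \bo bunassoc X Y Z = bid _.
Proof. by rewrite bof_comp bof_id //; apply: gunassocK. Qed.
Lemma blunitK X : blununit X \bo blunit X = bid _.
Proof. by rewrite bof_comp bof_id //; apply: glunitK. Qed.
Lemma blununitK X : blunit X \bo blununit X = bid _.
Proof. by rewrite bof_comp bof_id //; apply: glununitK. Qed.

Lemma bswap_nat X X' Y Y' (f : bhom X X') (g : bhom Y Y') :
  bswap X' Y' \bo bprod f g = bprod g f \bo bswap X Y.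
Proof.
elim/grothW: f => [a|x x' H H'].
  2: by rewrite bprodBl bcompBr bprodBr bcompBl H H'.
elim/grothW: g => [b|x x' H H'].
  2: by rewrite bprodBr bcompBr bprodBl bcompBl H H'.
by rewrite !(bprod_gin, bcomp_gin) span_swap_nat.
Qed.

Lemma bassoc_nat X X' Y Y' Z Z' (f : bhom X X') (g : bhom Y Y') (h : bhom Z Z') :
  bassoc X' Y' Z' \bo bprod f (bprod g h) = bprod (bprod f g) h \bo bassoc X Y Z.
Proof.
elim/grothW: f => [a|x x' H H'].
  2: by rewrite !(bprodBl, bcompBr, bcompBl) H H'.
elim/grothW: g => [b|x x' H H'].
  2: by rewrite !(bprodBl, bprodBr, bcompBr, bcompBl) H H'.
elim/grothW: h => [c|x x' H H'].
  2: by rewrite !(bprodBr, bcompBr, bcompBl) H H'.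
by rewrite !(bprod_gin, bcomp_gin) span_assoc_nat.
Qed.

Lemma bunassoc_nat X X' Y Y' Z Z' (f : bhom X X') (g : bhom Y Y')
    (h : bhom Z Z') :
  bunassoc X' Y' Z' \bo bprod (bprod f g) h =
  bprod f (bprod g h) \bo bunassoc X Y Z.
Proof.
rewrite -[LHS]bcomp1 -(bunassocK X Y Z) bcompA -(bcompA (bunassoc _ _ _)).
by rewrite -bassoc_nat bcompA bassocK b1comp.
Qed.

Lemma blunit_nat X X' (f : bhom X X') :
  blunit X' \bo bprod (bid (gpt gT)) f = f \bo blunit X.
Proof.
elim/grothW: f => [a|x x' H H'].
  2: by rewrite bprodBr bcompBr bcompBl H H'.
by rewrite !(bprod_gin, bcomp_gin) span_lunit_nat.
Qed.

Lemma blununit_nat X X' (f : bhom X X') :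
  bprod (bid (gpt gT)) f \bo blununit X = blununit X' \bo f.
Proof.
rewrite -[LHS]b1comp -(blunitK X') -!bcompA; congr (_ \bo _).
by rewrite bcompA blunit_nat -bcompA blununitK bcomp1.
Qed.

(** Additive functors from the opposite of the Burnside category to abelian
    groups. *)
Record mackey := Mackey {
  mob :> gset gT -> zmodType;
  mmap : forall X Y, bhom X Y -> {additive mob Y -> mob X};
  mmapD : forall X Y (f g : bhom X Y) m, mmap (f + g) m = mmap f m + mmap g m;
  mmap1 : forall X m, mmap (bid X) m = m;
  mmap_comp : forall X Y Z (g : bhom Y Z) (f : bhom X Y) m,
    mmap (g \bo f) m = mmap f (mmap g m) }.

Record mtrans (M N : mackey) := MTrans {
  mtr :> forall X, {additive M X -> N X};
  mtr_nat : forall X Y (f : bhom X Y) m,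
    mtr X (mmap M f m) = mmap N f (mtr Y m) }.

Definition miso (M N : mackey) :=
  exists (t : mtrans M N) (u : mtrans N M),
    (forall X, cancel (t X) (u X)) /\ (forall X, cancel (u X) (t X)).

Definition mtid M : mtrans M M :=
  @MTrans M M (fun X => idfun : {additive M X -> M X}) (fun _ _ _ _ => erefl).
Lemma mtcomp_subproof M N P (u : mtrans N P) (t : mtrans M N)
   X Y (f : bhom X Y) m :
   (u X \o t X) (mmap M f m) = mmap P f ((u Y \o t Y) m).
Proof. by rewrite /= !mtr_nat. Qed.
Definition mtcomp M N P (u : mtrans N P) (t : mtrans M N) : mtrans M P :=
  @MTrans M P (fun X => (u X \o t X) : {additive M X -> P X})
    (mtcomp_subproof u t).

Lemma miso_refl M : miso M M.
Proof. by exists (mtid M), (mtid M). Qed.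
Lemma miso_sym M N : miso M N -> miso N M.
Proof. by case=> t [u [tK uK]]; exists u, t. Qed.
Lemma miso_trans M N P : miso M N -> miso N P -> miso M P.
Proof.
case=> t [u [tK uK]] [t' [u' [tK' uK']]]; exists (mtcomp t' t), (mtcomp u u').
by split=> X x /=; rewrite ?tK' ?tK ?uK ?uK'.
Qed.

(** The Burnside Mackey functor, represented by the one-point G-set. *)
Section Unit.
Definition munit_map_fun X Y (f : bhom X Y) (a : bhom Y (gpt gT)) := a \bo f.
Lemma munit_map_additive X Y (f : bhom X Y) : zmod_morphism (munit_map_fun f).
Proof. by move=> a b; apply: bcompBl. Qed.
Definition munit_map X Y (f : bhom X Y) :
    {additive bhom Y (gpt gT) -> bhom X (gpt gT)} :=
  HB.pack (munit_map_fun f)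
    (GRing.isZmodMorphism.Build _ _ _ (munit_map_additive f)).
Definition munit : mackey :=
  @Mackey (fun X => bhom X (gpt gT)) munit_map
    (fun X Y f g a => bcompDr a f g) (fun X a => bcomp1 a)
    (fun X Y Z g f a => bcompA a g f).
End Unit.

(** Day convolution: the coend over [X] and [Y] of
    [M X (x) N Y (x) bhom Z (X * Y)], presented by its elementary tensors. *)
Section Box.
Variables M N : mackey.

Record boxgen Z := BoxGen {
  box_X : gset gT;
  box_Y : gset gT;
  box_m : M box_X;
  box_n : N box_Y;
  box_h : bhom Z (gprod box_X box_Y) }.

Inductive boxrel Z : zterm (boxgen Z) -> zterm (boxgen Z) -> Prop :=
  | box_addm X Y (m m' : M X) (n : N Y) (h : bhom Z (gprod X Y)) :
      boxrel (ZGen (BoxGen (m + m') n h))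
        (ZAdd (ZGen (BoxGen m n h)) (ZGen (BoxGen m' n h)))
  | box_addn X Y (m : M X) (n n' : N Y) (h : bhom Z (gprod X Y)) :
      boxrel (ZGen (BoxGen m (n + n') h))
        (ZAdd (ZGen (BoxGen m n h)) (ZGen (BoxGen m n' h)))
  | box_addh X Y (m : M X) (n : N Y) (h h' : bhom Z (gprod X Y)) :
      boxrel (ZGen (BoxGen m n (h + h')))
        (ZAdd (ZGen (BoxGen m n h)) (ZGen (BoxGen m n h')))
  | box_dinat X X' Y Y' (f : bhom X X') (g : bhom Y Y')
      (m : M X') (n : N Y') (h : bhom Z (gprod X Y)) :
      boxrel (ZGen (BoxGen (mmap M f m) (mmap N g n) h))
        (ZGen (BoxGen m n (bprod f g \bo h))).

Definition box_ob Z : zmodType := presented (@boxrel Z).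

Section BoxElt.
Variable Z : gset gT.

Definition bx X Y (m : M X) (n : N Y) (h : bhom Z (gprod X Y)) : box_ob Z :=
  pgen (BoxGen m n h).

Lemma bxDm X Y (m m' : M X) (n : N Y) h : bx (m + m') n h = bx m n h + bx m' n h.
Proof. by rewrite -pclsD; apply: cls_eq; apply: zeq_rel; apply: box_addm. Qed.
Lemma bxDn X Y (m : M X) (n n' : N Y) h : bx m (n + n') h = bx m n h + bx m n' h.
Proof. by rewrite -pclsD; apply: cls_eq; apply: zeq_rel; apply: box_addn. Qed.
Lemma bxDh X Y (m : M X) (n : N Y) h h' : bx m n (h + h') = bx m n h + bx m n h'.
Proof. by rewrite -pclsD; apply: cls_eq; apply: zeq_rel; apply: box_addh. Qed.
Lemma bx_dinat X X' Y Y' (f : bhom X X') (g : bhom Y Y') (m : M X') (n : N Y') h :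
  bx (mmap M f m) (mmap N g n) h = bx m n (bprod f g \bo h).
Proof. by apply: cls_eq; apply: zeq_rel; apply: box_dinat. Qed.
Lemma bx_dinatl X X' Y (f : bhom X X') (m : M X') (n : N Y) h :
  bx (mmap M f m) n h = bx m n (bprod f (bid Y) \bo h).
Proof. by rewrite -bx_dinat mmap1. Qed.
Lemma bx_dinatr X Y Y' (g : bhom Y Y') (m : M X) (n : N Y') h :
  bx m (mmap N g n) h = bx m n (bprod (bid X) g \bo h).
Proof. by rewrite -bx_dinat mmap1. Qed.
Lemma bx0m X Y (n : N Y) h : bx (0 : M X) n h = 0.
Proof. by apply: (addIr (bx (0 : M X) n h)); rewrite -bxDm !add0r. Qed.
Lemma bx0n X Y (m : M X) h : bx m (0 : N Y) h = 0.
Proof. by apply: (addIr (bx m (0 : N Y) h)); rewrite -bxDn !add0r. Qed.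
Lemma bxNm X Y (m : M X) (n : N Y) h : bx (- m) n h = - bx m n h.
Proof. by apply: (addIr (bx m n h)); rewrite -bxDm !addNr bx0m. Qed.
Lemma bxNn X Y (m : M X) (n : N Y) h : bx m (- n) h = - bx m n h.
Proof. by apply: (addIr (bx m n h)); rewrite -bxDn !addNr bx0n. Qed.

Lemma box_ind (P : box_ob Z -> Prop) :
  (forall X Y m n h, P (@bx X Y m n h)) -> P 0 ->
  (forall x y, P x -> P y -> P (x + y)) -> (forall x, P x -> P (- x)) ->
  forall x, P x.
Proof. by move=> Pb; apply: pres_ind => -[X Y m n h]; apply: Pb. Qed.

Section Lift.
Variables (V : zmodType).
Variable phi : forall X Y, M X -> N Y -> bhom Z (gprod X Y) -> V.

Record box_bal := BoxBal {
  bal_m : forall X Y (m m' : M X) (n : N Y) h,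
    phi (m + m') n h = phi m n h + phi m' n h;
  bal_n : forall X Y (m : M X) (n n' : N Y) h,
    phi m (n + n') h = phi m n h + phi m n' h;
  bal_h : forall X Y (m : M X) (n : N Y) h h',
    phi m n (h + h') = phi m n h + phi m n h';
  bal_dinat : forall X X' Y Y' (f : bhom X X') (g : bhom Y Y') m n h,
    phi (mmap M f m) (mmap N g n) h = phi m n (bprod f g \bo h) }.

Hypothesis phiP : box_bal.

Definition box_phi (t : boxgen Z) : V := phi (box_m t) (box_n t) (box_h t).
Lemma box_phi_rel a b : boxrel a b -> zeval box_phi a = zeval box_phi b.
Proof.
case: phiP => Hm Hn Hh Hd.
by case=> *; rewrite /= /box_phi /= ?Hm ?Hn ?Hh ?Hd.
Qed.
Definition box_lift : {additive box_ob Z -> V} := pres_lift box_phi_rel.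
Lemma box_liftE X Y m n h : box_lift (@bx X Y m n h) = phi m n h.
Proof. exact: pres_liftE. Qed.
End Lift.

Lemma box_ext (V : zmodType) (f g : {additive box_ob Z -> V}) :
  (forall X Y m n h, f (@bx X Y m n h) = g (bx m n h)) -> f =1 g.
Proof. by move=> fg; apply: pres_ext => -[X Y m n h]; apply: fg. Qed.

End BoxElt.

Lemma box_map_bal Z Z' (k : bhom Z Z') :
  box_bal (fun X Y m n (h : bhom Z' (gprod X Y)) => bx m n (h \bo k)).
Proof.
split=> *; rewrite ?bxDm ?bxDn //; first by rewrite bcompDl bxDh.
by rewrite bx_dinat bcompA.
Qed.
Definition box_map Z Z' (k : bhom Z Z') : {additive box_ob Z' -> box_ob Z} :=
  box_lift (box_map_bal k).
Lemma box_mapE Z Z' (k : bhom Z Z') X Y m n h :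
  box_map k (@bx Z' X Y m n h) = bx m n (h \bo k).
Proof. exact: box_liftE. Qed.

Lemma box_mapD Z Z' (k k' : bhom Z Z') x :
  box_map (k + k') x = box_map k x + box_map k' x.
Proof.
elim/box_ind: x => [X Y m n h||x y Hx Hy|x Hx].
- by rewrite !box_mapE bcompDr bxDh.
- by rewrite !raddf0 addr0.
- by rewrite !raddfD Hx Hy /= addrACA.
- by rewrite !raddfN Hx /= opprD.
Qed.
Lemma box_map1 Z x : box_map (bid Z) x = x.
Proof.
elim/box_ind: x => [X Y m n h||x y Hx Hy|x Hx].
- by rewrite box_mapE bcomp1.
- by rewrite raddf0.
- by rewrite raddfD Hx Hy.
- by rewrite raddfN Hx.
Qed.
Lemma box_map_comp Z1 Z2 Z3 (l : bhom Z2 Z3) (k : bhom Z1 Z2) x :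
  box_map (l \bo k) x = box_map k (box_map l x).
Proof.
elim/box_ind: x => [X Y m n h||x y Hx Hy|x Hx].
- by rewrite !box_mapE bcompA.
- by rewrite !raddf0.
- by rewrite !raddfD Hx Hy.
- by rewrite !raddfN Hx.
Qed.

Definition box : mackey := Mackey box_mapD box_map1 box_map_comp.

End Box.
Arguments bx {M N Z X Y} m n h.
Arguments box_lift {M N Z V phi} phiP : simpl never.

Lemma mmap_boxE (M N : mackey) Z Z' (k : bhom Z Z') X Y (m : M X) (n : N Y)
    (h : bhom Z' (gprod X Y)) :
  mmap (box M N) k (bx m n h) = bx m n (h \bo k).
Proof. exact: box_mapE. Qed.

Lemma box_trans (M N P : mackey)
    (phi : forall Z X Y, M X -> N Y -> bhom Z (gprod X Y) -> P Z)
    (H : forall Z, box_bal (@phi Z)) :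
  (forall Z Z' (k : bhom Z Z') X Y m n h,
      @phi Z X Y m n (h \bo k) = mmap P k (@phi Z' X Y m n h)) ->
  forall Z Z' (k : bhom Z Z') x,
    box_lift (H Z) (mmap (box M N) k x) = mmap P k (box_lift (H Z') x).
Proof.
move=> phiN Z Z' k; elim/box_ind=> [X Y m n h||x y Hx Hy|x Hx].
- by rewrite mmap_boxE !box_liftE phiN.
- by rewrite !raddf0.
- by rewrite !raddfD Hx Hy.
- by rewrite !raddfN Hx.
Qed.

Section BoxFunctor.
Variables (M M' N N' : mackey) (t : mtrans M M') (u : mtrans N N').
Lemma box_tr_bal Z :
  box_bal (fun X Y (m : M X) (n : N Y) (h : bhom Z (gprod X Y)) =>
    bx (t X m) (u Y n) h).
Proof.
split=> *; rewrite ?raddfD ?bxDm ?bxDn ?bxDh //.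
by rewrite !mtr_nat bx_dinat.
Qed.
Lemma box_tr_nat Z Z' (k : bhom Z Z') x :
  box_lift (box_tr_bal Z) (mmap (box M N) k x) =
  mmap (box M' N') k (box_lift (box_tr_bal Z') x).
Proof.
by apply: (@box_trans M N (box M' N') _ box_tr_bal) => *; rewrite mmap_boxE.
Qed.
Definition box_tr : mtrans (box M N) (box M' N') :=
  @MTrans (box M N) (box M' N') (fun Z => box_lift (box_tr_bal Z)) box_tr_nat.
Lemma box_trE Z X Y (m : M X) (n : N Y) (h : bhom Z (gprod X Y)) :
  box_tr Z (bx m n h) = bx (t X m) (u Y n) h.
Proof. exact: box_liftE. Qed.
End BoxFunctor.

Lemma box_cancel (M N P : mackey) (t : mtrans (box M N) P)
    (u : mtrans P (box M N)) :
  (forall Z X Y (m : M X) (n : N Y) (h : bhom Z (gprod X Y)),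
     u Z (t Z (bx m n h)) = bx m n h) ->
  forall Z, cancel (t Z) (u Z).
Proof.
move=> H Z; elim/box_ind=> [X Y m n h||x y Hx Hy|x Hx] //.
- by rewrite !raddf0.
- by rewrite !raddfD Hx Hy.
- by rewrite !raddfN Hx.
Qed.

Lemma box_iso M M' N N' : miso M M' -> miso N N' -> miso (box M N) (box M' N').
Proof.
case=> t [t' [tK t'K]] [u [u' [uK u'K]]]; exists (box_tr t u), (box_tr t' u').
split; apply: box_cancel => Z X Y m n h; rewrite !box_trE ?tK ?uK //.
by rewrite t'K u'K.
Qed.

Section Comm.
Variables M N : mackey.
Lemma box_swap_bal Z : box_bal (fun X Y (m : M X) (n : N Y)
  (h : bhom Z (gprod X Y)) => bx n m (bswap X Y \bo h)).
Proof.
split=> *; rewrite ?bxDm ?bxDn // ?bcompDr ?bxDh //.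
by rewrite bx_dinat bcompA -bswap_nat -bcompA.
Qed.
Lemma box_swap_nat Z Z' (k : bhom Z Z') x :
  box_lift (box_swap_bal Z) (mmap (box M N) k x) =
  mmap (box N M) k (box_lift (box_swap_bal Z') x).
Proof.
by apply: (@box_trans M N (box N M) _ box_swap_bal) => *; rewrite mmap_boxE bcompA.
Qed.
Definition box_swap : mtrans (box M N) (box N M) :=
  @MTrans (box M N) (box N M) (fun Z => box_lift (box_swap_bal Z)) box_swap_nat.
Lemma box_swapE Z X Y (m : M X) (n : N Y) (h : bhom Z (gprod X Y)) :
  box_swap Z (bx m n h) = bx n m (bswap X Y \bo h).
Proof. exact: box_liftE. Qed.
End Comm.

Lemma boxC M N : miso (box M N) (box N M).
Proof.
exists (box_swap M N), (box_swap N M).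
by split; apply: box_cancel => Z X Y m n h; rewrite !box_swapE bcompA bswapK b1comp.
Qed.

Section UnitLaw.
Variable M : mackey.
Lemma box_lunit_bal Z : box_bal (fun X Y (a : munit X) (m : M Y)
  (h : bhom Z (gprod X Y)) => mmap M (blunit Y \bo bprod a (bid Y) \bo h) m).
Proof.
split=> [X Y a a' m h|X Y a m m' h|X Y a m h h'|X X' Y Y' f g a m h].
- by rewrite bprodDl bcompDr bcompDl mmapD.
- by rewrite raddfD.
- by rewrite bcompDr mmapD.
- rewrite -mmap_comp; congr (mmap M _ m) => /=.
  rewrite !bcompA -blunit_nat -!(bcompA (blunit _)); congr (_ \bo _).
  by rewrite -!bcompA !(bcompA (bprod _ _)) !bprod_comp !b1comp bcomp1.
Qed.
Lemma box_lunit_nat Z Z' (k : bhom Z Z') x :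
  box_lift (box_lunit_bal Z) (mmap (box munit M) k x) =
  mmap M k (box_lift (box_lunit_bal Z') x).
Proof.
by apply: (@box_trans munit M M _ box_lunit_bal) => *; rewrite bcompA mmap_comp.
Qed.
Definition box_lunit : mtrans (box munit M) M :=
  @MTrans (box munit M) M (fun Z => box_lift (box_lunit_bal Z)) box_lunit_nat.
Lemma box_lunitE Z X Y (a : munit X) (m : M Y) (h : bhom Z (gprod X Y)) :
  box_lunit Z (bx a m h) = mmap M (blunit Y \bo bprod a (bid Y) \bo h) m.
Proof. exact: box_liftE. Qed.

Definition box_lununit_fun Z (m : M Z) : box munit M Z :=
  bx (bid (gpt gT) : munit (gpt gT)) m (blununit Z).
Lemma box_lununit_additive Z : zmod_morphism (@box_lununit_fun Z).
Proof. by move=> m m'; rewrite /box_lununit_fun bxDn bxNn. Qed.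
Definition box_lununit_add Z : {additive M Z -> box munit M Z} :=
  HB.pack (@box_lununit_fun Z)
    (GRing.isZmodMorphism.Build _ _ _ (@box_lununit_additive Z)).
Lemma box_lununit_addE Z (m : M Z) :
  box_lununit_add Z m = bx (bid (gpt gT) : munit (gpt gT)) m (blununit Z).
Proof. by []. Qed.
Lemma box_lununit_nat Z Z' (k : bhom Z Z') m :
  box_lununit_add Z (mmap M k m) = mmap (box munit M) k (box_lununit_add Z' m).
Proof.
by rewrite !box_lununit_addE mmap_boxE bx_dinatr blununit_nat.
Qed.
Definition box_lununit : mtrans M (box munit M) := @MTrans M (box munit M) box_lununit_add box_lununit_nat.

Lemma box1 : miso (box munit M) M.
Proof.
exists box_lunit, box_lununit; split; last first.
  move=> Z m; rewrite -[box_lununit Z m]/(box_lununit_add Z m) box_lununit_addE box_lunitE.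
  by rewrite bprod1 bcomp1 blununitK mmap1.
apply: box_cancel => Z X Y a m h.
rewrite box_lunitE -[LHS]/(box_lununit_add Z _) box_lununit_addE bx_dinatr blununit_nat.
rewrite !bcompA blunitK b1comp -bx_dinatl /=.
by rewrite /munit_map_fun b1comp.
Qed.
End UnitLaw.

Section Assoc.
Variables M N P : mackey.

Section Left.
Variables (Z W V : gset gT).
Lemma assocl_bal (p : P V) (h : bhom Z (gprod W V)) :
  box_bal (fun X Y (m : M X) (n : N Y) (k : bhom W (gprod X Y)) =>
    bx m (bx n p (bid (gprod Y V)) : box N P (gprod Y V))
      (bunassoc X Y V \bo (bprod k (bid V) \bo h))).
Proof.
split=> [X Y m m' n k|X Y m n n' k|X Y m n k k'|X X' Y Y' f g m n k].
- by rewrite bxDm.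
- by rewrite bxDm bxDn.
- by rewrite bprodDl bcompDl bcompDr bxDh.
- have -> : bx (mmap N g n) p (bid (gprod Y V)) =
      mmap (box N P) (bprod g (bid V)) (bx n p (bid (gprod Y' V))).
    by rewrite bx_dinatl bcomp1 mmap_boxE b1comp.
  rewrite bx_dinat bcompA -bunassoc_nat -bcompA; congr (bx _ _ (_ \bo _)).
  by rewrite bcompA bprod_comp b1comp.
Qed.
Definition assocl (p : P V) (h : bhom Z (gprod W V)) :
    {additive box M N W -> box M (box N P) Z} := box_lift (assocl_bal p h).
Lemma assoclE p h X Y (m : M X) (n : N Y) (k : bhom W (gprod X Y)) :
  assocl p h (bx m n k) =
  bx m (bx n p (bid (gprod Y V)) : box N P (gprod Y V))
    (bunassoc X Y V \bo (bprod k (bid V) \bo h)).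
Proof. exact: box_liftE. Qed.
End Left.

Lemma assocl_bal2 Z : box_bal (fun W V (t : box M N W) (p : P V)
  (h : bhom Z (gprod W V)) => assocl p h t).
Proof.
split=> [W V t t' p h|W V t p p' h|W V t p h h'|W W' V V' F G t p h].
- by rewrite raddfD.
- elim/box_ind: t => [X Y m n k||x y Hx Hy|x Hx].
  + by rewrite !assoclE !bxDn.
  + by rewrite !raddf0 addr0.
  + by rewrite !raddfD Hx Hy addrACA.
  + by rewrite !raddfN Hx opprD.
- elim/box_ind: t => [X Y m n k||x y Hx Hy|x Hx].
  + by rewrite !assoclE !bcompDr bxDh.
  + by rewrite !raddf0 addr0.
  + by rewrite !raddfD Hx Hy addrACA.
  + by rewrite !raddfN Hx opprD.
- elim/box_ind: t => [X Y m n k||x y Hx Hy|x Hx].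
  + rewrite mmap_boxE !assoclE.
    have -> : bx n (mmap P G p) (bid (gprod Y V)) =
        mmap (box N P) (bprod (bid Y) G) (bx n p (bid (gprod Y V'))).
      by rewrite bx_dinatr bcomp1 mmap_boxE b1comp.
    rewrite bx_dinatr bcompA -bunassoc_nat -bcompA bprod1.
    by rewrite !(bcompA (bprod _ _)) !bprod_comp !(b1comp, bcomp1).
  + by rewrite !raddf0.
  + by rewrite !raddfD Hx Hy.
  + by rewrite !raddfN Hx.
Qed.
Lemma assocl_nat Z Z' (k : bhom Z Z') x :
  box_lift (assocl_bal2 Z) (mmap (box (box M N) P) k x) =
  mmap (box M (box N P)) k (box_lift (assocl_bal2 Z') x).
Proof.
apply: (@box_trans _ _ (box M (box N P)) _ assocl_bal2) =>
  {x}{}Z {}Z' {}k W V t p h.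
elim/box_ind: t => [X Y m n l||x y Hx Hy|x Hx].
- by rewrite !assoclE mmap_boxE !bcompA.
- by rewrite !raddf0.
- by rewrite !raddfD Hx Hy.
- by rewrite !raddfN Hx.
Qed.
Definition box_assocl : mtrans (box (box M N) P) (box M (box N P)) :=
  @MTrans (box (box M N) P) (box M (box N P)) (fun Z => box_lift (assocl_bal2 Z)) assocl_nat.
Lemma box_assoclE Z V X Y W (m : M X) (n : N Y) (k : bhom W (gprod X Y)) (p : P V)
    (h : bhom Z (gprod W V)) :
  box_assocl Z (bx (bx m n k : box M N W) p h) =
  bx m (bx n p (bid (gprod Y V)) : box N P (gprod Y V))
    (bunassoc X Y V \bo (bprod k (bid V) \bo h)).
Proof. by rewrite box_liftE assoclE. Qed.

Section Right.
Variables (Z X W : gset gT).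
Lemma assocr_bal (m : M X) (h : bhom Z (gprod X W)) :
  box_bal (fun Y V (n : N Y) (p : P V) (k : bhom W (gprod Y V)) =>
    bx (bx m n (bid (gprod X Y)) : box M N (gprod X Y)) p
      (bassoc X Y V \bo (bprod (bid X) k \bo h))).
Proof.
split=> [Y V n n' p k|Y V n p p' k|Y V n p k k'|Y Y' V V' f g n p k].
- by rewrite bxDn bxDm.
- by rewrite bxDn.
- by rewrite bprodDr bcompDl bcompDr bxDh.
- have -> : bx m (mmap N f n) (bid (gprod X Y)) =
      mmap (box M N) (bprod (bid X) f) (bx m n (bid (gprod X Y'))).
    by rewrite bx_dinatr bcomp1 mmap_boxE b1comp.
  rewrite bx_dinat bcompA -bassoc_nat -bcompA; congr (bx _ _ (_ \bo _)).
  by rewrite bcompA bprod_comp b1comp.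
Qed.
Definition assocr (m : M X) (h : bhom Z (gprod X W)) :
    {additive box N P W -> box (box M N) P Z} := box_lift (assocr_bal m h).
Lemma assocrE m h Y V (n : N Y) (p : P V) (k : bhom W (gprod Y V)) :
  assocr m h (bx n p k) =
  bx (bx m n (bid (gprod X Y)) : box M N (gprod X Y)) p
    (bassoc X Y V \bo (bprod (bid X) k \bo h)).
Proof. exact: box_liftE. Qed.
End Right.

Lemma assocr_bal2 Z : box_bal (fun X W (m : M X) (t : box N P W)
  (h : bhom Z (gprod X W)) => assocr m h t).
Proof.
split=> [X W m m' t h|X W m t t' h|X W m t h h'|X X' W W' F G m t h].
- elim/box_ind: t => [Y V n p k||x y Hx Hy|x Hx].
  + by rewrite !assocrE !bxDm.
  + by rewrite !raddf0 addr0.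
  + by rewrite !raddfD Hx Hy addrACA.
  + by rewrite !raddfN Hx opprD.
- by rewrite raddfD.
- elim/box_ind: t => [Y V n p k||x y Hx Hy|x Hx].
  + by rewrite !assocrE !bcompDr bxDh.
  + by rewrite !raddf0 addr0.
  + by rewrite !raddfD Hx Hy addrACA.
  + by rewrite !raddfN Hx opprD.
- elim/box_ind: t => [Y V n p k||x y Hx Hy|x Hx].
  + rewrite mmap_boxE !assocrE.
    have -> : bx (mmap M F m) n (bid (gprod X Y)) =
        mmap (box M N) (bprod F (bid Y)) (bx m n (bid (gprod X' Y))).
      by rewrite bx_dinatl bcomp1 mmap_boxE b1comp.
    rewrite bx_dinatl bcompA -bassoc_nat -bcompA bprod1.
    by rewrite !(bcompA (bprod _ _)) !bprod_comp !(b1comp, bcomp1).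
  + by rewrite !raddf0.
  + by rewrite !raddfD Hx Hy.
  + by rewrite !raddfN Hx.
Qed.
Lemma assocr_nat Z Z' (k : bhom Z Z') x :
  box_lift (assocr_bal2 Z) (mmap (box M (box N P)) k x) =
  mmap (box (box M N) P) k (box_lift (assocr_bal2 Z') x).
Proof.
apply: (@box_trans _ _ (box (box M N) P) _ assocr_bal2) =>
  {x}{}Z {}Z' {}k X W m t h.
elim/box_ind: t => [Y V n p l||x y Hx Hy|x Hx].
- by rewrite !assocrE mmap_boxE !bcompA.
- by rewrite !raddf0.
- by rewrite !raddfD Hx Hy.
- by rewrite !raddfN Hx.
Qed.
Definition box_assocr : mtrans (box M (box N P)) (box (box M N) P) :=
  @MTrans (box M (box N P)) (box (box M N) P) (fun Z => box_lift (assocr_bal2 Z)) assocr_nat.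
Lemma box_assocrE Z V X Y W (m : M X) (n : N Y) (p : P V) (k : bhom W (gprod Y V))
    (h : bhom Z (gprod X W)) :
  box_assocr Z (bx m (bx n p k : box N P W) h) =
  bx (bx m n (bid (gprod X Y)) : box M N (gprod X Y)) p
    (bassoc X Y V \bo (bprod (bid X) k \bo h)).
Proof. by rewrite box_liftE assocrE. Qed.

Lemma boxA : miso (box M (box N P)) (box (box M N) P).
Proof.
exists box_assocr, box_assocl; split; apply: box_cancel.
- move=> Z X W m t h; elim/box_ind: t => [Y V n p k||x y Hx Hy|x Hx].
  + rewrite box_assocrE box_assoclE bprod1 b1comp bcompA bassocK b1comp.
    by rewrite -bx_dinatr mmap_boxE b1comp.
  + by rewrite bx0n !raddf0.
  + by rewrite bxDn !raddfD Hx Hy.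
  + by rewrite bxNn !raddfN Hx.
- move=> Z W V t p h; elim/box_ind: t => [X Y m n k||x y Hx Hy|x Hx].
  + rewrite box_assoclE box_assocrE bprod1 b1comp bcompA bunassocK b1comp.
    by rewrite -bx_dinatl mmap_boxE b1comp.
  + by rewrite bx0m !raddf0.
  + by rewrite bxDm !raddfD Hx Hy.
  + by rewrite bxNm !raddfN Hx.
Qed.
End Assoc.

End BurnsideCategory.

Section Tensor.
Variable R : comPzRingType.
Implicit Types M N P : lmodType R.

Definition modiso M N :=
  exists (f : {linear M -> N}) (g : {linear N -> M}), cancel f g /\ cancel g f.

Lemma modiso_refl M : modiso M M.
Proof. by exists idfun, idfun. Qed.
Lemma modiso_sym M N : modiso M N -> modiso N M.
Proof. by case=> f [g [fK gK]]; exists g, f. Qed.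
Lemma modiso_trans M N P : modiso M N -> modiso N P -> modiso M P.
Proof.
case=> f [g [fK gK]] [f' [g' [fK' gK']]]; exists (f' \o f), (g \o g').
by split=> x /=; rewrite ?fK' ?fK ?gK ?gK'.
Qed.

(** Additive and [R]-balanced pairs; the scalars act through the first factor. *)
Section Tens.
Variables M N : lmodType R.

Inductive tensrel : zterm (M * N) -> zterm (M * N) -> Prop :=
  | tens_addl m m' n : tensrel (ZGen (m + m', n)) (ZAdd (ZGen (m, n)) (ZGen (m', n)))
  | tens_addr m n n' : tensrel (ZGen (m, n + n')) (ZAdd (ZGen (m, n)) (ZGen (m, n')))
  | tens_bal r m n : tensrel (ZGen (r *: m, n)) (ZGen (m, r *: n)).

Definition tens : Type := presented tensrel.
HB.instance Definition _ := GRing.Zmodule.on tens.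

Definition tn (m : M) (n : N) : tens := pgen (m, n).

Lemma tnDl m m' n : tn (m + m') n = tn m n + tn m' n.
Proof. by rewrite -pclsD; apply: cls_eq; apply: zeq_rel; apply: tens_addl. Qed.
Lemma tnDr m n n' : tn m (n + n') = tn m n + tn m n'.
Proof. by rewrite -pclsD; apply: cls_eq; apply: zeq_rel; apply: tens_addr. Qed.
Lemma tn_bal r m n : tn (r *: m) n = tn m (r *: n).
Proof. by apply: cls_eq; apply: zeq_rel; apply: tens_bal. Qed.
Lemma tn0l n : tn 0 n = 0.
Proof. by apply: (addIr (tn 0 n)); rewrite -tnDl !add0r. Qed.
Lemma tn0r m : tn m 0 = 0.
Proof. by apply: (addIr (tn m 0)); rewrite -tnDr !add0r. Qed.
Lemma tnNl m n : tn (- m) n = - tn m n.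
Proof. by apply: (addIr (tn m n)); rewrite -tnDl !addNr tn0l. Qed.
Lemma tnNr m n : tn m (- n) = - tn m n.
Proof. by apply: (addIr (tn m n)); rewrite -tnDr !addNr tn0r. Qed.

Lemma tens_ind (P : tens -> Prop) :
  (forall m n, P (tn m n)) -> P 0 ->
  (forall x y, P x -> P y -> P (x + y)) -> (forall x, P x -> P (- x)) ->
  forall x, P x.
Proof. by move=> Pt; apply: pres_ind => -[m n]; apply: Pt. Qed.

Section Lift.
Variables (V : zmodType) (phi : M -> N -> V).
Record tens_balanced := TensBalanced {
  tbal_l : forall m m' n, phi (m + m') n = phi m n + phi m' n;
  tbal_r : forall m n n', phi m (n + n') = phi m n + phi m n';
  tbal_s : forall r m n, phi (r *: m) n = phi m (r *: n) }.
Hypothesis phiP : tens_balanced.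
Lemma tens_phi_rel a b : tensrel a b ->
  zeval (fun t => phi t.1 t.2) a = zeval (fun t => phi t.1 t.2) b.
Proof. by case: phiP => Hl Hr Hs; case=> *; rewrite /= ?Hl ?Hr ?Hs. Qed.
Definition tens_lift : {additive tens -> V} := pres_lift tens_phi_rel.
Lemma tens_liftE m n : tens_lift (tn m n) = phi m n.
Proof. exact: pres_liftE. Qed.
End Lift.

Lemma tens_scale_bal r : tens_balanced (fun m n => tn (r *: m) n).
Proof.
split=> [m m' n|m n n'|s m n]; rewrite ?scalerDr ?tnDl ?tnDr //.
by rewrite -tn_bal !scalerA mulrC.
Qed.
Definition tens_scale (r : R) (x : tens) : tens :=
  locked (tens_lift (tens_scale_bal r) x).
Lemma tens_scaleE r m n : tens_scale r (tn m n) = tn (r *: m) n.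
Proof. by rewrite /tens_scale -lock tens_liftE. Qed.
Lemma tens_scaleD r : {morph tens_scale r : x y / x + y}.
Proof. by move=> x y; rewrite /tens_scale -!lock raddfD. Qed.
Lemma tens_scale0 r : tens_scale r 0 = 0.
Proof. by rewrite /tens_scale -lock raddf0. Qed.
Lemma tens_scaleN r : {morph tens_scale r : x / - x}.
Proof. by move=> x; rewrite /tens_scale -!lock raddfN. Qed.

Lemma tens_scaleA a b x : tens_scale a (tens_scale b x) = tens_scale (a * b) x.
Proof.
elim/tens_ind: x => [m n||x y Hx Hy|x Hx].
- by rewrite !tens_scaleE scalerA.
- by rewrite !tens_scale0.
- by rewrite !tens_scaleD Hx Hy.
- by rewrite !tens_scaleN Hx.
Qed.
Lemma tens_scale1 : left_id 1 tens_scale.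
Proof.
elim/tens_ind=> [m n||x y Hx Hy|x Hx].
- by rewrite !tens_scaleE scale1r.
- by rewrite !tens_scale0.
- by rewrite !tens_scaleD Hx Hy.
- by rewrite !tens_scaleN Hx.
Qed.
Lemma tens_scaleDl x : {morph tens_scale^~ x : a b / a + b}.
Proof.
move=> a b; elim/tens_ind: x => [m n||x y Hx Hy|x Hx].
- by rewrite !tens_scaleE scalerDl tnDl.
- by rewrite !tens_scale0 addr0.
- by rewrite !tens_scaleD Hx Hy addrACA.
- by rewrite !tens_scaleN Hx opprD.
Qed.
HB.instance Definition _ := GRing.Zmodule_isLmodule.Build R tens
  tens_scaleA tens_scale1 tens_scaleD tens_scaleDl.

Lemma scale_tn r m n : r *: tn m n = tn (r *: m) n.
Proof. exact: tens_scaleE. Qed.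
Lemma scale_tnr r m n : r *: tn m n = tn m (r *: n).
Proof. by rewrite scale_tn tn_bal. Qed.

Section LinLift.
Variables (P : lmodType R) (phi : M -> N -> P).
Record bilin := Bilin {
  bilin_Dl : forall m m' n, phi (m + m') n = phi m n + phi m' n;
  bilin_Dr : forall m n n', phi m (n + n') = phi m n + phi m n';
  bilin_Zl : forall r m n, phi (r *: m) n = r *: phi m n;
  bilin_Zr : forall r m n, phi m (r *: n) = r *: phi m n }.
Hypothesis phiP : bilin.
Lemma bilin_balanced : tens_balanced phi.
Proof. by case: phiP => Hl Hr Hzl Hzr; split=> // r m n; rewrite Hzl Hzr. Qed.
Definition tens_linfun (x : tens) : P := tens_lift bilin_balanced x.
Lemma tens_lin_linear : linear tens_linfun.
Proof.
have H r x : tens_lift bilin_balanced (r *: x) = r *: tens_lift bilin_balanced x.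
  elim/tens_ind: x => [m n||x y Hx Hy|x Hx].
  - by rewrite scale_tn !tens_liftE (bilin_Zl phiP).
  - by rewrite scaler0 !raddf0 ?scaler0.
  - by rewrite scalerDr !raddfD Hx Hy.
  - by rewrite scalerN !raddfN Hx.
by move=> r x y; rewrite /tens_linfun raddfD H.
Qed.
Definition tens_lin : {linear tens -> P} :=
  HB.pack tens_linfun (GRing.isLinear.Build _ _ _ _ _ tens_lin_linear).
Lemma tens_linE m n : tens_lin (tn m n) = phi m n.
Proof. exact: (tens_liftE bilin_balanced). Qed.
End LinLift.

Lemma tens_cancel (P : lmodType R) (f : {linear tens -> P}) (g : {linear P -> tens}) :
  (forall m n, g (f (tn m n)) = tn m n) -> cancel f g.
Proof.
move=> H; elim/tens_ind=> [m n||x y Hx Hy|x Hx] //.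
- by rewrite !linear0.
- by rewrite !linearD Hx Hy.
- by rewrite !linearN Hx.
Qed.

End Tens.
Arguments tn {M N} m n.
Arguments tens_lin {M N P phi} phiP : simpl never.

Lemma tens_map_bilin M M' N N' (f : {linear M -> M'}) (g : {linear N -> N'}) :
  bilin (fun m n => tn (f m) (g n)).
Proof.
by split=> *; rewrite ?linearD ?linearZ_LR ?tnDl ?tnDr ?scale_tn ?tn_bal.
Qed.
Definition tens_map M M' N N' (f : {linear M -> M'}) (g : {linear N -> N'}) :=
  tens_lin (tens_map_bilin f g).
Lemma tens_mapE M M' N N' (f : {linear M -> M'}) (g : {linear N -> N'}) m n :
  tens_map f g (tn m n) = tn (f m) (g n).
Proof. exact: tens_linE. Qed.

Lemma tens_iso M M' N N' :
  modiso M M' -> modiso N N' -> modiso (tens M N) (tens M' N').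
Proof.
case=> f [f' [fK f'K]] [g [g' [gK g'K]]]; exists (tens_map f g), (tens_map f' g').
by split; apply: tens_cancel => m n; rewrite !tens_mapE ?fK ?gK ?f'K ?g'K.
Qed.

Lemma tens_swap_bilin M N : bilin (fun (m : M) (n : N) => tn n m).
Proof. by split=> *; rewrite ?tnDl ?tnDr ?scale_tn ?tn_bal. Qed.
Lemma tensC M N : modiso (tens M N) (tens N M).
Proof.
exists (tens_lin (tens_swap_bilin M N)), (tens_lin (tens_swap_bilin N M)).
by split; apply: tens_cancel => m n; rewrite !tens_linE.
Qed.

Lemma tens_lunit_bilin M : bilin (fun (r : R^o) (m : M) => r *: m).
Proof.
split=> *; rewrite ?scalerDl ?scalerDr ?scalerA //; last by rewrite mulrC.
Qed.
Definition tens_lununit_fun M (m : M) : tens R^o M := tn (1 : R^o) m.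
Lemma tens_lununit_linear M : linear (@tens_lununit_fun M).
Proof. by move=> r x y; rewrite /tens_lununit_fun tnDr -scale_tnr. Qed.
Definition tens_lununit M : {linear M -> tens R^o M} :=
  HB.pack (@tens_lununit_fun M)
    (GRing.isLinear.Build _ _ _ _ _ (@tens_lununit_linear M)).
Lemma tens1 M : modiso (tens R^o M) M.
Proof.
exists (tens_lin (tens_lunit_bilin M)), (tens_lununit M); split.
  apply: tens_cancel => r m; rewrite tens_linE.
  rewrite -[LHS]/(tn (1 : R^o) (r *: m)) -tn_bal; congr tn.
  exact: mulr1.
by move=> m; rewrite -[tens_lununit M m]/(tn (1 : R^o) m) tens_linE scale1r.
Qed.

Section TensA.
Variables M N P : lmodType R.

Lemma tens_assocl_bilin0 (p : P) :
  bilin (fun (m : M) (n : N) => tn m (tn n p)).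
Proof.
split=> [m m' n|m n n'|r m n|r m n].
- by rewrite tnDl.
- by rewrite tnDl tnDr.
- by rewrite -scale_tn.
- by rewrite -scale_tn -scale_tnr.
Qed.
Lemma tens_assocl_bilin :
  bilin (fun (t : tens M N) (p : P) => tens_lin (tens_assocl_bilin0 p) t).
Proof.
split=> [t t' p|t p p'|r t p|r t p].
- by rewrite linearD.
- elim/tens_ind: t => [m n||x y Hx Hy|x Hx].
  + by rewrite !tens_linE !tnDr.
  + by rewrite !linear0 addr0.
  + by rewrite !linearD Hx Hy addrACA.
  + by rewrite !linearN Hx opprD.
- by rewrite linearZ_LR.
- elim/tens_ind: t => [m n||x y Hx Hy|x Hx].
  + by rewrite !tens_linE /= !scale_tnr.
  + by rewrite !linear0 ?scaler0.
  + by rewrite !linearD Hx Hy ?scalerDr.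
  + by rewrite !linearN Hx ?scalerN.
Qed.
Definition tens_assocl := tens_lin tens_assocl_bilin.
Lemma tens_assoclE m n p : tens_assocl (tn (tn m n) p) = tn m (tn n p).
Proof. by rewrite !tens_linE. Qed.

Lemma tens_assocr_bilin0 (m : M) :
  bilin (fun (n : N) (p : P) => tn (tn m n) p).
Proof.
split=> [n n' p|n p p'|r n p|r n p].
- by rewrite tnDr tnDl.
- by rewrite tnDr.
- by rewrite -scale_tnr -scale_tn.
- by rewrite -scale_tnr.
Qed.
Lemma tens_assocr_bilin :
  bilin (fun (m : M) (t : tens N P) => tens_lin (tens_assocr_bilin0 m) t).
Proof.
split=> [m m' t|m t t'|r m t|r m t].
- elim/tens_ind: t => [n p||x y Hx Hy|x Hx].
  + by rewrite !tens_linE !tnDl.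
  + by rewrite !linear0 addr0.
  + by rewrite !linearD Hx Hy addrACA.
  + by rewrite !linearN Hx opprD.
- by rewrite linearD.
- elim/tens_ind: t => [n p||x y Hx Hy|x Hx].
  + by rewrite !tens_linE /= !scale_tn.
  + by rewrite !linear0 ?scaler0.
  + by rewrite !linearD Hx Hy ?scalerDr.
  + by rewrite !linearN Hx ?scalerN.
- by rewrite linearZ_LR.
Qed.
Definition tens_assocr := tens_lin tens_assocr_bilin.
Lemma tens_assocrE m n p : tens_assocr (tn m (tn n p)) = tn (tn m n) p.
Proof. by rewrite !tens_linE. Qed.

Lemma tensA : modiso (tens M (tens N P)) (tens (tens M N) P).
Proof.
exists tens_assocr, tens_assocl; split; apply: tens_cancel.
- move=> m; elim/tens_ind=> [n p||x y Hx Hy|x Hx].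
  + by rewrite tens_assocrE tens_assoclE.
  + by rewrite tn0r !linear0.
  + by rewrite tnDr !linearD Hx Hy.
  + by rewrite tnNr !linearN Hx.
- move=> t p; elim/tens_ind: t => [m n||x y Hx Hy|x Hx].
  + by rewrite tens_assoclE tens_assocrE.
  + by rewrite tn0l !linear0.
  + by rewrite tnDl !linearD Hx Hy.
  + by rewrite tnNl !linearN Hx.
Qed.
End TensA.

End Tensor.

(** The groups and modules of the library live in one fixed universe, so a set
    of isomorphism classes of modules cannot carry a library structure; hence
    this record for (possibly large) abelian groups. *)
Record abGroup := AbGroup {
  ab_car :> Type;
  ab_op : ab_car -> ab_car -> ab_car;
  ab_one : ab_car;
  ab_inv : ab_car -> ab_car;
  ab_opA : associative ab_op;
  ab_opC : commutative ab_op;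
  ab_op1 : left_id ab_one ab_op;
  ab_opV : left_inverse ab_one ab_inv ab_op }.

Definition ab_isomorphic (A B : abGroup) : Prop :=
  exists f : A -> B,
    bijective f /\ {morph f : x y / ab_op x y >-> ab_op x y}.

(** The part of a symmetric monoidal category seen by its isomorphism classes
    of objects. *)
Record monoidalUpToIso := MonoidalUpToIso {
  mu_ob :> Type;
  mu_iso : mu_ob -> mu_ob -> Prop;
  mu_ten : mu_ob -> mu_ob -> mu_ob;
  mu_unit : mu_ob;
  mu_refl : forall x, mu_iso x x;
  mu_sym : forall x y, mu_iso x y -> mu_iso y x;
  mu_trans : forall x y z, mu_iso x y -> mu_iso y z -> mu_iso x z;
  mu_cong : forall x x' y y',
    mu_iso x x' -> mu_iso y y' -> mu_iso (mu_ten x y) (mu_ten x' y');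
  mu_assoc : forall x y z, mu_iso (mu_ten x (mu_ten y z)) (mu_ten (mu_ten x y) z);
  mu_comm : forall x y, mu_iso (mu_ten x y) (mu_ten y x);
  mu_lunit : forall x, mu_iso (mu_ten mu_unit x) x }.

Section Pic.
Variable C : monoidalUpToIso.
Local Notation "x ~~ y" := (mu_iso x y) (at level 70).
Local Notation "x (x) y" := (mu_ten x y) (at level 40, left associativity).
Local Notation one := (mu_unit C).

Definition invertible (x : C) := exists y : C, x (x) y ~~ one.

Lemma invertible_ten x y : invertible x -> invertible y -> invertible (x (x) y).
Proof.
case=> x' xx' [y' yy']; exists (y' (x) x').
apply: mu_trans (mu_assoc _ _ _) _.
apply: mu_trans (mu_cong (mu_sym (mu_assoc x y y')) (mu_refl x')) _.
apply: mu_trans xx'; apply: mu_cong (mu_refl _).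
apply: mu_trans (mu_cong (mu_refl x) yy') _.
exact: mu_trans (mu_comm _ _) (mu_lunit _).
Qed.
Lemma invertible_one : invertible one.
Proof. by exists one; apply: mu_lunit. Qed.

(** An isomorphism class is the predicate of being isomorphic to one of its
    members. *)
Definition is_iso_class (P : C -> Prop) :=
  exists2 x, invertible x & P = mu_iso x.
Definition pic_car := {P : C -> Prop | is_iso_class P}.

Definition pic_cls x (hx : invertible x) : pic_car :=
  exist is_iso_class (mu_iso x) (ex_intro2 _ _ x hx erefl).

Definition pic_rep (c : pic_car) : C := projT1 (cid2 (svalP c)).
Lemma pic_rep_inv c : invertible (pic_rep c).
Proof. by rewrite /pic_rep; case: cid2. Qed.
Lemma pic_repE c : sval c = mu_iso (pic_rep c).
Proof. by rewrite /pic_rep; case: cid2. Qed.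

Lemma pic_eqP c d : pic_rep c ~~ pic_rep d <-> c = d.
Proof.
split=> [h|->]; last exact: mu_refl.
apply: eq_sig_hprop => [Q|]; first by move=> ? ?; apply: Prop_irrelevance.
rewrite -[LHS]/(sval c) -[RHS]/(sval d) !pic_repE; apply/funext => z; apply/propext.
by split; apply: mu_trans; [apply: mu_sym|].
Qed.
Lemma pic_rep_cls x (hx : invertible x) : pic_rep (pic_cls hx) ~~ x.
Proof. by rewrite -pic_repE; apply: mu_refl. Qed.

Definition pic_op (c d : pic_car) : pic_car :=
  pic_cls (invertible_ten (pic_rep_inv c) (pic_rep_inv d)).
Definition pic_one : pic_car := pic_cls invertible_one.

Lemma pic_inv_ex c : exists y, invertible y /\ y (x) pic_rep c ~~ one.
Proof.
have [y hy] := pic_rep_inv c; exists y.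
have yx : y (x) pic_rep c ~~ one := mu_trans (mu_comm _ _) hy.
by split=> //; exists (pic_rep c).
Qed.
Definition pic_inv (c : pic_car) : pic_car :=
  pic_cls (proj1 (projT2 (cid (pic_inv_ex c)))).

Lemma pic_op_rep c d : pic_rep (pic_op c d) ~~ pic_rep c (x) pic_rep d.
Proof. exact: pic_rep_cls. Qed.

Lemma pic_opA : associative pic_op.
Proof.
move=> a b c; apply/pic_eqP.
apply: mu_trans (pic_op_rep _ _) _.
apply: mu_trans (mu_cong (mu_refl _) (pic_op_rep _ _)) _.
apply: mu_trans (mu_assoc _ _ _) _; apply: mu_sym.
apply: mu_trans (pic_op_rep _ _) _.
exact: mu_cong (pic_op_rep _ _) (mu_refl _).
Qed.
Lemma pic_opC : commutative pic_op.
Proof.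
move=> a b; apply/pic_eqP.
apply: mu_trans (pic_op_rep _ _) _; apply: mu_trans (mu_comm _ _) _.
exact: mu_sym (pic_op_rep _ _).
Qed.
Lemma pic_op1 : left_id pic_one pic_op.
Proof.
move=> a; apply/pic_eqP; apply: mu_trans (pic_op_rep _ _) _.
apply: mu_trans (mu_lunit _).
exact: mu_cong (pic_rep_cls _) (mu_refl _).
Qed.
Lemma pic_opV : left_inverse pic_one pic_inv pic_op.
Proof.
move=> a; apply/pic_eqP; apply: mu_trans (pic_op_rep _ _) _.
apply: mu_trans (mu_sym (pic_rep_cls invertible_one)).
apply: mu_trans (mu_cong (pic_rep_cls _) (mu_refl _)) _.
exact: proj2 (projT2 (cid (pic_inv_ex a))).
Qed.

Definition Pic : abGroup := AbGroup pic_opA pic_opC pic_op1 pic_opV.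

Lemma pic_cls_eq x y (hx : invertible x) (hy : invertible y) :
  pic_cls hx = pic_cls hy <-> x ~~ y.
Proof.
rewrite -pic_eqP; split=> h.
  apply: mu_trans (mu_sym (pic_rep_cls hx)) _.
  exact: mu_trans h (pic_rep_cls hy).
apply: mu_trans (pic_rep_cls hx) _.
exact: mu_trans h (mu_sym (pic_rep_cls hy)).
Qed.

Lemma pic_op_cls x y (hx : invertible x) (hy : invertible y) :
  pic_op (pic_cls hx) (pic_cls hy) = pic_cls (invertible_ten hx hy).
Proof.
apply/pic_cls_eq; apply: mu_cong; exact: pic_rep_cls.
Qed.

End Pic.

Definition modules (R : comPzRingType) : monoidalUpToIso :=
  @MonoidalUpToIso (lmodType R) (@modiso R) (fun M N => tens M N : lmodType R) (R^o : lmodType R)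
    (@modiso_refl R) (@modiso_sym R) (@modiso_trans R) (@tens_iso R)
    (@tensA R) (@tensC R) (@tens1 R).

Definition Mack (gT : finGroupType) : monoidalUpToIso :=
  @MonoidalUpToIso (mackey gT) (@miso gT) (@box gT) (munit gT)
    (@miso_refl gT) (@miso_sym gT) (@miso_trans gT) (@box_iso gT)
    (@boxA gT) (@boxC gT) (@box1 gT).

(* Main.v *)
(** Extension of scalars [L |-> A (x)_{A(G)} L] is strong monoidal and is undone
    by evaluation at the one-point G-set [pt], so it induces an injective
    homomorphism of Picard groups.  Surjectivity means that an invertible [M],
    with inverse [N], is extended from [M(pt)].

    It suffices that the ideal [M(pt) . N(pt)] of [A(G)] contains [1]: if
    [1 = sum_i m_i n_i], then [x = sum_ij (x n_i) (m_i n_j) m_j] for all [x],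
    which inverts the counit [A (x) M(pt) -> M].  By Burnside's theorem that
    marks are jointly injective, [1] is in the ideal as soon as for each
    subgroup [K] its image under the mark homomorphism at [K] is all of [Z],
    i.e. is contained in no [pZ].  Passing from [K] to [KP] with [P] a Sylow
    [p]-subgroup of [N(K)] does not change marks modulo [p], so [p] may be
    assumed not to divide [|N(K) : K|].

    In [(M box N)(pt)] the unit is the transfer of some [m (x) n] with
    [m \in M(X)], [n \in N(X)].  The marks at [K] of [m (x) n] form an integer
    matrix [b] on [X], invariant under [N(K)] and of trace [1]; invertibility of
    [M] forces it to have rank one.  Then [b] is invariant in each variable
    separately: [N(K)] acts on the line spanned by [b] by a sign, which is [1]
    since otherwise the trace would be even.  If [p] does not divide [b x x],
    then transferring the restrictions of [m] and [n] along [x : G/K -> X] gives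
    an element of the ideal whose mark at [K] is [|N(K) : K|^2 b x x], prime to
    [p]. *)

Require Import Defs.
From HB Require Import structures.
From mathcomp Require Import all_boot all_order all_algebra all_fingroup.
From mathcomp Require Import pgroup sylow boolp.
(* Last, so as to shadow the [span] and [gact] of the library. *)
Require Import Defs.

Set Implicit Arguments.
Unset Strict Implicit.
Unset Printing Implicit Defensive.

Import Order.TTheory GRing.Theory Num.Theory.
Local Open Scope ring_scope.

Local Notation "x ** a" := (gact _ x a) (at level 40, left associativity).
Local Notation "g \bo f" := (bcomp g f) (at level 40, left associativity).

(** * Marks *)

Section GrothLift.
Variables (M : nmodType) (V : zmodType) (f : M -> V).
Hypothesis fD : forall a b, f (a + b) = f a + f b.

Definition groth_lift_fun (x : groth M) : V := f (rep x).1 - f (rep x).2.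

Lemma groth_lift_pair a b : groth_lift_fun (gpair a b) = f a - f b.
Proof.
rewrite /groth_lift_fun; have [k] := rep_cls (groth_eqv M) (a, b).
rewrite -/(gpair a b) /=; case: (rep (gpair a b)) => [a' b'] /= E.
apply/eqP; rewrite subr_eq addrAC eq_sym subr_eq eq_sym; apply/eqP.
by apply: (addIr (f k)); rewrite -!fD E.
Qed.

Lemma groth_lift_additive : zmod_morphism groth_lift_fun.
Proof.
elim/gpairW=> a b; elim/gpairW=> c d; rewrite gpairN gpairD !groth_lift_pair !fD.
by rewrite !opprD opprK addrACA; congr (_ + _); rewrite addrC.
Qed.

Definition groth_lift : {additive groth M -> V} :=
  HB.pack groth_lift_fun (GRing.isZmodMorphism.Build _ _ _ groth_lift_additive).

Lemma groth_lift_gin a : groth_lift (gin a) = f a.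
Proof.
rewrite -[LHS]/(groth_lift_fun (gpair a 0)) groth_lift_pair.
have f0 : f 0 = 0 by apply: (addIr (f 0)); rewrite -fD !add0r.
by rewrite f0 subr0.
Qed.
End GrothLift.

Section Marks.
Variable gT : finGroupType.
Implicit Types (X Y Z W : gset gT) (K : {set gT}).

Definition gfix K X (x : gcar X) := [forall a in K, x ** a == x].

Lemma gfixP K X (x : gcar X) : reflect {in K, forall a, x ** a = x} (gfix K x).
Proof. by apply: (iffP forall_inP) => h a aK; apply/eqP/h. Qed.

Lemma gfix_map K X Y (f : gmap X Y) x : gfix K x -> gfix K (f x).
Proof. by move=> /gfixP h; apply/gfixP => a aK; rewrite -gmapJ h. Qed.

Lemma gfix_prod K X Y (p : gcar (gprod X Y)) :
  gfix K p = gfix K p.1 && gfix K p.2.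
Proof.
case: p => x y; apply/gfixP/andP => /= [h|[/gfixP h /gfixP k] a aK].
  by split; apply/gfixP => a aK; have [] := h a aK.
exact: (congr2 pair (h a aK) (k a aK)).
Qed.

Lemma gfix_pb K X Y Z (f : gmap X Z) (g : gmap Y Z) (p : gpb_car f g) :
  gfix K (p : gcar (gpb f g)) = gfix K (val p).1 && gfix K (val p).2.
Proof.
apply/gfixP/andP => [h|[/gfixP h /gfixP k] a aK].
  by split; apply/gfixP => a aK; rewrite -{2}(h a aK).
by apply: val_inj; case: p h k => -[x y] e /= h k; rewrite h ?k.
Qed.

(** The matrix of the span of sets of [K]-fixed points. Only [u] is required to be fixed: its images
    under the legs are then fixed too. *)
Definition span_mark K X Y (s : span X Y) (x : gcar X) (y : gcar Y) : int :=
  \sum_(u : gcar (apex s)) [&& gfix K u, legl s u == x & legr s u == y]%:R.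

Lemma span_mark_iso K X Y (s t : span X Y) x y :
  span_iso s t -> span_mark K s x y = span_mark K t x y.
Proof.
case=> f [bf fl fr]; rewrite /span_mark (reindex f) /=; last exact: onW_bij.
apply: eq_bigr => u _; rewrite fl fr; congr ((_ && _)%:R).
apply/idP/idP; first exact: gfix_map.
move/gfixP=> h; apply/gfixP => a aK; apply: (bij_inj bf).
by rewrite gmapJ h.
Qed.

Lemma sum_gset_sum X Y (V : zmodType) (F : gcar (gsum X Y) -> V) :
  \sum_u F u = \sum_x F (inl x) + \sum_y F (inr y).
Proof.
rewrite (reindex (id : (gcar X + gcar Y)%type -> gcar (gsum X Y))) /=; last first.
  by apply: onW_bij; exists id.
by rewrite big_sumType.
Qed.

Lemma sum_gset_prod X Y (V : zmodType) (F : gcar (gprod X Y) -> V) :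
  \sum_u F u = \sum_x \sum_y F (x, y).
Proof.
rewrite (reindex (id : (gcar X * gcar Y)%type -> gcar (gprod X Y))) /=; last first.
  by apply: onW_bij; exists id.
by rewrite pair_bigA; apply: eq_bigr => -[].
Qed.

Lemma sum_gset_pt (V : zmodType) (F : gcar (gpt gT) -> V) : \sum_u F u = F tt.
Proof.
rewrite (reindex (id : unit -> gcar (gpt gT))) /=; last first.
  by apply: onW_bij; exists id.
rewrite (big_pred1 tt) //; by case.
Qed.

Lemma sum_gset_pb X Y Z (f : gmap X Z) (g : gmap Y Z) (F : gcar X -> gcar Y -> int) :
  \sum_(p : gcar (gpb f g)) F (val p).1 (val p).2 =
  \sum_x \sum_y (f x == g y)%:R * F x y.
Proof.
rewrite (reindex (id : {p : gcar X * gcar Y | f p.1 == g p.2} -> gcar (gpb f g))) /=;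
  last by apply: onW_bij; exists id.
rewrite pair_bigA /= -(big_sub _ (fun p : gcar X * gcar Y => F p.1 p.2)) /=.
rewrite [LHS]big_mkcond; apply: eq_bigr => -[x y] _ /=.
rewrite -[_ \in _]/(f x == g y).
by case: (f x == g y); rewrite ?mul1r ?mul0r.
Qed.

Lemma span_markD K X Y (s t : span X Y) x y :
  span_mark K (span_add s t) x y = span_mark K s x y + span_mark K t x y.
Proof.
rewrite {1}/span_mark sum_gset_sum; congr (_ + _); apply: eq_bigr => u _ /=.
  congr ((_ && _)%:R); apply/gfixP/gfixP => h a aK; last exact: (congr1 inl (h a aK)).
  by have [] := h a aK.
congr ((_ && _)%:R); apply/gfixP/gfixP => h a aK; last exact: (congr1 inr (h a aK)).
by have [] := h a aK.
Qed.

Definition spanc_mark K X Y x y (c : spanc X Y) : int := span_mark K (rep c) x y.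
Lemma spanc_markE K X Y x y (s : span X Y) :
  spanc_mark K x y (scls s) = span_mark K s x y.
Proof. by apply: span_mark_iso; apply: (rep_cls (span_eqv X Y)). Qed.
Lemma spanc_markD K X Y x y (c d : spanc X Y) :
  spanc_mark K x y (c + d) = spanc_mark K x y c + spanc_mark K x y d.
Proof.
elim/sclsW: c => s; elim/sclsW: d => t.
by rewrite sclsD !spanc_markE span_markD.
Qed.

(** The [K]-geometric fixed points of the Burnside category: the entry at
    [(x, y)] of an integer matrix indexed by points, nonzero only if both are
    fixed by [K]. *)
Definition mark K X Y x y (f : bhom X Y) : int :=
  locked (groth_lift (@spanc_markD K X Y x y) f).

Lemma mark_gin K X Y x y (s : span X Y) :
  mark K x y (gin (scls s)) = span_mark K s x y.
Proof. by rewrite /mark -lock groth_lift_gin spanc_markE. Qed.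
Lemma markB K X Y x y : {morph @mark K X Y x y : f g / f - g}.
Proof. by move=> f g; rewrite /mark -!lock raddfB. Qed.
Lemma mark0 K X Y x y : @mark K X Y x y 0 = 0.
Proof. by rewrite /mark -lock raddf0. Qed.
Lemma markN K X Y x y : {morph @mark K X Y x y : f / - f}.
Proof. by move=> f; rewrite -[- f]add0r markB mark0 add0r. Qed.
Lemma markD K X Y x y : {morph @mark K X Y x y : f g / f + g}.
Proof. by move=> f g; rewrite -{1}[g]opprK markB markN opprK. Qed.

Lemma bhomW X Y (P : bhom X Y -> Prop) :
  (forall s, P (gin (scls s))) -> (forall f g, P f -> P g -> P (f - g)) ->
  forall f, P f.
Proof. by move=> Ps PB; apply: grothW => //; apply: sclsW. Qed.

(** Fixed points commute with pullbacks: a fixed point of the composite is a pair of fixed points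
    with the same image in [Y], so composing spans multiplies matrices. *)
Lemma mark_comp K X Y Z (g : bhom Y Z) (f : bhom X Y) x z :
  mark K x z (g \bo f) = \sum_y mark K x y f * mark K y z g.
Proof.
elim/bhomW: f => [s|f f' H H']; last first.
  rewrite bcompBr !markB H H' /= -sumrB; apply: eq_bigr => y _.
  by rewrite markB mulrBl.
elim/bhomW: g => [t|g g' H H']; last first.
  rewrite bcompBl !markB H H' /= -sumrB; apply: eq_bigr => y _.
  by rewrite markB mulrBr.
rewrite bcomp_gin spanc_compE mark_gin.
pose F u v : int := [&& gfix K u, gfix K v, legl s u == x & legr t v == z]%:R.
transitivity (\sum_(p : gcar (gpb (legr s) (legl t))) F (val p).1 (val p).2).
  apply: eq_bigr => p _; rewrite /F /= gfix_pb; congr (_%:R).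
  by rewrite -andbA.
rewrite sum_gset_pb; under [RHS]eq_bigr => y _ do rewrite !mark_gin mulr_suml.
rewrite [RHS]exchange_big; apply: eq_bigr => u _ /=.
under [RHS]eq_bigr => y _ do rewrite mulr_sumr.
rewrite [RHS]exchange_big; apply: eq_bigr => v _ /=.
rewrite (bigD1 (legr s u)) //= big1 ?addr0.
  rewrite -!natrM !mulnb eqxx andbT eq_sym; congr (_%:R).
  by rewrite /F; do !case: (_ == _); do !case: (gfix _ _).
move=> y /negbTE yu; rewrite [_ == y]eq_sym yu !andbF mul0r //.
Qed.

Lemma mark_prod K X X' Y Y' (f : bhom X X') (g : bhom Y Y') x y x' y' :
  mark K ((x, y) : gcar (gprod X Y)) ((x', y') : gcar (gprod X' Y')) (bprod f g) =
  mark K x x' f * mark K y y' g.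
Proof.
elim/bhomW: f => [s|f f' H H']; last by rewrite bprodBl !markB H H' /= mulrBl.
elim/bhomW: g => [t|g g' H H']; last by rewrite bprodBr !markB H H' /= mulrBr.
rewrite bprod_gin spanc_prodE !mark_gin /span_mark sum_gset_prod mulr_suml.
apply: eq_bigr => u _; rewrite mulr_sumr; apply: eq_bigr => v _.
rewrite gfix_prod -natrM mulnb /=; congr (_%:R).
have pE (A B : gset gT) (a a' : gcar A) (b b' : gcar B) :
    (((a, b) : gcar (gprod A B)) == (a', b')) = (a == a') && (b == b').
  by apply/eqP/andP => [[-> ->]|[/eqP-> /eqP->]].
by rewrite !pE; do !case: (_ == _); do !case: (gfix _ _).
Qed.

Lemma mark_of K X Y (f : gmap X Y) x y :
  mark K x y (bof f) = (gfix K x && (f x == y))%:R.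
Proof.
rewrite mark_gin /span_mark (bigD1 x) //= big1 ?addr0 ?eqxx //.
by move=> u /negbTE ->; rewrite andbF.
Qed.

Lemma mark_id K X x y : mark K x y (bid X) = (gfix K x && (x == y))%:R.
Proof. exact: mark_of. Qed.

Lemma markJ K X Y (f : bhom X Y) x y a : a \in 'N(K)%g ->
  mark K (x ** a) (y ** a) f = mark K x y f.
Proof.
move=> aN; elim/bhomW: f => [s|f f' H H']; last by rewrite !markB H H'.
rewrite !mark_gin /span_mark (reindex (fun u : gcar (apex s) => u ** a)) /=; last first.
  by apply: onW_bij; exists (fun u => u ** a^-1)%g => u; rewrite -actM ?mulgV ?mulVg act1.
apply: eq_bigr => u _; rewrite !gmapJ !(inj_eq (act_inj _ a)); congr ((_ && _)%:R).
apply/gfixP/gfixP => h k kK.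
  by apply: (act_inj (gact _) a); rewrite -actM conjgC actM h // memJ_norm.
by rewrite -actM conjgCV actM (h (k ^ a^-1)%g) // memJ_norm // groupV.
Qed.

(** The matrix of an identity is the projection onto the fixed points, and [f] factors through the
    identity of [X]. *)
Lemma mark_eq0 K X Y (f : bhom X Y) x y : ~~ gfix K x -> mark K x y f = 0.
Proof.
move=> /negbTE xK; rewrite -[f]bcomp1 mark_comp big1 // => z _; rewrite mark_id.
by rewrite xK mul0r.
Qed.

End Marks.

(** * The marks determine a finite G-set *)

Section Burnside.
Variable gT : finGroupType.
Implicit Types (X Y Z W : gset gT) (K : {set gT}).

Lemma gfix_astab1 K X (x : gcar X) : gfix K x = (K \subset 'C[x | gact X]%g).
Proof.
apply/gfixP/subsetP => h a aK; first by apply/astab1P/h.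
exact/astab1P/h.
Qed.

Lemma gfix_gen K X (x : gcar X) : gfix <<K>>%g x = gfix K x.
Proof. by rewrite !gfix_astab1 gen_subG. Qed.

Lemma gfixJ K X (x : gcar X) a : a \in 'N(K)%g -> gfix K x -> gfix K (x ** a).
Proof.
move=> aN /gfixP h; apply/gfixP => k kK.
by rewrite -actM conjgCV actM (h (k ^ a^-1)%g) // memJ_norm // groupV.
Qed.

Lemma span_mark_pt K (s : span (gpt gT) (gpt gT)) :
  span_mark K s tt tt = #|[set u : gcar (apex s) | gfix K u]|%:Z.
Proof.
have ptE (v : gcar (gpt gT)) : v == tt by apply/eqP; case: v.
rewrite -sum1_card -natz natr_sum /span_mark [RHS]big_mkcond; apply: eq_bigr => u _.
by rewrite !ptE !andbT inE; case: gfix.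
Qed.

Local Notation ptmark K := (@mark gT K (gpt gT) (gpt gT) tt tt).

(** [P] acts on the [K]-fixed points of the apex, with fixed points those of [K <*> P]; passing to
    the fixed points of a [p]-group does not change a cardinality modulo [p]. *)
Lemma mark_modp (p : nat) (K P : {group gT}) (a : bhom (gpt gT) (gpt gT)) :
  p.-group%g P -> P \subset 'N(K)%g ->
  (p%:Z %| ptmark (K <*> P)%g a - ptmark K a)%Z.
Proof.
move=> pP nKP; elim/bhomW: a => [s|f g Hf Hg]; last first.
  by rewrite !markB opprD addrACA -opprD; apply: rpredB.
rewrite !mark_gin !span_mark_pt -eqz_mod_dvd !modz_nat eqz_nat.
pose S := [set u : gcar (apex s) | gfix K u].
have actS : [acts P, on S | gact (apex s)].
  apply/subsetP => a aP; rewrite !inE /=; apply/subsetP => u; rewrite !inE.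
  exact/gfixJ/(subsetP nKP).
rewrite -/S (pgroup_fix_mod pP actS); apply/eqP; congr (_ %% _)%N.
apply: eq_card => u; rewrite in_setI -sub_astab1 !inE gfix_gen.
by rewrite !gfix_astab1 subUset.
Qed.

Section SubGset.
Variables (X : gset gT) (P : pred (gcar X)).
Hypothesis PJ : forall x a, P x -> P (x ** a).
Definition gsub_act (u : {x | P x}) a : {x | P x} :=
  exist _ (val u ** a) (PJ a (valP u)).
Lemma gsub_act1 : gsub_act^~ 1%g =1 id.
Proof. by move=> u; apply: val_inj; rewrite /= act1. Qed.
Lemma gsub_actM u : act_morph gsub_act u.
Proof. by move=> a b; apply: val_inj; rewrite /= actM. Qed.
Definition gsub : gset gT :=
  @GSet gT {x | P x} (inhabits (Finite.class {x | P x}))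
    (TotalAction gsub_act1 gsub_actM).
Definition gsub_val : gmap gsub X := @GMap gT gsub X val (fun _ _ => erefl).
End SubGset.

Section Powerset.
(** The subsets of [gT] are numbered because a [gset] is carried by a [Set],
    which the library's ordinals are not. *)
Definition gpow_car : Set := {i : nat | (i < #|{set gT}|)%N}.
Definition gpow_set (i : gpow_car) : {set gT} := enum_val (Ordinal (valP i)).
Definition gpow_of (A : {set gT}) : gpow_car :=
  exist _ (val (enum_rank A)) (ltn_ord (enum_rank A)).
Lemma gpow_setK : cancel gpow_set gpow_of.
Proof. by move=> i; apply: val_inj; rewrite /= /gpow_set enum_valK. Qed.
Lemma gpow_ofK : cancel gpow_of gpow_set.
Proof.
move=> A; rewrite /gpow_set -[RHS]enum_rankK; congr enum_val; exact: val_inj.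
Qed.
Definition gpow_act (i : gpow_car) (a : gT) : gpow_car :=
  gpow_of (gpow_set i :* a)%g.
Lemma gpow_act1 : gpow_act^~ 1%g =1 id.
Proof. by move=> i; rewrite /gpow_act mulg1 gpow_setK. Qed.
Lemma gpow_actM i : act_morph gpow_act i.
Proof. by move=> a b; rewrite /gpow_act gpow_ofK rcosetM. Qed.
Definition gpow : gset gT :=
  @GSet gT gpow_car (inhabits (Finite.class (can_type gpow_setK)))
    (TotalAction gpow_act1 gpow_actM).
Lemma gpow_actE A a : gpow_act (gpow_of A) a = gpow_of (A :* a)%g.
Proof. by rewrite /gpow_act gpow_ofK. Qed.
End Powerset.

Section MarksDetermine.
Variables X Y : gset gT.
Let to := gact X.
Let to' := gact Y.

(** Points with equal stabilisers have isomorphic orbits: [x ** a] goes to [y ** b] for a chosen [b]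
    with [x ** b = x ** a], and the common stabiliser makes the choice harmless. *)
Lemma orbit_transport (x : gcar X) (y : gcar Y) :
  'C[x | to]%g = 'C[y | to']%g ->
  exists f : gcar X -> gcar Y, forall a, f (x ** a) = y ** a.
Proof.
move=> e; exists (fun z => y ** repr [set a | x ** a == z]) => a.
set b := repr _; have : b \in [set b | x ** b == x ** a].
  by apply: (mem_repr a); rewrite inE.
rewrite inE => /eqP xb; apply/(act_inj (gact Y) a^-1)%g; rewrite -!actM mulgV act1.
by apply/astab1P; rewrite -/to' -e; apply/astab1P; rewrite actM xb -actM mulgV act1.
Qed.

(** Induction on the size of [S]: an orbit of [S] with largest stabiliser is matched with an orbit
    of [T] having the same stabiliser, and both are removed. Stable subsets keep the induction
    inside fixed [X] and [Y]; [y0] is the default value of the map that starts it. *)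
Lemma equivariant_matching n (S : {set gcar X}) (T : {set gcar Y}) (y0 : gcar Y) :
  (#|S| <= n)%N ->
  (forall x a, x \in S -> x ** a \in S) -> (forall y a, y \in T -> y ** a \in T) ->
  (forall K : {group gT}, #|[set x in S | gfix K x]| = #|[set y in T | gfix K y]|) ->
  exists f : gcar X -> gcar Y,
    [/\ {in S, forall x a, f (x ** a) = f x ** a}, {in S &, injective f}
      & f @: S = T].
Proof.
elim: n S T => [|n IHn] S T.
  rewrite leqn0 cards_eq0 => /eqP-> _ _ /(_ 1%G) e; exists (fun _ => y0).
  split=> [x||]; rewrite ?imset0 ?inE //; first by move=> x; rewrite inE.
  (* The trivial group fixes every point, so the counts force [T] to be empty. *)
  apply/esym/eqP; rewrite -cards_eq0 -(eq_card (A := [set y in T | gfix 1%G y])).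
    by rewrite -e cards_eq0 -subset0; apply/subsetP => x; rewrite !inE.
  move=> y; rewrite inE andbC; apply/esym; case: gfixP => // -[] a.
  by rewrite inE => /eqP->; rewrite act1.
move=> leSn SJ TJ eST; have [S0|[x1 x1S]] := set_0Vmem S.
  by apply: IHn; rewrite // S0 cards0.
pose st z := #|'C[z | to]%g|.
have [x xS xmax] := @arg_maxnP _ x1 (mem S) st x1S.
pose K := [group of 'C[x | to]%g].
have: (0 < #|[set y in T | gfix K y]|)%N.
  rewrite -eST; apply/card_gt0P; exists x; rewrite inE gfix_astab1 subxx andbT.
  exact: xS.
case/card_gt0P=> y; rewrite inE => /andP[yT yK].
(* [y] is fixed by the stabiliser of [x]; conversely the stabiliser of [y] fixes some [x'] in [S],
   so by maximality it is no larger than that of [x]. *)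
have eC : 'C[x | to]%g = 'C[y | to']%g.
  apply/eqP; rewrite eqEcard; rewrite gfix_astab1 in yK; rewrite yK /=.
  pose K' := [group of 'C[y | to']%g].
  have: (0 < #|[set x in S | gfix K' x]|)%N.
    by rewrite eST; apply/card_gt0P; exists y; rewrite inE gfix_astab1 subxx yT.
  case/card_gt0P=> x'; rewrite inE => /andP[x'S]; rewrite gfix_astab1 => sK'.
  exact: leq_trans (subset_leq_card sK') (xmax x' x'S).
have [g gE] := orbit_transport eC.
pose Ox := orbit to [set: gT] x; pose Oy := orbit to' [set: gT] y.
have OxP z : reflect (exists a, z = x ** a) (z \in Ox).
  by apply: (iffP orbitP) => [[a _ <-]|[a ->]]; exists a.
have OyP z : reflect (exists a, z = y ** a) (z \in Oy).
  by apply: (iffP orbitP) => [[a _ <-]|[a ->]]; exists a.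
have OxS : Ox \subset S by apply/subsetP => z /OxP[a ->]; apply: SJ.
have OyT : Oy \subset T by apply/subsetP => z /OyP[a ->]; apply: TJ.
have OxJ z a : (z ** a \in Ox) = (z \in Ox).
  apply/OxP/OxP => -[b e]; last by exists (b * a)%g; rewrite e actM.
  by exists (b * a^-1)%g; rewrite actM -e -actM mulgV act1.
have OyJ z a : (z ** a \in Oy) = (z \in Oy).
  apply/OyP/OyP => -[b e]; last by exists (b * a)%g; rewrite e actM.
  by exists (b * a^-1)%g; rewrite actM -e -actM mulgV act1.
have gJ : {in Ox, forall z a, g (z ** a) = g z ** a}.
  by move=> z /OxP[b ->] a; rewrite -actM !gE actM.
have ginj : {in Ox &, injective g}.
  move=> _ _ /OxP[a ->] /OxP[b ->]; rewrite !gE => yab.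
  apply/(act_inj to b^-1)%g; rewrite -!actM mulgV act1; apply/astab1P; rewrite eC.
  by apply/astab1P; rewrite actM yab -actM mulgV act1.
have gO : g @: Ox = Oy.
  apply/setP => z; apply/imsetP/OyP => [[_ /OxP[a ->] ->]|[a ->]].
    by exists a; rewrite gE.
  by exists (x ** a); rewrite ?gE //; apply/OxP; exists a.
have gfixE z (L : {set gT}) : z \in Ox -> gfix L (g z) = gfix L z.
  move=> zO; apply/gfixP/gfixP => h a aL; last by rewrite -gJ ?h.
  by apply: ginj; rewrite ?OxJ // gJ ?h.
have [f [fJ finj fS]] : exists f : gcar X -> gcar Y,
    [/\ {in S :\: Ox, forall x a, f (x ** a) = f x ** a},
        {in S :\: Ox &, injective f} & f @: (S :\: Ox) = T :\: Oy].
  apply: IHn => [|z a|z a|L].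
  - rewrite -ltnS; apply: leq_trans leSn; apply: proper_card.
    rewrite properE subsetDl; apply/subsetPn; exists x => //.
    by rewrite inE negb_and negbK; apply/orP; left; apply/OxP; exists 1%g; rewrite act1.
  - by rewrite !in_setD OxJ => /andP[-> /SJ->].
  - by rewrite !in_setD OyJ => /andP[-> /TJ->].
  (* The matched orbits have equally many [L]-fixed points, [g] being an equivariant bijection
     between them; these are subtracted from both counts. *)
  - apply/eqP; rewrite -(eqn_add2l #|[set z in Ox | gfix L z]|).
    have cD (Z : gset gT) (A B : {set gcar Z}) : A \subset B ->
        (#|[set z in A | gfix L z]| + #|[set z in B :\: A | gfix L z]| =
         #|[set z in B | gfix L z]|)%N.
      move=> AB; rewrite -(cardsID A [set z in B | gfix L z]); congr (_ + _)%N.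
        apply: eq_card => z; rewrite !inE andbAC; congr (_ && _).
        by apply/idP/andP => [zA|[]//]; split=> //; apply: (subsetP AB).
      by apply: eq_card => z; rewrite !inE andbA.
    rewrite cD // eST -(cD _ _ _ OyT) eqn_add2r; apply/eqP.
    rewrite -(card_in_imset (f := g)); last first.
      by move=> u v; rewrite !inE => /andP[uO _] /andP[vO _]; apply: ginj.
    apply: eq_card => z; rewrite inE -gO; apply/andP/imsetP.
      by move=> [/imsetP[u uO ->]]; rewrite gfixE // => uL; exists u; rewrite // inE uO.
    move=> [u]; rewrite inE => /andP[uO uL] ->; rewrite gfixE //; split=> //.
    exact: imset_f.
exists (fun z => if z \in Ox then g z else f z); split.
- move=> z zS a; rewrite OxJ; case: ifPn => zO; first exact: gJ.
  by rewrite fJ // inE zO.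
- have fO u : u \in S -> u \notin Ox -> f u \in T :\: Oy.
    by move=> uS uO; rewrite -fS imset_f // inE uO.
  have gO' u : u \in Ox -> g u \in Oy by move=> uO; rewrite -gO imset_f.
  move=> u v uS vS; case: ifPn => uO; case: ifPn => vO.
  + exact: ginj.
  + by move=> e; move: (fO v vS vO); rewrite inE -e gO'.
  + by move=> e; move: (fO u uS uO); rewrite inE e gO'.
  + by apply: finj; rewrite inE ?uO ?vO.
- apply/setP => z; apply/imsetP/idP => [[u uS ->]|zT].
    case: ifPn => uO; first by apply: (subsetP OyT); rewrite -gO imset_f.
    have: f u \in T :\: Oy by rewrite -fS imset_f // inE uO.
    by rewrite inE => /andP[].
  case: (boolP (z \in Oy)) => zO.
    move: (zO); rewrite -gO => /imsetP[u uO ->]; exists u; last by rewrite uO.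
    exact: (subsetP OxS).
  have: z \in T :\: Oy by rewrite inE zO.
  rewrite -fS => /imsetP[u]; rewrite inE => /andP[uO uS] ->.
  by exists u; rewrite ?(negbTE uO).
Qed.

Lemma giso_marks :
  (forall K : {group gT},
    #|[set x : gcar X | gfix K x]| = #|[set y : gcar Y | gfix K y]|) ->
  giso X Y.
Proof.
move=> e.
have cE (Z : gset gT) : #|[set z : gcar Z | gfix 1%G z]| = #|{: gcar Z}|.
  apply: eq_card => z; rewrite inE; apply/gfixP => a.
  by rewrite inE => /eqP->; rewrite act1.
have cXY : #|{: gcar X}| = #|{: gcar Y}| by rewrite -!cE e.
case: (pickP (mem {: gcar Y})) => [y0 _|Y0]; last first.
  have X0 (x : gcar X) : False.
    have /card0_eq/(_ x) : #|{: gcar X}| = 0%N by rewrite cXY (eq_card0 Y0).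
    by rewrite inE.
  exists (@GMap gT X Y (fun x => False_rect _ (X0 x)) (fun x _ => False_ind _ (X0 x))).
  have Y0' (y : gcar Y) : False by have := Y0 y; rewrite inE.
  by exists (fun y => False_rect _ (Y0' y)) => z; [case: (X0 z) | case: (Y0' z)].
have [|||K|f [fJ finj _]] := @equivariant_matching #|[set: gcar X]| setT setT y0.
- by [].
- by move=> x a; rewrite !inE.
- by move=> x a; rewrite !inE.
- rewrite (eq_card (B := [set x : gcar X | gfix K x])); last by move=> x; rewrite !inE.
  by rewrite e; apply: eq_card => y; rewrite !inE.
exists (@GMap gT X Y f (fun x a => fJ x (in_setT x) a)).
apply: inj_card_bij; last by rewrite cXY.
by move=> u v /=; apply: finj; rewrite inE.
Qed.
End MarksDetermine.

(** An element is a difference of two spans; equal marks make their apexes isomorphic, and over the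
    one-point set any such isomorphism respects the legs. *)
Lemma mark_inj (a b : bhom (gpt gT) (gpt gT)) :
  (forall K : {group gT}, ptmark K a = ptmark K b) -> a = b.
Proof.
move=> e; apply/eqP; rewrite -subr_eq0; apply/eqP.
have {e} : forall K : {group gT}, ptmark K (a - b) = 0.
  by move=> K; rewrite markB e subrr.
elim/gpairW: (a - b) => c d; rewrite gpairE.
elim/sclsW: c => s; elim/sclsW: d => t e.
suff -> : scls s = scls t by rewrite subrr.
have [|f bf] := @giso_marks (apex s) (apex t).
  move=> K; have /eqP := e K; rewrite markB !mark_gin !span_mark_pt subr_eq0.
  by rewrite eqz_nat => /eqP.
apply: scls_eq; exists f; split=> // u.
  by case: (legl t _); case: (legl s _).
by case: (legr t _); case: (legr s _).
Qed.

End Burnside.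

(** * Integer matrices of trace one *)

Section TraceOne.
Variables (T : finType) (b : T -> T -> int).
Hypothesis tr1 : \sum_s b s s = 1.
Hypothesis bb : forall x y z t, b z y * b x t = b z t * \sum_s b s y * b x s.

(** Let [C] be the entry at [(x, y)] of the square of [b]. The hypothesis at [z = x], [t = y] gives
    [C = b x y] unless [b x y = 0]; in that case a nonzero [C] would annihilate row [x], of which
    [C] is a combination. So [b] is idempotent and its two-by-two minors vanish. *)
Lemma rank_one x y z t : b z y * b x t = b z t * b x y.
Proof.
suff -> : b x y = \sum_s b s y * b x s by exact: bb.
have [bxy|bxy] := eqVneq (b x y) 0; last first.
  exact: (mulfI bxy (bb x y x y)).
rewrite bxy; apply/esym/eqP; apply: contraT => C0.
suff E t' : b x t' = 0 by move: C0; rewrite big1 ?eqxx // => s _; rewrite E mulr0.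
by apply: (mulIf C0); rewrite -bb bxy !mul0r.
Qed.

Lemma trace_neq0 : exists x, b x x != 0.
Proof.
apply/existsP; apply: contraT => /existsPn b0.
by move: tr1; rewrite big1 // => s _; apply/eqP; rewrite -[_ == _]negbK b0.
Qed.

(** The sum is split along the orbits of [s]: each contributes its size times a constant, which is
    even if the size is and zero otherwise. *)
Lemma even_sum_perm (s : {perm T}) (f : T -> int) :
  (forall x, f (s x) = f x) -> (forall x, odd #|porbit s x| -> f x = 0) ->
  (2 %| \sum_x f x)%Z.
Proof.
move=> fs f0; rewrite (partition_big (porbit s) predT) //=.
apply: rpred_sum => O _; have [x /= /eqP <-|nO] := pickP [pred x | porbit s x == O].
  have fO y : y \in porbit s x -> f y = f x.
    case/porbitP => i ->; elim: i => [|i IH]; first by rewrite expg0 perm1.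
    by rewrite expgSr permM fs.
  rewrite (eq_bigl (mem (porbit s x))) => [|y]; last by rewrite /= eq_porbit_mem porbit_sym.
  rewrite (eq_bigr (fun=> f x)) => [|y /fO //]; rewrite sumr_const.
  have [/f0->|/negbTE evO] := boolP (odd #|porbit s x|); first by rewrite mul0rn dvdz0.
  by rewrite -[_ *+ #|_|]mulr_natr natz; apply: dvdz_mull; rewrite dvdzE /= dvdn2 evO.
by rewrite big_pred0 // dvdz0.
Qed.

(** A permutation preserving [b] acts on the line spanned by [b] through a
    sign.  The sign is [1]: otherwise the orbits of odd size would contribute
    nothing to the trace, which would be even. *)
Lemma rank_one_invariant (s : {perm T}) :
  (forall x y, b (s x) (s y) = b x y) -> forall x y, b (s x) y = b x y.
Proof.
move=> bs; have [o b0] := trace_neq0.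
have bE x y : b x y * b o o = b x o * b o y by rewrite rank_one mulrC.
have rs x : b (s x) o * b o (s o) = b x o * b o o by rewrite -bE bs.
(* Summing [rs] in absolute value over all [x], which [s] permutes, leaves the same nonzero factor
   on both sides. *)
have absq : `|b o (s o)| = `|b o o|.
  have N0 : \sum_x `|b x o| != 0.
    rewrite psumr_neq0; last by move=> x _; apply: normr_ge0.
    by apply/hasP; exists o; rewrite ?mem_index_enum //= normr_gt0.
  apply: (mulfI N0); rewrite [in LHS](reindex s) /=; last first.
    by apply: onW_bij; exact: injF_bij (@perm_inj _ s).
  by rewrite !mulr_suml; apply: eq_bigr => x _; rewrite -!normrM rs.
have /orP[/eqP q|/eqP q] : (b o (s o) == b o o) || (b o (s o) == - b o o).
  by rewrite -eqr_norm2 absq.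
  move=> x y; apply: (mulIf b0); rewrite !bE; congr (_ * _).
  by apply: (mulIf b0); rewrite -[RHS]rs q.
have rsN x : b (s x) o = - b x o.
  by apply: (mulIf b0); rewrite mulNr -[in RHS]rs q mulrN opprK.
have : (2 %| \sum_x b x x)%Z.
  apply: (even_sum_perm (s := s)) => [x|x ox]; first exact: bs.
  (* On an orbit of odd size [n], returning to [x] after [n] steps gives [b x o = - b x o], so the
     diagonal entry at [x] vanishes. *)
  have rn n : b ((s ^+ n)%g x) o = (-1) ^+ n * b x o.
    elim: n => [|n IH]; first by rewrite expg0 perm1 mul1r.
    by rewrite expgSr permM rsN IH exprS mulN1r mulNr.
  have := rn #|porbit s x|; rewrite permX iter_porbit -signr_odd ox mulN1r.
  move=> /eqP; rewrite -addr_eq0 -mulr2n mulrn_eq0 /= => /eqP rx.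
  by apply: (mulIf b0); rewrite bE rx !mul0r.
by rewrite tr1.
Qed.

End TraceOne.

(** Euclidean descent: a nonzero [x] in [P] with a prime divisor [p] is replaced by its gcd with an
    element of [P] not divisible by [p], which is strictly smaller. The prime 2 supplies the nonzero
    start. *)
Lemma int_subgroup_one (P : int -> Prop) :
  (forall x y, P x -> P y -> P (x - y)) ->
  (forall p, prime p -> exists2 x, P x & ~~ (p%:Z %| x)%Z) -> P 1.
Proof.
move=> PB Pp; have [x0 Px0 x0N] := Pp 2 isT.
have P0 : P 0 by rewrite -(subrr x0); apply: PB.
have PN x : P x -> P (- x) by move=> Px; rewrite -[- x]add0r; apply: PB.
have PD x y : P x -> P y -> P (x + y).
  by move=> Px Py; rewrite -[y]opprK; apply/PB/PN.
have PM u x : P x -> P (u * x).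
  move=> Px; have PMn n : P (n%:Z * x).
    elim: n => [|n IH]; first by rewrite mul0r.
    by rewrite intS mulrDl mul1r; apply: PD.
  by case: (intP u) => [|n|n]; rewrite ?mul0r ?mulNr //; apply: PN.
have {x0N} : x0 != 0 by apply: contraNneq x0N => ->; rewrite dvdz0.
have [n] := ubnP `|x0|%N; elim: n x0 Px0 => // n IHn x Px lex x_neq0.
have [x1|x1] := eqVneq `|x|%N 1%N.
  have /orP[/eqP<-//|/eqP e] : (x == 1) || (x == - 1) by rewrite -eqr_norm2 -!abszE x1.
  by rewrite -[1]opprK -e; apply: PN.
have x_gt1 : (1 < `|x|)%N by rewrite ltn_neqAle eq_sym x1 absz_gt0.
have [y Py ny] := Pp _ (pdiv_prime x_gt1).
have [u [v uv]] := Bezoutz x y.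
apply: (IHn (gcdz x y)); last by rewrite gcdz_eq0 negb_and x_neq0.
  by rewrite -uv; apply: PD; apply: PM.
rewrite -ltnS; apply: leq_trans lex; rewrite ltnS absz_nat ltn_neqAle.
rewrite dvdn_leq ?dvdn_gcdl ?absz_gt0 // andbT.
apply: contra ny => /eqP e; rewrite dvdzE; apply: dvdn_trans (pdiv_dvd _) _.
by rewrite -{1}e dvdn_gcdr.
Qed.

(** * The pairing of an invertible Mackey functor with its inverse *)

Section Transfers.
Variable gT : finGroupType.
Implicit Types (X Y Z A B : gset gT).
Local Notation pt := (gpt gT).

Definition gterm X : gmap X pt := @GMap gT X pt (fun _ => tt) (fun _ _ => erefl).
Definition gdiag X : gmap X (gprod X X) :=
  @GMap gT X (gprod X X) (fun x => (x, x)) (fun _ _ => erefl).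

(** On a Mackey functor [btr f] acts as restriction along [f] followed by transfer to the point, and
    [brev f] as transfer along [f]. Thus [bx m n (bdiag X)] is the transfer to the point of the
    product of [m] and [n] over [X]. *)
Definition btr X Y (f : gmap X Y) : bhom pt Y := gin (scls (Span (gterm X) f)).
Definition bdiag X : bhom pt (gprod X X) := btr (gdiag X).
Definition brev X Y (f : gmap X Y) : bhom Y X := gin (scls (Span f (gid X))).

Lemma mark_btr K X Y (f : gmap X Y) y :
  mark K (tt : gcar pt) y (btr f) = \sum_x (gfix K x && (f x == y))%:R.
Proof. by rewrite mark_gin; apply: eq_bigr => x _; case: eqP. Qed.

Lemma mark_bdiag K X x y :
  mark K (tt : gcar pt) ((x, y) : gcar (gprod X X)) (bdiag X) =
  (gfix K x && (x == y))%:R.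
Proof.
rewrite mark_btr (bigD1 x) //= big1 ?addr0.
  by congr ((_ && _)%:R); apply/eqP/eqP => [[]|->].
by move=> z /eqP zx; case: eqP => [[e _]|]; rewrite ?andbF.
Qed.

Lemma bof_btr X Y Z (f : gmap X Y) (g : gmap Y Z) :
  bof g \bo btr f = btr (gcomp g f).
Proof. by rewrite bcomp_gin spanc_compE; congr gin; apply/scls_eq/span_comp_of. Qed.

Definition gpair_map X Y Z (f : gmap X Y) (g : gmap X Z) : gmap X (gprod Y Z) :=
  gcomp (gprod_map f g) (gdiag X).

Lemma btr_pair X Y Z (f : gmap X Y) (g : gmap X Z) :
  btr (gpair_map f g) = bprod (bof f) (bof g) \bo bdiag X.
Proof.
rewrite -bof_btr; congr (_ \bo _); rewrite bprod_gin spanc_prodE.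
congr gin; apply: scls_eq; exists (gid _); split=> //; first by exists id.
by case.
Qed.

(** The composite pulls the diagonal of [Y] back along [f] in both factors; injectivity leaves
    exactly the diagonal of [X]. In [brev_diag0] the images are disjoint and the pullback is
    empty. *)
Lemma brev_diag_eq X Y (f : gmap X Y) : injective f ->
  bprod (brev f) (brev f) \bo bdiag Y = bdiag X.
Proof.
move=> finj; rewrite bprod_gin spanc_prodE bcomp_gin spanc_compE; congr gin.
apply: scls_eq.
pose s := span_comp (span_prod (Span f (gid X)) (Span f (gid X)))
  (Span (gterm Y) (gdiag Y)).
have hP (x : gcar X) : gdiag Y (f x) == gprod_map f f (x, x) by [].
apply: (@span_isoI _ _ _ s (Span (gterm X) (gdiag X))
  (fun p => (val p).2.1) (fun x => exist _ (f x, (x, x)) (hP x))) => //.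
- case=> -[y [x x']] /= e; apply: val_inj => /=.
  by move/eqP: e => [-> /finj ->].
- by case=> -[y [x x']] /= /eqP[-> /finj ->].
Qed.

Lemma brev_diag0 X X' Y (f : gmap X Y) (f' : gmap X' Y) :
  (forall x x', f x <> f' x') -> bprod (brev f) (brev f') \bo bdiag Y = 0.
Proof.
move=> ff'; rewrite bprod_gin spanc_prodE bcomp_gin spanc_compE.
pose s := span_comp (span_prod (Span f (gid X)) (Span f' (gid X')))
  (Span (gterm Y) (gdiag Y)).
have s0 : span_iso s (span_zero pt (gprod X X')).
  have H (p : gcar (gpb (gdiag Y) (gprod_map f f'))) : False.
    by case: p => -[y [x x']] /= /eqP[yx yx']; apply: (ff' x x'); rewrite -yx.
  apply: (@span_isoI _ _ _ s (span_zero _ _)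
    (fun p => False_rect _ (H p)) (fun v : gcar (gempty gT) => match v with end)).
  - by move=> p; case: (H p).
  - by move=> p; case: (H p).
  - by case.
  - by move=> p; case: (H p).
  - by move=> p; case: (H p).
by rewrite (scls_eq s0).
Qed.

Definition ginl X Y : gmap X (gsum X Y) :=
  @GMap gT X (gsum X Y) inl (fun _ _ => erefl).
Definition ginr X Y : gmap Y (gsum X Y) :=
  @GMap gT Y (gsum X Y) inr (fun _ _ => erefl).

Definition gfst X Y : gmap (gprod X Y) X :=
  @GMap gT (gprod X Y) X fst (fun _ _ => erefl).
Definition gsnd X Y : gmap (gprod X Y) Y :=
  @GMap gT (gprod X Y) Y snd (fun _ _ => erefl).

Section BoxDiag.
Variables M N : mackey gT.

Lemma bxBh Z X Y (m : M X) (n : N Y) (h h' : bhom Z (gprod X Y)) :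
  bx m n (h - h') = bx m n h - bx m n h'.
Proof. by apply/eqP; rewrite eq_sym subr_eq -bxDh subrK. Qed.

Lemma bx0h Z X Y (m : M X) (n : N Y) : bx m n (0 : bhom Z (gprod X Y)) = 0.
Proof. by rewrite -(subrr 0) bxBh subrr. Qed.

(** For a generator given by a span, [m] and [n] are restricted to the apex along the right leg. For
    a sum, both summands are transferred to the disjoint union, where the mixed terms vanish. *)
Lemma box_diagP (t : box M N pt) :
  exists X (m : M X) (n : N X), t = bx m n (bdiag X).
Proof.
have PD u v : (exists X (m : M X) (n : N X), u = bx m n (bdiag X)) ->
    (exists X (m : M X) (n : N X), v = bx m n (bdiag X)) ->
    exists X (m : M X) (n : N X), u + v = bx m n (bdiag X).
  case=> X [m [n ->]] [Y [m' [n' ->]]]; exists (gsum X Y).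
  exists (mmap M (brev (ginl X Y)) m + mmap M (brev (ginr X Y)) m').
  exists (mmap N (brev (ginl X Y)) n + mmap N (brev (ginr X Y)) n').
  rewrite bxDm !bxDn !bx_dinat !brev_diag_eq ?brev_diag0 //; try by move=> ? ? [].
  by rewrite !bx0h addr0 add0r.
have PN u : (exists X (m : M X) (n : N X), u = bx m n (bdiag X)) ->
    exists X (m : M X) (n : N X), - u = bx m n (bdiag X).
  by case=> X [m [n ->]]; exists X, (- m), n; rewrite bxNm.
elim/box_ind: t => // [X Y m n h|]; last by exists pt, 0, 0; rewrite bx0m.
elim/bhomW: h => [s|f g Hf Hg]; last by rewrite bxBh; apply/PD/PN.
exists (apex s), (mmap M (bof (gcomp (gfst X Y) (legr s))) m).
exists (mmap N (bof (gcomp (gsnd X Y) (legr s))) n).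
rewrite bx_dinat -btr_pair; congr (bx m n (gin _)); apply: scls_eq.
exists (gid _); split; first by exists id.
  by move=> u; case: (legl s u).
by move=> u /=; case: (legr s u).
Qed.
End BoxDiag.

Local Notation ptmark K := (@mark gT K pt pt tt tt).

Lemma ptmarkM (K : {set gT}) a c : ptmark K (a \bo c) = ptmark K a * ptmark K c.
Proof. by rewrite mark_comp sum_gset_pt mulrC. Qed.
Lemma ptmark1 (K : {set gT}) : ptmark K (bid pt) = 1.
Proof. by rewrite mark_id eqxx andbT; case: gfixP => // -[]. Qed.

Lemma mark_bprod_pt (K : {set gT}) X Y (f : bhom pt X) (g : bhom pt Y) x y :
  mark K (tt : gcar pt) ((x, y) : gcar (gprod X Y)) (bprod f g \bo blununit pt) =
  mark K (tt : gcar pt) x f * mark K (tt : gcar pt) y g.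
Proof.
rewrite mark_comp sum_gset_prod !sum_gset_pt mark_of.
rewrite [_ == _](introT eqP erefl) andbT; case: gfixP => [_|[]//].
by rewrite mul1r mark_prod.
Qed.

(** While [p] divides the index, [K] is enlarged by a Sylow [p]-subgroup of its normaliser; the
    induction is on the number of elements outside [K]. *)
Lemma sylow_normaliser_coprime (p : nat) (K : {group gT}) : prime p ->
  exists2 L : {group gT}, ~~ (p %| #|'N(L) : L|%g)%N
    & forall a : bhom pt pt, (p%:Z %| ptmark L a - ptmark K a)%Z.
Proof.
move=> pp; have [n] := ubnP (#|gT| - #|K|); elim: n K => // n IHn K leKn.
have [pW|] := boolP (p %| #|'N(K) : K|%g)%N; last first.
  by exists K => // a; rewrite subrr dvdz0.
have [P sylP] := Sylow_exists p 'N(K)%G.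
have [sPN pP] := and3P sylP; rewrite p'natE // => pNP.
(* If [P] were inside [K], the index of [K] in its normaliser would divide that of [P], which is
   prime to [p]. *)
have nsPK : ~~ (P \subset K).
  by apply: contra pNP => sPK; apply: dvdn_trans pW (indexgS _ sPK).
have sKL : K \proper (K <*> P)%G.
  by rewrite properE joing_subl join_subG subxx.
have [|L pL eL] := IHn (K <*> P)%G.
  apply: leq_trans (ltn_sub2l _ (proper_card sKL)) _; last by rewrite -ltnS.
  exact: leq_trans (proper_card sKL) (max_card _).
exists L => // a; have := eL a; have := mark_modp a pP sPN.
move=> h1 h2; rewrite -(subrK (ptmark (K <*> P)%g a) (ptmark L a)) -addrA.
exact: rpredD.
Qed.

Section Pairing.
Variables M N : mackey gT.
Variables (th : mtrans (box M N) (munit gT)) (th' : mtrans (munit gT) (box M N)).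
Hypothesis thK : forall Z, cancel (th Z) (th' Z).
Hypothesis th'K : forall Z, cancel (th' Z) (th Z).

Definition pairing X Y (m : M X) (n : N Y) : bhom (gprod X Y) pt :=
  th _ (bx m n (bid _)).

Lemma th_bx Z X Y (m : M X) (n : N Y) (h : bhom Z (gprod X Y)) :
  th Z (bx m n h) = pairing m n \bo h.
Proof.
rewrite -[RHS]/(mmap (munit gT) h (th _ (bx m n (bid _)))) -mtr_nat.
by rewrite mmap_boxE b1comp.
Qed.

Lemma pairing_map X X' Y Y' (f : bhom X X') (g : bhom Y Y') (m : M X') (n : N Y') :
  pairing (mmap M f m) (mmap N g n) = pairing m n \bo bprod f g.
Proof. by rewrite /pairing bx_dinat bcomp1 th_bx. Qed.
Lemma pairing_mapl X X' Y (f : bhom X X') (m : M X') (n : N Y) :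
  pairing (mmap M f m) n = pairing m n \bo bprod f (bid Y).
Proof. by rewrite -pairing_map mmap1. Qed.
Lemma pairing_mapr X Y Y' (g : bhom Y Y') (m : M X) (n : N Y') :
  pairing m (mmap N g n) = pairing m n \bo bprod (bid X) g.
Proof. by rewrite -pairing_map mmap1. Qed.

Lemma pairingDl X Y (m m' : M X) (n : N Y) :
  pairing (m + m') n = pairing m n + pairing m' n.
Proof. by rewrite /pairing bxDm raddfD. Qed.
Lemma pairingDr X Y (m : M X) (n n' : N Y) :
  pairing m (n + n') = pairing m n + pairing m n'.
Proof. by rewrite /pairing bxDn raddfD. Qed.

Let one : box M N pt := th' pt (bid pt : munit gT pt).

(** Through [th] the functor [box M N] is represented by the point, with universal element [one]. *)
Lemma box_Yoneda Z (t : box M N Z) : t = mmap (box M N) (th Z t) one.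
Proof.
rewrite -[LHS]thK -[RHS]thK mtr_nat th'K; congr (th' Z _).
by rewrite -[RHS]/(_ \bo _) b1comp.
Qed.

Section Contraction.
Variables (K : {group gT}) (X : gset gT) (m : M X) (n : N X).
Hypothesis oneE : one = bx m n (bdiag X).
Let b x y : int := mark K ((x, y) : gcar (gprod X X)) (tt : gcar pt) (pairing m n).

Lemma pairing_mark_neq0 x y : b x y != 0 -> gfix K x && gfix K y.
Proof.
apply: contraNT => xy; apply/eqP; apply: mark_eq0.
by rewrite gfix_prod.
Qed.

(** Composing [pairing m n] with [bdiag X] gives the image of [one] under [th], which is the
    identity; the mark of this composite is the trace. *)
Lemma pairing_mark_trace : \sum_x b x x = 1.
Proof.
have e : pairing m n \bo bdiag X = bid pt by rewrite -th_bx -oneE th'K.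
have := mark_comp K (pairing m n) (bdiag X) (tt : gcar pt) (tt : gcar pt).
rewrite e mark_id sum_gset_prod eqxx andbT.
have -> : gfix K (tt : gcar pt) by apply/gfixP.
rewrite -[true%:R]/(1 : int) => ->.
apply: eq_bigr => x _; rewrite (bigD1 x) //= big1 ?addr0.
  rewrite mark_bdiag eqxx andbT; case: (boolP (gfix K x)) => xK; first by rewrite mul1r.
  by rewrite mul0r; apply/eqP; apply: contraNT xK => /pairing_mark_neq0 /andP[].
by move=> y /negbTE yx; rewrite mark_bdiag eq_sym yx andbF mul0r.
Qed.

(** The partners are exchanged: [m'] is paired with the fixed [n], and [n'] with the fixed [m]. This
    extends to an additive functional on [box M N], which can be applied to both sides of an
    identity there. *)
Definition contract (x y : gcar X) Z (z : gcar Z) A B (m' : M A) (n' : N B)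
    (h : bhom Z (gprod A B)) : int :=
  \sum_a \sum_c mark K z ((a, c) : gcar (gprod A B)) h *
    (mark K ((a, y) : gcar (gprod A X)) (tt : gcar pt) (pairing m' n) *
     mark K ((x, c) : gcar (gprod X B)) (tt : gcar pt) (pairing m n')).

Lemma mark_pairing_mapl A A' B (f : bhom A A') (m' : M A') (n' : N B) a c :
  mark K ((a, c) : gcar (gprod A B)) (tt : gcar pt) (pairing (mmap M f m') n') =
  \sum_a' mark K a a' f *
    mark K ((a', c) : gcar (gprod A' B)) (tt : gcar pt) (pairing m' n').
Proof.
rewrite pairing_mapl mark_comp sum_gset_prod; apply: eq_bigr => a' _.
rewrite (bigD1 c) //= big1 ?addr0.
  rewrite mark_prod mark_id eqxx andbT; case: (boolP (gfix K c)) => [|cK].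
    by rewrite mulr1.
  by rewrite (@mark_eq0 _ _ (gprod A' B) _ _ (a', c)) ?mulr0 // gfix_prod (negbTE cK) andbF.
by move=> c' /negbTE cc'; rewrite mark_prod mark_id eq_sym cc' andbF mulr0 mul0r.
Qed.

Lemma mark_pairing_mapr A B B' (g : bhom B B') (m' : M A) (n' : N B') a c :
  mark K ((a, c) : gcar (gprod A B)) (tt : gcar pt) (pairing m' (mmap N g n')) =
  \sum_c' mark K c c' g *
    mark K ((a, c') : gcar (gprod A B')) (tt : gcar pt) (pairing m' n').
Proof.
rewrite pairing_mapr mark_comp sum_gset_prod.
rewrite (bigD1 a) //= [X in _ + X]big1 ?addr0.
  apply: eq_bigr => c' _.
  rewrite mark_prod mark_id eqxx andbT; case: (boolP (gfix K a)) => [|aK].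
    by rewrite mul1r.
  by rewrite (@mark_eq0 _ _ (gprod A B') _ _ (a, c')) ?mulr0 // gfix_prod (negbTE aK).
move=> a' /negbTE aa'; apply: big1 => c' _.
by rewrite mark_prod mark_id eq_sym aa' andbF !mul0r.
Qed.

(** Dinaturality is an exchange of summations: the matrices of [f] and [g] can be absorbed either
    into the pairings or into [h]. *)
Lemma contract_bal x y Z (z : gcar Z) : box_bal (@contract x y Z z).
Proof.
split=> [A B m' m'' n' h|A B m' n' n'' h|A B m' n' h h'|A A' B B' f g m' n' h].
- rewrite /contract -big_split; apply: eq_bigr => a _ /=.
  rewrite -big_split; apply: eq_bigr => c _ /=.
  by rewrite pairingDl markD mulrDl mulrDr.
- rewrite /contract -big_split; apply: eq_bigr => a _ /=.
  rewrite -big_split; apply: eq_bigr => c _ /=.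
  by rewrite pairingDr markD !mulrDr.
- rewrite /contract -big_split; apply: eq_bigr => a _ /=.
  rewrite -big_split; apply: eq_bigr => c _ /=.
  by rewrite markD mulrDl.
pose p a' := mark K ((a', y) : gcar (gprod A' X)) (tt : gcar pt) (pairing m' n).
pose q c' := mark K ((x, c') : gcar (gprod X B')) (tt : gcar pt) (pairing m n').
transitivity (\sum_a \sum_c \sum_a' \sum_c'
    mark K z ((a, c) : gcar (gprod A B)) h *
    ((mark K a a' f * mark K c c' g) * (p a' * q c'))).
  apply: eq_bigr => a _; apply: eq_bigr => c _.
  rewrite mark_pairing_mapl mark_pairing_mapr mulr_suml mulr_sumr.
  apply: eq_bigr => a' _; rewrite -/(p a') mulr_sumr mulr_sumr.
  by apply: eq_bigr => c' _; rewrite -/(q c') mulrACA.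
transitivity (\sum_a' \sum_c' (\sum_a \sum_c
    mark K z ((a, c) : gcar (gprod A B)) h *
    (mark K a a' f * mark K c c' g)) * (p a' * q c')).
  under eq_bigr => a _ do rewrite exchange_big /=.
  rewrite exchange_big /=; apply: eq_bigr => a' _.
  under eq_bigr => a _ do rewrite exchange_big /=.
  rewrite exchange_big /=; apply: eq_bigr => c' _.
  rewrite mulr_suml; apply: eq_bigr => a _; rewrite mulr_suml.
  by apply: eq_bigr => c _; rewrite mulrA.
apply: eq_bigr => a' _; apply: eq_bigr => c' _; congr (_ * _).
rewrite mark_comp sum_gset_prod; apply: eq_bigr => a _; apply: eq_bigr => c _.
by rewrite mark_prod.
Qed.

(** Both sides contract [m (x) n], which by Yoneda is the unit element pulled back
    along [pairing m n]. *)
Lemma pairing_mark_contract x y z t : b z y * b x t = b z t * \sum_s b s y * b x s.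
Proof.
have e := box_Yoneda (bx m n (bid (gprod X X))).
rewrite th_bx bcomp1 oneE mmap_boxE in e.
have := congr1 (box_lift (contract_bal x y ((z, t) : gcar (gprod X X)))) e.
rewrite !box_liftE /contract.
rewrite (bigD1 z) //= (bigD1 t) //= mark_id eqxx andbT.
rewrite big1 ?addr0; last first.
  move=> c /negbTE ct; rewrite mark_id; case: eqP => [[tc]|].
    by rewrite tc eqxx in ct.
  by rewrite andbF mul0r.
rewrite big1 ?addr0; last first.
  move=> a /negbTE az; apply: big1 => c _; rewrite mark_id; case: eqP => [[za]|].
    by rewrite za eqxx in az.
  by rewrite andbF mul0r.
have -> : (gfix K ((z, t) : gcar (gprod X X)))%:R * (b z y * b x t) = b z y * b x t.
  case: (boolP (gfix K _)) => zt; first by rewrite mul1r.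
  rewrite mul0r; apply/esym/eqP; apply: contraNT zt; rewrite mulf_eq0 negb_or.
  case/andP=> /pairing_mark_neq0/andP[zK _] /pairing_mark_neq0/andP[_ tK].
  by rewrite gfix_prod zK.
move=> ->; rewrite mulr_sumr; apply: eq_bigr => s _.
rewrite (bigD1 s) //= big1 ?addr0.
  rewrite mark_comp sum_gset_pt mark_bdiag eqxx andbT -/(b z t).
  rewrite -mulrA; congr (_ * _); rewrite -/(b s y) -/(b x s).
  case: (boolP (gfix K s)) => sK; first by rewrite mul1r.
  rewrite mul0r; apply/esym/eqP; apply: contraNT sK; rewrite mulf_eq0 negb_or.
  by case/andP=> /pairing_mark_neq0/andP[].
move=> c /negbTE cs; rewrite mark_comp sum_gset_pt mark_bdiag eq_sym cs andbF.
by rewrite mulr0 mul0r.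
Qed.

Lemma pairing_mark_invariant x y a a' : a \in 'N(K)%g -> a' \in 'N(K)%g ->
  b (x ** a) (y ** a') = b x y.
Proof.
have bJ u v c : c \in 'N(K)%g -> b (u ** c) (v ** c) = b u v.
  move=> cN; rewrite /b -[in RHS](markJ _ _ _ cN).
  by congr (mark K _ _ _).
have bl u v c : c \in 'N(K)%g -> b (u ** c) v = b u v.
  move=> cN; pose s := perm (act_inj (gact X) c).
  have := @rank_one_invariant _ b pairing_mark_trace pairing_mark_contract s.
  have sE w : s w = w ** c by rewrite permE.
  move=> h; rewrite -sE; apply: h => w w'; rewrite !sE; exact: bJ.
(* In turn: [x ** a] is moved back to [x], then [x] forward to [x ** a'], then [a'] is removed from
   both arguments. *)
move=> aN a'N; rewrite bl // -(bl x (y ** a') a') // bJ //.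
Qed.

End Contraction.

Definition bx_pt (q : M pt * N pt) : box M N pt := bx q.1 q.2 (blununit pt).

(** The ideal [M(pt) . N(pt)] of the Burnside ring. *)
Definition pairing_ideal (a : bhom pt pt) :=
  exists l : seq (M pt * N pt), a = th pt (\sum_(q <- l) bx_pt q).

Lemma pairing_idealD a a' :
  pairing_ideal a -> pairing_ideal a' -> pairing_ideal (a + a').
Proof. by move=> [l ->] [l' ->]; exists (l ++ l'); rewrite big_cat raddfD. Qed.
Lemma pairing_idealN a : pairing_ideal a -> pairing_ideal (- a).
Proof.
move=> [l ->]; exists [seq (- q.1, q.2) | q <- l].
rewrite big_map -[LHS](raddfN (th pt)) -sumrN; congr (th pt _).
by apply: eq_bigr => q _; rewrite /bx_pt bxNm.
Qed.
Lemma pairing_idealM a c : pairing_ideal a -> pairing_ideal (a \bo c).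
Proof.
move=> [l ->]; exists [seq (q.1, mmap N c q.2) | q <- l].
rewrite -[LHS]/(mmap (munit gT) c (th pt _)) -mtr_nat; congr (th pt _).
rewrite raddf_sum big_map; apply: eq_bigr => q _.
by rewrite mmap_boxE /bx_pt /= bx_dinatr blununit_nat.
Qed.

(** The matrix of [btr f] at [K] counts the [K]-fixed points of [O] over each point of [X]. *)
Lemma ptmark_transfer (K : {set gT}) X O (f : gmap O X) (m : M X) (n : N X) :
  ptmark K (th pt (bx_pt (mmap M (btr f) m, mmap N (btr f) n))) =
  \sum_(o | gfix K o) \sum_(o' | gfix K o')
    mark K ((f o, f o') : gcar (gprod X X)) (tt : gcar pt) (pairing m n).
Proof.
pose c x y := mark K ((x, y) : gcar (gprod X X)) (tt : gcar pt) (pairing m n).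
have E (F : gcar X -> int) :
    \sum_x mark K (tt : gcar pt) x (btr f) * F x = \sum_(o | gfix K o) F (f o).
  under eq_bigr => x _ do rewrite mark_btr mulr_suml.
  rewrite exchange_big [RHS]big_mkcond; apply: eq_bigr => o _ /=.
  rewrite (bigD1 (f o)) //= big1 ?addr0; last first.
    by move=> x /negbTE fx; rewrite eq_sym fx andbF mul0r.
  by rewrite eqxx andbT; case: gfix; rewrite ?mul1r ?mul0r.
rewrite /bx_pt /= bx_dinat th_bx mark_comp sum_gset_prod.
transitivity (\sum_x mark K (tt : gcar pt) x (btr f) *
    \sum_y mark K (tt : gcar pt) y (btr f) * c x y).
  apply: eq_bigr => x _; rewrite mulr_sumr; apply: eq_bigr => y _.
  by rewrite mark_bprod_pt mulrA.
by rewrite E; apply: eq_bigr => o _; rewrite E.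
Qed.

Lemma pairing_ideal_coprime0 (p : nat) (K : {group gT}) :
  prime p -> ~~ (p %| #|'N(K) : K|%g)%N ->
  exists2 a, pairing_ideal a & ~~ (p%:Z %| ptmark K a)%Z.
Proof.
move=> pp pW; have [X [m [n oneE]]] := box_diagP one.
pose b x y := mark K ((x, y) : gcar (gprod X X)) (tt : gcar pt) (pairing m n).
(* Otherwise [p] would divide the trace, which is one. *)
have [x pb] : exists x, ~~ (p%:Z %| b x x)%Z.
  apply/existsP; apply: contraT => /existsPn pb.
  have : (p%:Z %| \sum_x b x x)%Z.
    by apply: rpred_sum => x _; rewrite -[_ \in _]negbK pb.
  by rewrite (pairing_mark_trace K oneE) dvdz1 /= eqn_leq leqNgt prime_gt1.
have xK : gfix K x.
  have : b x x != 0 by apply: contraNneq pb => ->; rewrite dvdz0.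
  by move/(pairing_mark_neq0) => /andP[].
(* [O], the orbit of [(x, K)] in [X * P(G)], is a copy of [K\G] over [X]. *)
pose Z := gprod X (gpow gT); pose z0 : gcar Z := (x, gpow_of K).
pose P (z : gcar Z) := [exists a, z == z0 ** a].
have PJ z a : P z -> P (z ** a).
  case/existsP => c /eqP ->; apply/existsP; exists (c * a)%g.
  by rewrite actM.
have z0K k : k \in K -> z0 ** k = z0.
  move=> kK; congr pair; first by move/gfixP: xK; apply.
  by rewrite -[LHS]/(gpow_act (gpow_of K) k) gpow_actE rcoset_id.
pose O := gsub PJ; pose f : gmap O X := gcomp (gfst X (gpow gT)) (gsub_val PJ).
have oP (o : gcar O) : gfix K o -> exists2 a, a \in 'N(K)%g & val o = z0 ** a.
  move=> /gfixP oK; have /existsP[a /eqP oa] := valP o; exists a => //.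
  rewrite -groupV inE; apply/subsetP => y /imsetP[k kK ->].
  have := congr1 (fun o : gcar O => (val o).2) (oK k kK).
  rewrite /= oa /= !gpow_actE => /(can_inj (@gpow_ofK gT)) e.
  have : (a * k)%g \in (K :* a)%g by rewrite -e -rcosetM rcoset_refl.
  by rewrite mem_rcoset /conjg invgK -mulgA.
pose g (o : gcar O) := gpow_set (val o).2.
(* The fixed points of [O] correspond to the cosets of [K] in its normaliser; the coset determines
   the point because [K] fixes [z0]. *)
have cO : #|[set o : gcar O | gfix K o]| = #|'N(K) : K|%g.
  rewrite -(card_in_imset (f := g)); last first.
    move=> o o'; rewrite !inE => /oP[a _ oa] /oP[a' _ oa'].
    rewrite /g oa oa' /= !gpow_actE !gpow_ofK => e; apply: val_inj; rewrite oa oa'.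
    have /rcosetP[k kK ->] : a \in (K :* a')%g by rewrite -e rcoset_refl.
    by rewrite actM (z0K k).
  congr #|pred_of_set _|; apply/setP => A; apply/imsetP/rcosetsP => [[o]|[a aN ->]].
    rewrite inE => /oP[a aN oa] ->; exists a => //.
    by rewrite /g oa /= gpow_actE gpow_ofK.
  have Pa : P (z0 ** a) by apply/existsP; exists a.
  exists (exist _ (z0 ** a) Pa : gcar O); last by rewrite /g /= gpow_actE gpow_ofK.
  rewrite inE; apply/gfixP => k kK; apply: val_inj.
  rewrite -[LHS]/(z0 ** a ** k) -actM conjgCV actM (z0K (k ^ a^-1)%g) //.
  by rewrite memJ_norm // groupV; exact: aN.
exists (th pt (bx_pt (mmap M (btr f) m, mmap N (btr f) n))).
  by exists [:: (mmap M (btr f) m, mmap N (btr f) n)]; rewrite big_seq1.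
rewrite ptmark_transfer.
(* Fixed points of [O] lie over translates of [x] by the normaliser, so by invariance in each
   variable every term equals [b x x]. *)
rewrite (eq_bigr (fun=> \sum_(o' | gfix K (o' : gcar O)) b x x)); last first.
  move=> o /oP[a aN oa]; apply: eq_bigr => o' /oP[a' a'N oa'].
  transitivity (b (x ** a) (x ** a')); last first.
    by rewrite /b (pairing_mark_invariant oneE x x aN a'N).
  have fE u c : val u = z0 ** c -> f u = x ** c by move=> e; rewrite /f /= e.
  by rewrite (fE o a oa) (fE o' a' oa').
rewrite !sumr_const.
have -> : #|[pred o : gcar O | gfix K o]| = #|'N(K) : K|%g.
  by rewrite -cO; apply: eq_card => o; rewrite !inE.
rewrite -mulrnA -[_ *+ (_ * _)]mulr_natr natz.
by move: pb; rewrite !dvdzE abszM /= !Euclid_dvdM // !negb_or => ->; rewrite pW.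
Qed.

Lemma pairing_ideal_coprime (p : nat) (K : {group gT}) : prime p ->
  exists2 a, pairing_ideal a & ~~ (p%:Z %| ptmark K a)%Z.
Proof.
move=> pp; have [L pL eL] := sylow_normaliser_coprime K pp.
have [a Ia pa] := pairing_ideal_coprime0 pp pL; exists a => //.
apply: contra pa => pa; rewrite -(subrK (ptmark K a) (ptmark L a)).
exact: rpredD.
Qed.

Lemma pairing_ideal_mark1 (K : {group gT}) :
  exists2 a, pairing_ideal a & ptmark K a = 1.
Proof.
have := @int_subgroup_one (fun x => exists2 a, pairing_ideal a & ptmark K a = x).
apply=> [x y [a Ia <-] [c Ic <-]|p /(pairing_ideal_coprime K)[a Ia pa]].
  exists (a - c); last by rewrite markB.
  by apply/pairing_idealD/pairing_idealN.
by exists (ptmark K a) => //; exists a.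
Qed.

(** The element [a + c - a \bo c], that is [1 - (1 - a)(1 - c)], has mark 1 wherever [a] or [c]
    does, so the subgroups can be treated one at a time. *)
Lemma pairing_ideal_marks (s : seq {group gT}) :
  exists2 a, pairing_ideal a & forall K, K \in s -> ptmark K a = 1.
Proof.
elim: s => [|K s [a Ia aE]].
  by exists 0 => //; exists [::]; rewrite big_nil raddf0.
have [c Ic cE] := pairing_ideal_mark1 K; exists (a + c - a \bo c).
  by apply/pairing_idealD/pairing_idealN/pairing_idealM => //; apply: pairing_idealD.
move=> L; rewrite inE => /predU1P[->|/aE Ls]; rewrite markB markD ptmarkM.
  by rewrite cE mulr1 addrC addKr.
by rewrite Ls mul1r addrK.
Qed.

Lemma pairing_ideal_one : exists l : seq (M pt * N pt), one = \sum_(q <- l) bx_pt q.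
Proof.
have [a [l ea] a1] := pairing_ideal_marks (enum {group gT}); exists l.
suff e : a = bid pt by rewrite /one -e ea thK.
by apply: mark_inj => K; rewrite ptmark1 a1 ?mem_enum.
Qed.

End Pairing.
End Transfers.

(** * Extension of scalars *)

Section EndPoint.
Variable gT : finGroupType.
Local Notation pt := (gpt gT).
Local Notation R := (burnside_ring gT).
Implicit Types (X Y Z : gset gT).

Definition gcls X : gclass gT := cls X.

Definition pt_span X : span pt pt := Span (gterm X) (gterm X).

Lemma pt_span_iso X Y : giso X Y -> span_iso (pt_span X) (pt_span Y).
Proof. by case=> f bf; exists f; split. Qed.

Lemma pt_spanE (s : span pt pt) : span_iso (pt_span (apex s)) s.
Proof.
exists (gid _); split; first by exists id.
  by move=> u; case: (legl s _).
by move=> u; case: (legr s _).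
Qed.

Definition pt_spanc (c : gclass gT) : spanc pt pt := scls (pt_span (rep c)).
Lemma pt_spancE X : pt_spanc (cls X) = scls (pt_span X).
Proof. by apply/scls_eq/pt_span_iso/(rep_cls (giso_eqv gT)). Qed.
Lemma gin_pt_spancD (c d : gclass gT) :
  gin (pt_spanc (c + d)) = gin (pt_spanc c) + gin (pt_spanc d).
Proof.
elim/quotW: c => X; elim/quotW: d => Y.
rewrite [_ + _](gclass_addE X Y) !pt_spancE -ginD.
congr gin; rewrite sclsD; apply: scls_eq; exists (gid _).
by split; [exists id | case | case].
Qed.

Definition apexc (c : spanc pt pt) : gclass gT := cls (apex (rep c)).
Lemma apexcE (s : span pt pt) : apexc (scls s) = cls (apex s).
Proof.
apply: cls_eq; have [f [bf _ _]] := rep_cls (span_eqv pt pt) s.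
by exists f.
Qed.
Lemma gin_apexcD (c d : spanc pt pt) :
  gin (apexc (c + d)) = gin (apexc c) + gin (apexc d).
Proof.
elim/sclsW: c => s; elim/sclsW: d => t; rewrite sclsD !apexcE -ginD.
by congr gin; rewrite [RHS](gclass_addE (apex s) (apex t)).
Qed.

(** The Burnside ring is the endomorphism ring of the point: a finite set with action corresponds to
    the span having it as apex, and [bendV] recovers the apex. *)
Definition bend (r : R) : bhom pt pt := locked (groth_lift gin_pt_spancD r).
Definition bendV (a : bhom pt pt) : R := locked (groth_lift gin_apexcD a).

Lemma bend_gin X : bend (gin (gcls X)) = gin (scls (pt_span X)).
Proof. by rewrite /bend -lock groth_lift_gin pt_spancE. Qed.
Lemma bendV_gin s : bendV (gin (scls s)) = gin (gcls (apex s)).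
Proof. by rewrite /bendV -lock groth_lift_gin apexcE. Qed.
Lemma bendB : {morph bend : r s / r - s}.
Proof. by move=> r s; rewrite /bend -!lock raddfB. Qed.
Lemma bendVB : {morph bendV : r s / r - s}.
Proof. by move=> r s; rewrite /bendV -!lock raddfB. Qed.

Lemma burnsideW (P : R -> Prop) :
  (forall X, P (gin (gcls X))) -> (forall r s, P r -> P s -> P (r - s)) ->
  forall r, P r.
Proof. by move=> PX PB; apply: grothW => //; apply: quotW. Qed.

Lemma bendK : cancel bend bendV.
Proof.
elim/burnsideW=> [X|r s Hr Hs]; last by rewrite bendB bendVB Hr Hs.
by rewrite bend_gin bendV_gin.
Qed.
Lemma bendVK : cancel bendV bend.
Proof.
elim/bhomW=> [s|f g Hf Hg]; last by rewrite bendVB bendB Hf Hg.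
by rewrite bendV_gin bend_gin (scls_eq (pt_spanE s)).
Qed.

Lemma bend1 : bend 1 = bid pt.
Proof.
rewrite -[1]/(gin (gcls pt)) bend_gin; congr gin; apply: scls_eq.
by exists (gid _); split; [exists id|case|case].
Qed.

Lemma bendM r s : bend (r * s) = bend r \bo bend s.
Proof.
elim/burnsideW: r => [X|r r' H H']; last by rewrite mulrBl !bendB bcompBl H H'.
elim/burnsideW: s => [Y|s s' H H']; last by rewrite mulrBr !bendB bcompBr H H'.
rewrite -[_ * _]/(gmul _ _) gmul_gin [_ * _](gclass_mulE X Y).
rewrite !bend_gin bcomp_gin spanc_compE; congr gin; apply: scls_eq.
(* The pullback over the point is the full product, with its factors in reverse order. *)
have hP (p : gcar X * gcar Y) : gterm Y p.2 == gterm X p.1 by [].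
apply: (@span_isoI _ _ _ (pt_span (gprod X Y)) (span_comp (pt_span X) (pt_span Y))
  (fun p => exist _ (p.2, p.1) (hP p)) (fun p => ((val p).2, (val p).1))) => //.
- by move=> p a; apply: val_inj.
- by case.
- by case=> -[x y] e; apply: val_inj.
Qed.

(** Commutativity comes from the Burnside ring; it makes the contravariant action on the value of a
    Mackey functor at the point a module structure. *)
Lemma bcomp_ptC (a b : bhom pt pt) : a \bo b = b \bo a.
Proof. by rewrite -[a]bendVK -[b]bendVK -!bendM mulrC. Qed.

Lemma bendD : {morph bend : r s / r + s}.
Proof. by move=> r s; rewrite /bend -!lock raddfD. Qed.

Lemma bendVD : {morph bendV : a b / a + b}.
Proof. by move=> a b; rewrite /bendV -!lock raddfD. Qed.
Lemma bendVM r a : bendV (bend r \bo a) = r * bendV a.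
Proof. by rewrite -{1}[a]bendVK -bendM bendK. Qed.

Section Rmod.
Variable Z : gset gT.
Definition bmod : Type := bhom Z pt.
HB.instance Definition _ := GRing.Zmodule.on bmod.
Definition bmod_scale (r : R) (a : bmod) : bmod := bend r \bo a.
Lemma bmod_scaleA r s a : bmod_scale r (bmod_scale s a) = bmod_scale (r * s) a.
Proof. by rewrite /bmod_scale bendM bcompA. Qed.
Lemma bmod_scale1 : left_id 1 bmod_scale.
Proof. by move=> a; rewrite /bmod_scale bend1 b1comp. Qed.
Lemma bmod_scaleDr : right_distributive bmod_scale +%R.
Proof. by move=> r a b; rewrite /bmod_scale -bcompDr. Qed.
Lemma bmod_scaleDl a : {morph bmod_scale^~ a : r s / r + s}.
Proof. by move=> r s; rewrite /bmod_scale bendD bcompDl. Qed.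
HB.instance Definition _ := GRing.Zmodule_isLmodule.Build R bmod
  bmod_scaleA bmod_scale1 bmod_scaleDr bmod_scaleDl.
Lemma bmodZ (r : R) (a : bmod) : r *: a = bend r \bo a.
Proof. by []. Qed.
End Rmod.

Section Eval.
Variable M : mackey gT.
Definition meval : Type := M pt.
HB.instance Definition _ := GRing.Zmodule.on meval.
Definition meval_scale (r : R) (m : meval) : meval := mmap M (bend r) m.
Lemma meval_scaleA r s m : meval_scale r (meval_scale s m) = meval_scale (r * s) m.
Proof. by rewrite /meval_scale bendM bcomp_ptC mmap_comp. Qed.
Lemma meval_scale1 : left_id 1 meval_scale.
Proof. by move=> m; rewrite /meval_scale bend1 mmap1. Qed.
Lemma meval_scaleDr : right_distributive meval_scale +%R.
Proof. by move=> r m m'; rewrite /meval_scale -raddfD. Qed.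
Lemma meval_scaleDl m : {morph meval_scale^~ m : r s / r + s}.
Proof. by move=> r s; rewrite /meval_scale bendD mmapD. Qed.
HB.instance Definition _ := GRing.Zmodule_isLmodule.Build R meval
  meval_scaleA meval_scale1 meval_scaleDr meval_scaleDl.
Lemma mevalZ (r : R) (m : meval) : r *: m = mmap M (bend r) m.
Proof. by []. Qed.
End Eval.

Definition bpre_fun X Y (f : bhom X Y) (a : bmod Y) : bmod X := a \bo f.
Lemma bpre_linear X Y (f : bhom X Y) : linear (bpre_fun f).
Proof. by move=> r a b; rewrite /bpre_fun bmodZ bcompDl bmodZ bcompA. Qed.
Definition bpre X Y (f : bhom X Y) : {linear bmod Y -> bmod X} :=
  HB.pack (bpre_fun f) (GRing.isLinear.Build _ _ _ _ _ (bpre_linear f)).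
Lemma bpreE X Y (f : bhom X Y) (a : bmod Y) : bpre f a = a \bo f.
Proof. by []. Qed.

Section Induced.
Variable L : lmodType R.

Definition ind_map X Y (f : bhom X Y) :
    {additive tens (bmod Y) L -> tens (bmod X) L} :=
  tens_map (bpre f) (idfun : {linear L -> L}).
Lemma ind_mapE X Y (f : bhom X Y) (a : bmod Y) l :
  ind_map f (tn a l) = tn (a \bo f : bmod X) l.
Proof. exact: tens_mapE. Qed.
Lemma ind_mapD X Y (f g : bhom X Y) x : ind_map (f + g) x = ind_map f x + ind_map g x.
Proof.
elim/tens_ind: x => [a l||x y Hx Hy|x Hx].
- by rewrite !ind_mapE bcompDr tnDl.
- by rewrite !raddf0 addr0.
- by rewrite !raddfD Hx Hy /= addrACA.
- by rewrite !raddfN Hx /= opprD.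
Qed.
Lemma ind_map1 X x : ind_map (bid X) x = x.
Proof.
elim/tens_ind: x => [a l||x y Hx Hy|x Hx].
- by rewrite !ind_mapE bcomp1.
- by rewrite !raddf0.
- by rewrite !raddfD Hx Hy.
- by rewrite !raddfN Hx.
Qed.
Lemma ind_map_comp X Y Z (g : bhom Y Z) (f : bhom X Y) x :
  ind_map (g \bo f) x = ind_map f (ind_map g x).
Proof.
elim/tens_ind: x => [a l||x y Hx Hy|x Hx].
- by rewrite !ind_mapE bcompA.
- by rewrite !raddf0.
- by rewrite !raddfD Hx Hy.
- by rewrite !raddfN Hx.
Qed.

(** Extension of scalars from the Burnside ring to the Burnside Mackey functor. *)
Definition induced : mackey gT := Mackey ind_mapD ind_map1 ind_map_comp.
Lemma mmap_indE X Y (f : bhom X Y) (a : bmod Y) (l : L) :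
  mmap induced f (tn a l) = tn (a \bo f : bmod X) l.
Proof. exact: ind_mapE. Qed.
End Induced.
End EndPoint.

(** * Extension of scalars is strong monoidal and undone by evaluation at the point *)

Section InducedTheory.
Variable gT : finGroupType.
Local Notation pt := (gpt gT).
Local Notation R := (burnside_ring gT).
Implicit Types (X Y Z : gset gT) (L : lmodType R).

Lemma miso_of_cancel (M N : mackey gT) (t : mtrans M N) (u : forall X, N X -> M X) :
  (forall X, cancel (t X) (u X)) -> (forall X, cancel (u X) (t X)) -> miso M N.
Proof.
move=> tK uK.
have uB X : zmod_morphism (u X).
  by move=> x y; rewrite -[x in LHS]uK -[y in LHS]uK -raddfB tK.
pose u' X : {additive N X -> M X} :=
  HB.pack (u X) (GRing.isZmodMorphism.Build _ _ _ (uB X)).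
have uN X Y (f : bhom X Y) n : u' X (mmap N f n) = mmap M f (u' Y n).
  by rewrite /u' /= -[n in LHS]uK -mtr_nat tK.
by exists t, (MTrans uN).
Qed.

Lemma bswap_blununit : bswap pt pt \bo blununit pt = blununit pt.
Proof. by rewrite bof_comp; congr gin; apply: scls_of_ext; case. Qed.

(** The left and right unitors coincide at the point, so an endomorphism acts alike through either
    factor. *)
Lemma bprod_blununit (f : bhom pt pt) :
  bprod f (bid pt) \bo blununit pt = blununit pt \bo f.
Proof.
rewrite -{1}bswap_blununit bcompA -bswap_nat -bcompA blununit_nat bcompA.
by rewrite bswap_blununit.
Qed.

Section InducedMap.
Variables (L L' : lmodType R) (f : {linear L -> L'}).
Definition ind_tr_fun X : {additive induced L X -> induced L' X} :=
  tens_map (idfun : {linear bmod X -> bmod X}) f.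
Lemma ind_tr_funE X (a : bmod X) l : ind_tr_fun X (tn a l) = tn a (f l).
Proof. exact: tens_mapE. Qed.
Lemma ind_tr_nat X Y (g : bhom X Y) x :
  ind_tr_fun X (mmap (induced L) g x) = mmap (induced L') g (ind_tr_fun Y x).
Proof.
elim/tens_ind: x => [a l||x y Hx Hy|x Hx].
- by rewrite mmap_indE !ind_tr_funE mmap_indE.
- by rewrite !raddf0.
- by rewrite !raddfD Hx Hy.
- by rewrite !raddfN Hx.
Qed.
Definition ind_tr : mtrans (induced L) (induced L') := MTrans ind_tr_nat.
Lemma ind_trE X (a : bmod X) l : ind_tr X (tn a l) = tn a (f l).
Proof. exact: ind_tr_funE. Qed.
End InducedMap.

Lemma ind_tr_cancel L L' (f : {linear L -> L'}) (g : {linear L' -> L}) :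
  cancel f g -> forall X, cancel (ind_tr f X) (ind_tr g X).
Proof.
move=> fK X; elim/tens_ind=> [a l||x y Hx Hy|x Hx].
- by rewrite !ind_trE fK.
- by rewrite !raddf0.
- by rewrite !raddfD Hx Hy.
- by rewrite !raddfN Hx.
Qed.

Lemma induced_iso L L' : modiso L L' -> miso (induced L) (induced L').
Proof.
by case=> f [g [fK gK]]; exists (ind_tr f), (ind_tr g); split; apply: ind_tr_cancel.
Qed.

Lemma ind_unit_bilin X : bilin (fun (a : bmod X) (r : R^o) => (r : R) *: a).
Proof.
split=> [a b r|a r s|s a r|s a r].
- exact: scalerDr.
- exact: scalerDl.
- by rewrite !scalerA mulrC.
- by rewrite scalerA.
Qed.
Definition ind_unit_fun X : {additive induced (R^o : lmodType R) X -> munit gT X} :=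
  tens_lin (ind_unit_bilin X).
Lemma ind_unit_funE X (a : bmod X) (r : R^o) :
  ind_unit_fun X (tn a r) = (r : R) *: a :> bmod X.
Proof. exact: tens_linE. Qed.
Lemma ind_unit_nat X Y (f : bhom X Y) x :
  ind_unit_fun X (mmap (induced (R^o : lmodType R)) f x) =
  mmap (munit gT) f (ind_unit_fun Y x).
Proof.
elim/tens_ind: x => [a r||x y Hx Hy|x Hx].
- rewrite mmap_indE !ind_unit_funE !bmodZ.
  by rewrite -[RHS]/(_ \bo _) bcompA.
- by rewrite !raddf0.
- by rewrite !raddfD Hx Hy.
- by rewrite !raddfN Hx.
Qed.

Lemma induced_unit : miso (induced (R^o : lmodType R)) (munit gT).
Proof.
apply: (@miso_of_cancel _ _ (MTrans ind_unit_nat)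
  (fun X (a : bmod X) => tn a (1 : R^o))) => X; last first.
  by move=> a; rewrite -[LHS]/(ind_unit_fun X _) ind_unit_funE scale1r.
suff: cancel (ind_unit_fun X) (fun a : bmod X => tn a (1 : R^o)) by [].
elim/tens_ind=> [a r||x y Hx Hy|x Hx].
- by rewrite ind_unit_funE tn_bal; congr tn; apply: mulr1.
- by rewrite raddf0 tn0l.
- by rewrite raddfD tnDl Hx Hy.
- by rewrite raddfN tnNl Hx.
Qed.

Lemma modiso_of_cancel (A B : lmodType R) (f : A -> B) (g : B -> A) :
  linear f -> cancel f g -> cancel g f -> modiso A B.
Proof.
move=> fl fK gK.
have gl : linear g by move=> r x y; apply: (can_inj fK); rewrite fl !gK.
pose f' : {linear A -> B} := HB.pack f (GRing.isLinear.Build _ _ _ _ _ fl).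
pose g' : {linear B -> A} := HB.pack g (GRing.isLinear.Build _ _ _ _ _ gl).
by exists f', g'.
Qed.

Lemma bmod_pt_iso : modiso (bmod pt : lmodType R) (R^o : lmodType R).
Proof.
apply: (@modiso_of_cancel _ _ (@bendV gT : bmod pt -> R^o) (@bend gT : R^o -> bmod pt)).
- by move=> r a b; rewrite bmodZ bendVD bendVM.
- exact: bendVK.
- exact: bendK.
Qed.

Lemma induced_pt L : modiso (tens (bmod pt) L) L.
Proof.
apply: modiso_trans (tens1 L).
exact: tens_iso bmod_pt_iso (modiso_refl L).
Qed.

(** The scalars of the tensor product agree with the action of endomorphisms of the point, so the
    component at the point of a natural transformation is linear. *)
Lemma induced_ptZ L (r : R) (x : tens (bmod pt) L) :
  r *: x = mmap (induced L) (bend r) x.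
Proof.
elim/tens_ind: x => [a l||x y Hx Hy|x Hx].
- by rewrite mmap_indE scale_tn bmodZ bcomp_ptC.
- by rewrite !raddf0.
- by rewrite scalerDr raddfD Hx Hy.
- by rewrite scalerN raddfN Hx.
Qed.

Lemma induced_inj L L' : miso (induced L) (induced L') -> modiso L L'.
Proof.
case=> t [u [tK uK]].
apply: modiso_trans (induced_pt L'); apply: modiso_trans (modiso_sym (induced_pt L)) _.
apply: (@modiso_of_cancel (tens (bmod pt) L) (tens (bmod pt) L') (t pt) (u pt)).
- by move=> r x y; rewrite !induced_ptZ raddfD mtr_nat.
- exact: tK.
- exact: uK.
Qed.

Section TensExt.
Variables (M N P : lmodType R).
Implicit Types f g h : {linear tens M N -> P}.
Lemma tens_eqD f g h : (forall m n, f (tn m n) = g (tn m n) + h (tn m n)) ->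
  forall y, f y = g y + h y.
Proof.
move=> H; elim/tens_ind=> [||x y Hx Hy|x Hx]; first exact: H.
- by rewrite !linear0 addr0.
- by rewrite !linearD Hx Hy addrACA.
- by rewrite !linearN Hx opprD.
Qed.
Lemma tens_eqZ f g r : (forall m n, f (tn m n) = r *: g (tn m n)) ->
  forall y, f y = r *: g y.
Proof.
move=> H; elim/tens_ind=> [||x y Hx Hy|x Hx]; first exact: H.
- by rewrite !linear0.
- by rewrite !linearD Hx Hy.
- by rewrite !linearN Hx.
Qed.
End TensExt.

Section InducedTens.
Variables L L' : lmodType R.

Definition bext X Y (a : bmod X) (a' : bmod Y) : bmod (gprod X Y) :=
  blunit pt \bo bprod a a'.
Lemma bextDl X Y (a b : bmod X) (a' : bmod Y) :
  bext (a + b) a' = bext a a' + bext b a'.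
Proof. by rewrite /bext bprodDl bcompDr. Qed.
Lemma bextDr X Y (a : bmod X) (a' b' : bmod Y) :
  bext a (a' + b') = bext a a' + bext a b'.
Proof. by rewrite /bext bprodDr bcompDr. Qed.
Lemma bextZr X Y r (a : bmod X) (a' : bmod Y) : bext a (r *: a') = r *: bext a a'.
Proof.
rewrite /bext !bmodZ bcompA -blunit_nat -bcompA; congr (_ \bo _).
by rewrite bprod_comp b1comp.
Qed.
Lemma bunit_natl (f : bhom pt pt) :
  blunit pt \bo bprod f (bid pt) = f \bo blunit pt.
Proof.
rewrite -[LHS]bcomp1 -(blunitK pt) -!bcompA [X in _ \bo X]bcompA bprod_blununit.
by rewrite !bcompA blununitK b1comp.
Qed.
Lemma bextZl X Y r (a : bmod X) (a' : bmod Y) : bext (r *: a) a' = r *: bext a a'.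
Proof.
rewrite /bext !bmodZ bcompA -bunit_natl -bcompA; congr (_ \bo _).
by rewrite bprod_comp b1comp.
Qed.

Lemma bext_comp X X' Y Y' (a : bmod X') (a' : bmod Y') (f : bhom X X') (g : bhom Y Y') :
  bext (a \bo f : bmod X) (a' \bo g : bmod Y) = bext a a' \bo bprod f g.
Proof. by rewrite /bext -bprod_comp bcompA. Qed.

Section Back.
Variables (Z X Y : gset gT) (h : bhom Z (gprod X Y)).
Let P := tens (bmod Z) (tens L L').
Lemma ind_box_bilin0 (a : bmod X) (l : L) :
  bilin (fun (a' : bmod Y) (l' : L') => tn (bpre h (bext a a')) (tn l l') : P).
Proof.
split=> [a' b' l'|a' l' k'|r a' l'|r a' l'].
- by rewrite bextDr linearD tnDl.
- by rewrite !tnDr.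
- by rewrite bextZr linearZ_LR scale_tn.
- by rewrite -scale_tnr -scale_tnr.
Qed.
Lemma ind_box_bilin (y : tens (bmod Y) L') :
  bilin (fun (a : bmod X) (l : L) => tens_lin (ind_box_bilin0 a l) y).
Proof.
split=> [a b l|a l k|r a l|r a l].
- apply: tens_eqD => a' l'; rewrite !tens_linE.
  by rewrite bextDl linearD tnDl.
- apply: tens_eqD => a' l'; rewrite !tens_linE.
  by rewrite tnDl tnDr.
- apply: tens_eqZ => a' l'; rewrite !tens_linE.
  by rewrite bextZl linearZ_LR scale_tn.
- apply: tens_eqZ => a' l'; rewrite !tens_linE.
  by rewrite -scale_tn -scale_tnr.
Qed.
Definition ind_box_phi (x : induced L X) (y : induced L' Y) : induced (tens L L') Z :=
  tens_lin (ind_box_bilin y) x.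
Lemma ind_box_phiE (a : bmod X) (l : L) (a' : bmod Y) (l' : L') :
  ind_box_phi (tn a l) (tn a' l') = tn (bpre h (bext a a')) (tn l l').
Proof. by rewrite /ind_box_phi !tens_linE. Qed.
Lemma ind_box_phiDl x x' y : ind_box_phi (x + x') y = ind_box_phi x y + ind_box_phi x' y.
Proof. exact: linearD. Qed.
Lemma ind_box_phiDr x y y' : ind_box_phi x (y + y') = ind_box_phi x y + ind_box_phi x y'.
Proof.
rewrite /ind_box_phi; elim/tens_ind: x => [a l||x x' Hx Hx'|x Hx].
- by rewrite !tens_linE linearD.
- by rewrite !linear0 addr0.
- by rewrite !linearD Hx Hx' addrACA.
- by rewrite !linearN Hx opprD.
Qed.
End Back.

Lemma bpreD Z W (h h' : bhom Z W) (a : bmod W) : bpre (h + h') a = bpre h a + bpre h' a.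
Proof. by rewrite !bpreE bcompDr. Qed.

Lemma ind_box_bal Z :
  box_bal (fun X Y (x : induced L X) (y : induced L' Y) (h : bhom Z (gprod X Y)) =>
    ind_box_phi h x y).
Proof.
split=> [X Y x x' y h|X Y x y y' h|X Y x y h h'|X X' Y Y' f g x y h].
- exact: ind_box_phiDl.
- exact: ind_box_phiDr.
- rewrite /ind_box_phi; elim/tens_ind: x => [a l||x x' Hx Hx'|x Hx].
  + rewrite !tens_linE; elim/tens_ind: y => [a' l'||y y' Hy Hy'|y Hy].
    * by rewrite !tens_linE bpreD tnDl.
    * by rewrite !linear0 addr0.
    * by rewrite !linearD Hy Hy' addrACA.
    * by rewrite !linearN Hy opprD.
  + by rewrite !linear0 addr0.
  + by rewrite !linearD Hx Hx' addrACA.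
  + by rewrite !linearN Hx opprD.
rewrite /ind_box_phi; elim/tens_ind: x => [a l||x x' Hx Hx'|x Hx].
- elim/tens_ind: y => [a' l'||y y' Hy Hy'|y Hy].
  + rewrite !mmap_indE !tens_linE; congr tn.
    by rewrite !bpreE bext_comp -bcompA.
  + by rewrite raddf0 !mmap_indE !tens_linE !linear0.
  + by move: Hy Hy'; rewrite raddfD !mmap_indE !tens_linE !linearD => -> ->.
  + by move: Hy; rewrite raddfN !mmap_indE !tens_linE !linearN => ->.
- by rewrite raddf0 !linear0.
- by rewrite raddfD !linearD Hx Hx'.
- by rewrite raddfN !linearN Hx.
Qed.

Lemma ind_box_nat Z Z' (k : bhom Z Z') x :
  box_lift (ind_box_bal Z) (mmap (box (induced L) (induced L')) k x) =
  mmap (induced (tens L L')) k (box_lift (ind_box_bal Z') x).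
Proof.
apply: (@box_trans _ _ _ (induced (tens L L')) _ ind_box_bal) => {x}{}Z {}Z' {}k X Y x y h.
rewrite /ind_box_phi; elim/tens_ind: x => [a l||x x' Hx Hx'|x Hx].
- elim/tens_ind: y => [a' l'||y y' Hy Hy'|y Hy].
  + rewrite !tens_linE mmap_indE; congr tn.
    by rewrite !bpreE bcompA.
  + by rewrite !tens_linE !linear0 raddf0.
  + by move: Hy Hy'; rewrite !tens_linE !linearD raddfD => -> ->.
  + by move: Hy; rewrite !tens_linE !linearN raddfN => ->.
- by rewrite !linear0 raddf0.
- by rewrite !linearD raddfD Hx Hx'.
- by rewrite !linearN raddfN Hx.
Qed.
Definition ind_box : mtrans (box (induced L) (induced L')) (induced (tens L L')) :=
  @MTrans _ (box (induced L) (induced L')) (induced (tens L L'))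
    (fun Z => box_lift (ind_box_bal Z)) ind_box_nat.
Lemma ind_boxE Z X Y (a : bmod X) (l : L) (a' : bmod Y) (l' : L')
    (h : bhom Z (gprod X Y)) :
  ind_box Z (bx (tn a l : induced L X) (tn a' l' : induced L' Y) h) =
  tn (bpre h (bext a a')) (tn l l').
Proof. by rewrite box_liftE ind_box_phiE. Qed.

(** The unit [m |-> 1 (x) m] of extension of scalars. By [mmap_ind_one] its values generate
    [induced M], so the inverse of [ind_box] can be written with pairs of them over the point. *)
Definition ind_one (M : lmodType R) (m : M) : induced M pt := tn (bid pt : bmod pt) m.
Lemma ind_oneD (M : lmodType R) (m m' : M) : ind_one (m + m') = ind_one m + ind_one m'.
Proof. exact: tnDr. Qed.
Lemma ind_oneZ (M : lmodType R) r (m : M) :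
  ind_one (r *: m) = mmap (induced M) (bend r) (ind_one m).
Proof. by rewrite mmap_indE /ind_one -tn_bal bmodZ b1comp bcomp1. Qed.
Lemma mmap_ind_one (M : lmodType R) X (a : bmod X) (m : M) :
  mmap (induced M) a (ind_one m) = tn a m.
Proof. by rewrite mmap_indE b1comp. Qed.

(** A scalar slides from one factor to the other because on either side it becomes [bend r] composed
    before [blununit pt]. *)
Lemma ind_unbox_bal0 Z (a : bmod Z) :
  tens_balanced (fun l l' => bx (ind_one l) (ind_one l') (blununit pt \bo a)
    : box (induced L) (induced L') Z).
Proof.
split=> [l k l'|l l' k'|r l l'].
- by rewrite ind_oneD bxDm.
- by rewrite ind_oneD bxDn.
- by rewrite !ind_oneZ bx_dinatl bx_dinatr !bcompA bprod_blununit blununit_nat.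
Qed.
Lemma ind_unbox_bal Z :
  tens_balanced (fun (a : bmod Z) (t : tens L L') => tens_lift (ind_unbox_bal0 a) t).
Proof.
split=> [a b t|a t t'|r a t]; last 2 first.
- by rewrite raddfD.
- elim/tens_ind: t => [l l'||x y Hx Hy|x Hx].
  + rewrite scale_tn !tens_liftE ind_oneZ bx_dinatl bcompA bprod_blununit.
    by rewrite bmodZ bcompA.
  + by rewrite scaler0 !raddf0.
  + by rewrite scalerDr !raddfD Hx Hy.
  + by rewrite scalerN !raddfN Hx.
elim/tens_ind: t => [l l'||x y Hx Hy|x Hx].
- by rewrite !tens_liftE bcompDr bxDh.
- by rewrite !raddf0 addr0.
- by rewrite !raddfD Hx Hy /= addrACA.
- by rewrite !raddfN Hx /= opprD.
Qed.
Definition ind_unbox Z :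
    {additive tens (bmod Z) (tens L L') -> box (induced L) (induced L') Z} :=
  tens_lift (ind_unbox_bal Z).
Lemma ind_unboxE Z (a : bmod Z) l l' :
  ind_unbox Z (tn a (tn l l')) = bx (ind_one l) (ind_one l') (blununit pt \bo a).
Proof. by rewrite !tens_liftE. Qed.

Lemma ind_boxK Z : cancel (ind_box Z) (ind_unbox Z).
Proof.
elim/box_ind=> [X Y x y h||x y Hx Hy|x Hx]; last 3 first.
- by rewrite !raddf0.
- by rewrite !raddfD Hx Hy.
- by rewrite !raddfN Hx.
elim/tens_ind: x => [a l||x x' Hx Hx'|x Hx]; last 3 first.
- by rewrite bx0m !raddf0.
- by rewrite bxDm !raddfD Hx Hx'.
- by rewrite bxNm !raddfN Hx.
elim/tens_ind: y => [a' l'||y y' Hy Hy'|y Hy]; last 3 first.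
- by rewrite bx0n !raddf0.
- by rewrite bxDn !raddfD Hy Hy'.
- by rewrite bxNn !raddfN Hy.
(* Dinaturality returns [a] and [a'] to their own factors, where they turn each [ind_one] into the
   original tensor. *)
rewrite ind_boxE ind_unboxE bpreE /bext !bcompA blunitK b1comp -bx_dinat.
by rewrite !mmap_ind_one.
Qed.

Lemma ind_unboxK Z : cancel (ind_unbox Z) (ind_box Z).
Proof.
elim/tens_ind=> [a t||x y Hx Hy|x Hx]; last 3 first.
- by rewrite !raddf0.
- by rewrite !raddfD Hx Hy.
- by rewrite !raddfN Hx.
elim/tens_ind: t => [l l'||x y Hx Hy|x Hx]; last 3 first.
- by rewrite tn0r !raddf0.
- by rewrite tnDr !raddfD Hx Hy.
- by rewrite tnNr !raddfN Hx.
rewrite ind_unboxE /ind_one ind_boxE bpreE /bext bprod1 bcomp1 bcompA.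
by rewrite blununitK b1comp.
Qed.

Lemma induced_tens : miso (box (induced L) (induced L')) (induced (tens L L')).
Proof. exact: miso_of_cancel ind_boxK ind_unboxK. Qed.
End InducedTens.
End InducedTheory.

(** * Invertible Mackey functors are extended *)

Section RightUnit.
Variable gT : finGroupType.
Local Notation pt := (gpt gT).
Implicit Types X Y : gset gT.

Definition brunit X : bhom (gprod X pt) X := blunit X \bo bswap X pt.
Definition brununit X : bhom X (gprod X pt) := bswap pt X \bo blununit X.

Lemma brunit_nat X Y (f : bhom X Y) :
  brunit Y \bo bprod f (bid pt) = f \bo brunit X.
Proof. by rewrite /brunit -bcompA bswap_nat bcompA blunit_nat -bcompA. Qed.
Lemma brununit_nat X Y (f : bhom X Y) :
  bprod f (bid pt) \bo brununit X = brununit Y \bo f.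
Proof. by rewrite /brununit bcompA -bswap_nat -bcompA blununit_nat bcompA. Qed.
Lemma brununitK X : brunit X \bo brununit X = bid X.
Proof.
by rewrite /brunit /brununit bcompA -(bcompA (blunit X)) bswapK bcomp1 blununitK.
Qed.
Lemma brununit_pt : brununit pt = blununit pt.
Proof. exact: bswap_blununit. Qed.
End RightUnit.

Section InvertibleMackey.
Variable gT : finGroupType.
Local Notation pt := (gpt gT).
Local Notation R := (burnside_ring gT).
Implicit Types X Y Z : gset gT.

Section Counit.
Variable M : mackey gT.

Lemma counit_bal Z :
  tens_balanced (fun (a : bmod Z) (m : meval M) => mmap M a (m : M pt)).
Proof.
split=> [a b m|a m m'|r a m]; [exact: mmapD | exact: raddfD |].
by rewrite bmodZ mevalZ mmap_comp.
Qed.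
Definition counit_fun Z : {additive induced (meval M) Z -> M Z} :=
  tens_lift (counit_bal Z).
Lemma counit_funE Z (a : bmod Z) (m : meval M) :
  counit_fun Z (tn a m) = mmap M a (m : M pt).
Proof. exact: tens_liftE. Qed.
Lemma counit_nat X Y (f : bhom X Y) x :
  counit_fun X (mmap (induced (meval M)) f x) = mmap M f (counit_fun Y x).
Proof.
elim/tens_ind: x => [a l||x y Hx Hy|x Hx].
- by rewrite mmap_indE !counit_funE mmap_comp.
- by rewrite !raddf0.
- by rewrite !raddfD Hx Hy.
- by rewrite !raddfN Hx.
Qed.
Definition counit : mtrans (induced (meval M)) M := MTrans counit_nat.
Lemma counitE Z (a : bmod Z) (m : meval M) : counit Z (tn a m) = mmap M a (m : M pt).
Proof. exact: counit_funE. Qed.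
End Counit.

Variables M N : mackey gT.
Variables (th : mtrans (box M N) (munit gT)) (th' : mtrans (munit gT) (box M N)).
Hypothesis thK : forall Z, cancel (th Z) (th' Z).
Hypothesis th'K : forall Z, cancel (th' Z) (th Z).

Variable l : seq (M pt * N pt).
Hypothesis lE : th' pt (bid pt : munit gT pt) = \sum_(q <- l) bx_pt q.

(** [rpair] and [lpair] are the products [x n_i] and [m_i n_j] of the dual-basis formula: pairings
    with one argument at the point, the unit factor being removed. *)
Definition rpair Z (x : M Z) (n : N pt) : bhom Z pt := pairing th x n \bo brununit Z.
Definition lpair Z (m : M pt) (n : N Z) : bhom Z pt := pairing th m n \bo blununit Z.

Lemma rpair_map X Z (f : bhom X Z) (x : M Z) n :
  rpair (mmap M f x) n = rpair x n \bo f.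
Proof. by rewrite /rpair pairing_mapl -bcompA brununit_nat bcompA. Qed.
Lemma lpair_map X Z (f : bhom X Z) m (n : N Z) :
  lpair m (mmap N f n) = lpair m n \bo f.
Proof. by rewrite /lpair pairing_mapr -bcompA blununit_nat bcompA. Qed.
Lemma lpairD Z m (n n' : N Z) : lpair m (n + n') = lpair m n + lpair m n'.
Proof. by rewrite /lpair pairingDr bcompDl. Qed.
Lemma rpairD Z (x x' : M Z) n : rpair (x + x') n = rpair x n + rpair x' n.
Proof. by rewrite /rpair pairingDl bcompDl. Qed.

Lemma sum_lpair : \sum_(q <- l) lpair q.1 q.2 = bid pt.
Proof.
rewrite -[RHS]th'K lE raddf_sum; apply: eq_bigr => q _.
by rewrite /bx_pt th_bx.
Qed.

Section Act.
Variable m : M pt.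
(** This defines the contraction from [box M N] to [M] that sends [x (x) n] to [x] multiplied by the
    pairing of [m] with [n]. *)
Lemma act_bal Z : box_bal (fun X Y (x : M X) (n : N Y) (h : bhom Z (gprod X Y)) =>
  mmap M (brunit X \bo bprod (bid X) (lpair m n) \bo h) x).
Proof.
split=> [X Y x x' n h|X Y x n n' h|X Y x n h h'|X X' Y Y' f g x n h].
- exact: raddfD.
- by rewrite lpairD bprodDr bcompDr bcompDl mmapD.
- by rewrite bcompDr mmapD.
rewrite -mmap_comp; congr (mmap M _ x).
rewrite lpair_map [LHS]bcompA [RHS]bcompA; congr (_ \bo h).
rewrite [LHS]bcompA -(brunit_nat f) -[LHS]bcompA -[RHS]bcompA; congr (_ \bo _).
by rewrite !bprod_comp !b1comp !bcomp1.
Qed.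
End Act.

(** Both sides contract [x (x) n_i] with [m_i]; on the right it is first
    rewritten as [(x n_i) . sum_j m_j (x) n_j]. *)
Lemma dual_basis Z (x : M Z) :
  x = \sum_(q <- l) \sum_(q' <- l) mmap M (lpair q.1 q'.2 \bo rpair x q.2) q'.1.
Proof.
(* First [x] is multiplied by the identity, expanded as in [sum_lpair]. *)
transitivity (\sum_(q <- l)
    mmap M (brunit Z \bo bprod (bid Z) (lpair q.1 q.2) \bo brununit Z) x).
  have mmap_sum (F : M pt * N pt -> bhom Z Z) :
      \sum_(q <- l) mmap M (F q) x = mmap M (\sum_(q <- l) F q) x.
    elim: l => [|q s IH]; last by rewrite !big_cons IH mmapD.
    rewrite !big_nil; apply: (addIr (mmap M 0 x)).
    by rewrite -mmapD !add0r.
  rewrite mmap_sum.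
  have -> : \sum_(q <- l) brunit Z \bo bprod (bid Z) (lpair q.1 q.2) \bo brununit Z =
      brunit Z \bo bprod (bid Z) (\sum_(q <- l) lpair q.1 q.2) \bo brununit Z.
    elim: l => [|q s IH]; last by rewrite !big_cons IH bprodDr bcompDr bcompDl.
    by rewrite !big_nil -(subrr (bid pt)) bprodBr bcompBr bcompBl subrr.
  by rewrite sum_lpair bprod1 bcomp1 brununitK mmap1.
apply: eq_bigr => q _.
have := box_Yoneda thK th'K (bx x q.2 (brununit Z)); rewrite th_bx -/(rpair x q.2).
move=> /(congr1 (box_lift (act_bal q.1 Z))); rewrite box_liftE => ->.
rewrite lE !raddf_sum; apply: eq_bigr => q' _.
rewrite /bx_pt mmap_boxE box_liftE; congr (mmap M _ _).
rewrite bcompA -(bcompA (brunit pt)) blununit_nat bcompA -brununit_pt brununitK.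
by rewrite b1comp.
Qed.

Definition counit_inv Z (x : M Z) : induced (meval M) Z :=
  \sum_(q <- l) \sum_(q' <- l)
    tn (lpair q.1 q'.2 \bo rpair x q.2 : bmod Z) (q'.1 : meval M).

Lemma counit_invD Z (x y : M Z) : counit_inv (x + y) = counit_inv x + counit_inv y.
Proof.
rewrite /counit_inv -big_split; apply: eq_bigr => q _ /=.
rewrite -big_split; apply: eq_bigr => q' _ /=.
by rewrite rpairD bcompDr tnDl.
Qed.

Lemma tn_act Z (c : bhom pt pt) (a : bmod Z) (m : meval M) :
  tn (c \bo a : bmod Z) m = tn a (mmap M c (m : M pt) : meval M).
Proof. by rewrite -(bendVK c) -mevalZ -tn_bal. Qed.

Lemma counit_invK Z : cancel (@counit_inv Z) (counit M Z).
Proof.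
move=> x; rewrite {2}[x]dual_basis /counit_inv raddf_sum; apply: eq_bigr => q _.
rewrite raddf_sum; apply: eq_bigr => q' _; exact: counitE.
Qed.

(** On [a (x) m] every coefficient is an endomorphism of the point composed with [a]; [tn_act] moves
    it across the tensor sign, where [dual_basis] at the point rebuilds [m]. *)
Lemma counitK Z : cancel (counit M Z) (@counit_inv Z).
Proof.
elim/tens_ind=> [a m||x y Hx Hy|x Hx].
- rewrite counitE [in RHS](dual_basis (m : M pt)) /counit_inv.
  have tn_sum (I : Type) (s : seq I) (F : I -> meval M) :
      tn a (\sum_(i <- s) F i) = \sum_(i <- s) tn a (F i).
    elim: s => [|i s IH]; first by rewrite !big_nil tn0r.
    by rewrite !big_cons tnDr IH.
  rewrite tn_sum; apply: eq_bigr => q _; rewrite tn_sum; apply: eq_bigr => q' _.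
  by rewrite rpair_map bcompA tn_act.
- rewrite raddf0; apply: (addIr (@counit_inv Z 0)).
  by rewrite -counit_invD !add0r.
- by rewrite raddfD counit_invD Hx Hy.
- rewrite raddfN; apply: (addIr (@counit_inv Z (counit M Z x))).
  rewrite -counit_invD addNr Hx addNr; apply: (addIr (@counit_inv Z 0)).
  by rewrite -counit_invD !add0r.
Qed.

Lemma counit_miso : miso (induced (meval M)) M.
Proof. exact: miso_of_cancel counitK counit_invK. Qed.

End InvertibleMackey.

(** * The isomorphism of Picard groups *)

Section Picard.
Variable gT : finGroupType.
Local Notation R := (burnside_ring gT).

Lemma invertible_induced (M N : mackey gT) :
  miso (box M N) (munit gT) -> miso (induced (meval M)) M.
Proof.
case=> th [th' [thK th'K]]; have [l lE] := pairing_ideal_one thK th'K.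
exact: (counit_miso thK th'K lE).
Qed.

Lemma induced_invertible (L : modules R) :
  invertible L -> @invertible (Mack gT) (induced L).
Proof.
case=> L' e; exists (induced L'); apply: miso_trans (induced_unit gT).
exact: miso_trans (induced_tens L L') (induced_iso e).
Qed.

(** If [N] is inverse to [M], both are extended from their values at the point, so the tensor
    product of these values is sent to [box M N], hence to the unit; [induced_inj] brings this
    isomorphism back to modules. *)
Lemma meval_invertible (M : Mack gT) :
  invertible M -> @invertible (modules R) (meval M).
Proof.
case=> N e; exists (meval N : lmodType R).
have e' : miso (box N M) (munit gT) := miso_trans (boxC N M) e.
apply: induced_inj; apply: miso_trans (miso_sym (induced_tens _ _)) _.
apply: miso_trans (miso_sym (induced_unit gT)).
exact: miso_trans (box_iso (invertible_induced e) (invertible_induced e')) e.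
Qed.

Definition pic_induced (c : Pic (modules R)) : Pic (Mack gT) :=
  pic_cls (induced_invertible (pic_rep_inv c)).

Lemma pic_inducedM : {morph pic_induced : c d / ab_op c d >-> ab_op c d}.
Proof.
move=> c d; rewrite /= pic_op_cls; apply/pic_cls_eq.
apply: miso_trans (miso_sym (induced_tens _ _)).
exact: induced_iso (pic_op_rep c d).
Qed.

Lemma pic_induced_inj : injective pic_induced.
Proof. by move=> c d /pic_cls_eq /induced_inj e; apply/pic_eqP. Qed.

Lemma pic_induced_surj (c : Pic (Mack gT)) : exists d, pic_induced d = c.
Proof.
have [N e] := pic_rep_inv c.
exists (pic_cls (meval_invertible (pic_rep_inv c))).
apply/pic_eqP; apply: mu_trans (pic_rep_cls _) _.
exact: miso_trans (induced_iso (pic_rep_cls (C := modules R) _)) (invertible_induced e).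
Qed.

End Picard.

Theorem theorem4p18 (gT : finGroupType) :
  ab_isomorphic (Pic (modules (burnside_ring gT))) (Pic (Mack gT)).
Proof.
exists (@pic_induced gT); split; last exact: pic_inducedM.
pose g (c : Pic (Mack gT)) := projT1 (cid (pic_induced_surj c)).
have gK : cancel g (@pic_induced gT) by move=> c; rewrite /g; case: cid.
by exists g => // c; apply: pic_induced_inj; rewrite gK.
Qed.
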